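(* Let $n\ge1$, $s\in(0,2)$, $\beta\in(0,1)$, and let $\mu$ be a nonnegative outer measure on $\mathbb{R}^{n+1}_+$. Let $p\in(1,n/\beta)$ and $q_0\in(0,\infty)$. For $f\in C_0^\infty(\mathbb{R}^n)$ let $u(x,t)=p^s_t\ast f(x)$ be its Caffarelli–Silvestre extension. Then there is a constant $C$ such that $$\|u\|_{L^{q_0,\infty}_\mu(\mathbb{R}^{n+1}_+)}\le C\|f\|_{\dot\Lambda^{p,\infty}_\beta(\mathbb{R}^n)}\qquad\text{for all } f\in C_0^\infty(\mathbb{R}^n)$$ if and only if there is a constant $C'$ such that $$\mu(T(O))\le C'\,\bigl(C^{p,\infty}_\beta(O)\bigr)^{q_0/p}\qquad\text{for every open set } O\subset\mathbb{R}^n.$$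
   Context: $\mathbb{R}^{n+1}_+=\mathbb{R}^n\times(0,\infty)$. The fractional Poisson kernel is $p^s_t(x)=\dfrac{c(n,s)\,t^s}{(|x|^2+t^2)^{(n+s)/2}}$, $c(n,s)=\dfrac{\Gamma((n+s)/2)}{\pi^{n/2}\Gamma(s/2)}$, and $p^s_t\ast f(x)=\int_{\mathbb{R}^n}p^s_t(x-y)f(y)\,dy$. Besov space: for $\beta\in(0,1)$, $\|f\|_{\dot\Lambda^{p,\infty}_\beta(\mathbb{R}^n)}=\sup_{h\in\mathbb{R}^n\setminus\{0\}}\|\Delta_h^1f\|_{L^p(\mathbb{R}^n)}|h|^{-\beta}$ with $\Delta_h^1f(x)=f(x+h)-f(x)$; the space $\dot\Lambda^{p,\infty}_\beta(\mathbb{R}^n)$ is the completion with respect to this norm of the set of all $f\in C_0^\infty(\mathbb{R}^n)$ with finite norm. Weak Lorentz norm: $\|g\|_{L^{q_0,\infty}_\mu(\mathbb{R}^{n+1}_+)}=\sup_{\lambda>0}\lambda\,\bigl(\mu(\{(x,t)\in\mathbb{R}^{n+1}_+:|g(x,t)|>\lambda\})\bigr)^{1/q_0}$. $\infty$-Besov capacity: for $E\subset\mathbb{R}^n$, $C^{p,\infty}_\beta(E)=\inf\{\|f\|^p_{\dot\Lambda^{p,\infty}_\beta(\mathbb{R}^n)}: f\in\dot\Lambda^{p,\infty}_\beta(\mathbb{R}^n)\cap C(\mathbb{R}^n)\text{ and } f\ge1_N\text{ on a neighbourhood } N\text{ of } E\}$, where $C(\mathbb{R}^n)$ is the class of continuous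 functions on $\mathbb{R}^n$ and $1_N$ is the characteristic function of $N$ (with $\inf\emptyset=+\infty$). Tent: for open $O\subset\mathbb{R}^n$, $T(O)=\{(x,t)\in\mathbb{R}^{n+1}_+:B(x,t)\subset O\}$, where $B(x,t)$ is the ball in $\mathbb{R}^n$ with centre $x$ and radius $t$. *)

(* Defs.v *)
From HB Require Import structures.
From mathcomp Require Import all_boot all_order all_algebra.
From mathcomp Require Import all_classical all_reals all_analysis.
Import Order.TTheory GRing.Theory Num.Theory.
Import numFieldNormedType.Exports.

Set Implicit Arguments.
Unset Strict Implicit.
Unset Printing Implicit Defensive.

Local Open Scope classical_set_scope.
Local Open Scope ring_scope.

(* R^n is 'rV[R]_n with its product sigma-algebra, generated by the coordinate
   functions; it coincides with the Borel sigma-algebra. *)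
Section measurable_rV.
Context {R : realType} {n : nat}.

Definition rV_coord (i : 'I_n) (x : 'rV[R]_n) : measurableTypeR R := x ord0 i.

Let rV_set0 : g_sigma_preimage rV_coord set0.
Proof. exact: sigma_algebra0. Qed.

Let rV_setC A : g_sigma_preimage rV_coord A ->
  g_sigma_preimage rV_coord (~` A).
Proof. exact: sigma_algebraC. Qed.

Let rV_bigcup (F : _^nat) : (forall i, g_sigma_preimage rV_coord (F i)) ->
  g_sigma_preimage rV_coord (\bigcup_i (F i)).
Proof. exact: sigma_algebra_bigcup. Qed.

HB.instance Definition _ := @isMeasurable.Build default_measure_display
  'rV[R]_n (g_sigma_preimage rV_coord) rV_set0 rV_setC rV_bigcup.

Lemma measurable_rV_coord (i : 'I_n) : measurable_fun setT (rV_coord i).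
Proof.
move=> _ Y mY; rewrite setTI; apply: sub_sigma_algebra => /=.
rewrite -bigcup_seq/=; exists i => /=; first by rewrite mem_index_enum.
by exists Y => //; rewrite setTI.
Qed.

Lemma measurable_fun_rV d (T : measurableType d) (f : T -> 'rV[R]_n) :
  (forall i, measurable_fun setT (rV_coord i \o f)) -> measurable_fun setT f.
Proof.
move=> mf _ A mA; rewrite setTI.
suff: g_sigma_preimage rV_coord `<=` [set A | measurable (f @^-1` A)] by apply.
apply: smallest_sub.
  split => /=.
  - by rewrite preimage_set0.
  - by move=> B mB; rewrite setTD preimage_setC; exact: measurableC.
  - by move=> F mF; rewrite preimage_bigcup; exact: bigcupT_measurable.
rewrite -bigcup_seq/=; apply: bigcup_sub => i _ _ [B mB <-] /=.
by rewrite setTI -comp_preimage -[X in measurable X]setTI; exact: mf.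
Qed.

End measurable_rV.

Section lebesgue_rV.
Context {R : realType}.

Definition rV_cons (n : nat) (z : measurableTypeR R * 'rV[R]_n) : 'rV[R]_n.+1 :=
  \row_(i < n.+1) oapp (fun j => z.2 ord0 j) z.1 (unlift ord0 i).

Definition rV_behead (n : nat) (x : 'rV[R]_n.+1) : 'rV[R]_n :=
  \row_(i < n) x ord0 (lift ord0 i).

Lemma measurable_rV_cons n : measurable_fun setT (@rV_cons n).
Proof.
apply: measurable_fun_rV => i.
rewrite (_ : _ \o _ = fun z =>
    oapp (fun j => rV_coord j z.2) z.1 (unlift ord0 i)); last first.
  by apply/funext => z; rewrite /= /rV_coord mxE.
case: (unliftP ord0 i) => [j _|_] /=; last exact: measurable_fst.
exact: (measurableT_comp (measurable_rV_coord j) measurable_snd).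
Qed.

Lemma measurable_rV_behead n : measurable_fun setT (@rV_behead n).
Proof.
apply: measurable_fun_rV => i.
rewrite (_ : _ \o _ = rV_coord (lift ord0 i)); first exact: measurable_rV_coord.
by apply/funext => x; rewrite /= /rV_coord mxE.
Qed.

Section lebesgue_rV_step.
Local Open Scope ereal_scope.
Variables (n : nat) (m : {sigma_finite_measure set 'rV[R]_n -> \bar R}).

Definition lebesgue_rV_step : set 'rV[R]_n.+1 -> \bar R :=
  pushforward (@lebesgue_measure R \x m) (@rV_cons n).

Let step_measurable A : measurable A -> measurable (@rV_cons n @^-1` A).
Proof.
by move=> mA; rewrite -[X in measurable X]setTI; exact: measurable_rV_cons.
Qed.

Let step0 : lebesgue_rV_step set0 = 0.
Proof. by rewrite /lebesgue_rV_step /pushforward preimage_set0 measure0. Qed.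

Let step_ge0 A : 0 <= lebesgue_rV_step A.
Proof. by rewrite /lebesgue_rV_step /pushforward; exact: measure_ge0. Qed.

Let step_sigma_additive : semi_sigma_additive lebesgue_rV_step.
Proof.
move=> F mF tF mUF; rewrite /lebesgue_rV_step /pushforward preimage_bigcup.
apply: measure_semi_sigma_additive.
- by move=> k; exact: step_measurable.
- apply/trivIsetP => /= i j _ _ ij; rewrite -preimage_setI.
  by move/trivIsetP : tF => /(_ _ _ _ _ ij) ->//; rewrite preimage_set0.
- by rewrite -preimage_bigcup; exact: step_measurable.
Qed.

HB.instance Definition _ := isMeasure.Build _ _ _ lebesgue_rV_step
  step0 step_ge0 step_sigma_additive.

Let step_sigma_finite : sigma_finite setT lebesgue_rV_step.
Proof.
have /sigma_finiteP[F [TF ndF Foo]] := sigma_finiteT (@lebesgue_measure R).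
have /sigma_finiteP[G [TG ndG Goo]] := sigma_finiteT m.
pose g (x : 'rV[R]_n.+1) : measurableTypeR R * 'rV[R]_n :=
  (rV_coord ord0 x, rV_behead x).
have mg : measurable_fun setT g.
  by apply/measurable_fun_pairP; split;
    [exact: measurable_rV_coord|exact: measurable_rV_behead].
have gK z : g (rV_cons z) = z.
  case: z => a v; rewrite /g /rV_coord mxE unlift_none /=; congr pair.
  by apply/rowP => j; rewrite !mxE liftK.
exists (fun k => g @^-1` (F k `*` G k)).
  apply/seteqP; split => // x _.
  have [i _ Fi] : (\bigcup_k F k) (g x).1 by rewrite -TF.
  have [j _ Gj] : (\bigcup_k G k) (g x).2 by rewrite -TG.
  exists (maxn i j) => //; split => /=.
  - by have /subsetPset := ndF _ _ (leq_maxl i j); apply.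
  - by have /subsetPset := ndG _ _ (leq_maxr i j); apply.
move=> k; have [mF Fky] := Foo k; have [mG Gky] := Goo k; split.
  by rewrite -[X in measurable X]setTI; apply: mg => //; exact: measurableX.
rewrite /lebesgue_rV_step /pushforward.
rewrite (_ : _ @^-1` _ = F k `*` G k); last first.
  by rewrite -comp_preimage (_ : g \o _ = id)//; apply/funext => z; exact: gK.
by rewrite product_measure1E// lte_mul_pinfty// ge0_fin_numE.
Qed.

HB.instance Definition _ := Measure_isSigmaFinite.Build _ _ _ lebesgue_rV_step
  step_sigma_finite.

End lebesgue_rV_step.

(* Lebesgue measure on R^n: the n-fold product of the Lebesgue measure on R. *)
Fixpoint lebesgue_rV (n : nat) : {sigma_finite_measure set 'rV[R]_n -> \bar R} :=
  match n with
  | 0 => \d_(0 : 'rV[R]_0)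
  | n'.+1 => lebesgue_rV_step (lebesgue_rV n')
  end.

Lemma lebesgue_rV_box (n : nat) (A : 'I_n -> set (measurableTypeR R)) :
  (forall i, measurable (A i)) ->
  lebesgue_rV n [set x | forall i, A i (x ord0 i)] =
    (\prod_(i < n) lebesgue_measure (A i))%E.
Proof.
elim: n A => [|n IH] A mA.
  by rewrite big_ord0 /= diracE mem_set//=; case.
have mB : measurable [set x : 'rV[R]_n | forall i, A (lift ord0 i) (x ord0 i)].
  rewrite [X in measurable X](_ : _ =
      \big[setI/setT]_(i < n) (rV_coord i @^-1` A (lift ord0 i))).
    apply: big_ind => // [B C|i _]; first exact: measurableI.
    by rewrite -[X in measurable X]setTI; exact: measurable_rV_coord.
  rewrite -bigcap_seq; apply/seteqP; split => x /= xA i.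
    by move=> _; exact: xA.
  by apply: (xA i); rewrite /= mem_index_enum.
rewrite big_ord_recl -IH// -product_measure1E//= /lebesgue_rV_step /pushforward.
congr (_ \x _)%E; apply/seteqP; split => -[a v] /=.
  move=> h; split; first by have := h ord0; rewrite mxE unlift_none.
  by move=> i; have := h (lift ord0 i); rewrite mxE liftK.
move=> [Aa Av] i; rewrite mxE; case: unliftP => [j|] -> //=.
Qed.

End lebesgue_rV.

Section euclidean.
Context {R : realType} {n : nat}.
Implicit Types (x : 'rV[R]_n) (f : 'rV[R]_n -> R).

(* The norm `|x| that the library puts on 'rV[R]_n is the sup norm. *)
Definition euclid_norm x : R := Num.sqrt (\sum_(i < n) x ord0 i ^+ 2).

Definition euclid_ball x (t : R) : set 'rV[R]_n :=
  [set y | euclid_norm (y - x) < t].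

Definition iter_partial (s : seq 'I_n) f : 'rV[R]_n -> R :=
  foldr (fun i g => 'D_(delta_mx ord0 i) g) f s.

(* Differentiability of all the iterated partial derivatives, the 0-th included,
   makes them all continuous. *)
Definition smooth f := forall s x, differentiable (iter_partial s f) x.

Definition test_function f := smooth f /\ compact (closure [set x | f x != 0]).

End euclidean.

Section poisson.
Context {R : realType}.

Definition Gamma (a : R) : R :=
  \int[lebesgue_measure]_(x in `]0, +oo[) (x `^ (a - 1) * expR (- x)).

Definition poisson_const (n : nat) (s : R) : R :=
  Gamma ((n%:R + s) / 2) / (pi `^ (n%:R / 2) * Gamma (s / 2)).

Definition poisson_kernel (n : nat) (s t : R) (x : 'rV[R]_n) : R :=
  poisson_const n s * t `^ s /
    (euclid_norm x ^+ 2 + t ^+ 2) `^ ((n%:R + s) / 2).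

Definition cs_extension (n : nat) (s : R) (f : 'rV[R]_n -> R)
    (x : 'rV[R]_n) (t : R) : R :=
  \int[lebesgue_rV n]_y (poisson_kernel s t (x - y) * f y).

End poisson.

Section besov.
Context {R : realType} {n : nat}.
Variables (p beta : R).
Implicit Types (f : 'rV[R]_n -> R) (E N : set 'rV[R]_n).
Local Open Scope ereal_scope.

Definition besov_norm f : \bar R :=
  ereal_sup [set Lnorm (lebesgue_rV n) p%:E (fun x => (f (x + h) - f x)%:E)
                 * (euclid_norm h `^ (- beta))%:E | h in [set h | h != 0%R]].

(* The completion is realised as a space of functions, as needed to speak of
   its continuous elements: for 1 < p < n / beta a Cauchy sequence of test
   functions converges in L^1_loc to a function f, and its class in the
   completion is identified with f.  It then also converges to f in [besov_norm]
   (Fatou), so the norm of the class, the limit of the norms, is [besov_norm f],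
   and f = 0 almost everywhere only for the null class.  Convergence in
   [besov_norm] alone would not do, since it vanishes on constants. *)
Definition besov_space : set ('rV[R]_n -> R) :=
  [set f | measurable_fun setT f /\
    exists phi : nat -> 'rV[R]_n -> R,
      [/\ forall k, test_function (phi k) /\ besov_norm (phi k) < +oo,
          besov_norm (phi k \- f)%R @[k --> \oo] --> 0 &
          forall K, compact K ->
            \int[lebesgue_rV n]_(x in K) `|(phi k x - f x)%:E| @[k --> \oo]
              --> 0]].

Definition besov_capacity E : \bar R :=
  ereal_inf [set besov_norm f `^ p | f in
    [set f | [/\ besov_space f, continuous f &
      exists N, E `<=` N° /\ forall x, N x -> (\1_N x <= f x)%R]]].

End besov.

Section half_space.
Context {R : realType} {n : nat}.

Definition half_space : Type := {z : 'rV[R]_n * R | 0 < z.2}.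

Definition tent (O : set 'rV[R]_n) : set half_space :=
  [set z | euclid_ball (val z).1 (val z).2 `<=` O].

Definition weak_norm (q : R) (mu : set half_space -> \bar R)
    (g : half_space -> R) : \bar R :=
  ereal_sup [set (lambda%:E * (mu [set z | (lambda < `|g z|)%R]) `^ q^-1)%E
            | lambda in [set lambda | 0 < lambda]].

End half_space.

Arguments half_space : clear implicits.

(* Main.v *)
(* From the capacitary condition to the weak type estimate: the nontangential
   maximal function N f (x) = sup {|u(y, t)| : |y - x| < t} satisfies
   |N f (x + h) - N f x| <= N (f(. + h) - f) (x), and N is bounded on L^p because
   it is dominated by the Hardy-Littlewood maximal function; hence
   ||N f|| <= C ||f|| in the Besov norm.  For a test function f, the function
   (2 / l) max (N f - l / 2, 0) is Lipschitz with compact support, hence in the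
   Besov space, and it is at least 1 on the open set O = {N f > l}, whose tent
   contains {|u| > l}.

   Conversely, let f be admissible for O.  Since mu is only countably subadditive,
   the tent is not exhausted by bounded pieces; instead f is the sum of a series of
   test functions g_k with ||g_k|| <= C 4^-k ||f||.  Test functions psi_k >= 0 close
   to |g_k| have almost the same norms, and on every ball contained in O the
   integral of sum psi_k is bounded below, so each point of the tent lies in
   {u_(psi_k) > c 2^-k} for some k; these sets have summable measures. *)
From HB Require Import structures.
Require Import Defs.
From mathcomp Require Import all_boot all_order all_algebra.
From mathcomp Require Import all_classical all_reals all_analysis.
From mathcomp Require Import measurable_realfun ring lra.
Import Order.TTheory GRing.Theory Num.Theory.
Import numFieldNormedType.Exports.

Set Implicit Arguments.
Unset Strict Implicit.
Unset Printing Implicit Defensive.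

Local Open Scope classical_set_scope.
Local Open Scope ring_scope.

(** * Lebesgue measure on R^n *)

(** The truncated maximal function must lie in the completion, not merely have finite norm; this is
    why the proof works with compactly supported Lipschitz functions. If [|e| <= a] and [e] is
    [L]-Lipschitz, then [|diff h e| <= (2 a)^(1 - beta) (L |h|)^beta]. Hence uniform approximation
    by test functions with a bounded Lipschitz constant is approximation in the Besov norm, and a
    lattice partition of unity provides such approximants. In the converse direction [|g_k|] is
    again Lipschitz and is replaced by a test function in the same way.

    The rates 4^-k for the norms and 2^-k for the thresholds meet two demands: the thresholds are
    summable, which contradicts the lower bound on a cube, and so are the [q0]-th powers of the
    quotients 2^-k, which bounds the measure of the tent.

    Positivity of the Poisson kernel requires the convergence of the Gamma integral, because the
    real-valued integral of a divergent positive function is 0 by convention. *)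

Section rV_norm.
Context {R : realType} {n : nat}.
Implicit Types (x y : 'rV[R]_n) (r : R).

Lemma rV_norm_ltP x r : 0 < r -> `|x| < r <-> forall i, `|x ord0 i| < r.
Proof.
move=> r0; rewrite -[`|x|]/(mx_norm x) mx_normrE; split => [/bigmax_ltP[_ h] i|h].
  exact: (h (ord0, i)).
by apply/bigmax_ltP; split => // -[i j] _ /=; rewrite (ord1 i).
Qed.

Lemma rV_norm_leP x r : 0 <= r -> `|x| <= r <-> forall i, `|x ord0 i| <= r.
Proof.
move=> r0; rewrite -[`|x|]/(mx_norm x) mx_normrE; split => [/bigmax_leP[_ h] i|h].
  exact: (h (ord0, i)).
by apply/bigmax_leP; split => // -[i j] _ /=; rewrite (ord1 i).
Qed.

Lemma rV_norm_coord x i : `|x ord0 i| <= `|x|.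
Proof. by move: i; apply/rV_norm_leP. Qed.

Lemma rV_norm_le_euclid x : `|x| <= euclid_norm x.
Proof.
apply/rV_norm_leP => [|i]; first exact: sqrtr_ge0.
rewrite -sqrtr_sqr ler_wsqrtr// (bigD1 i)//= lerDl.
by apply: sumr_ge0 => j _; exact: sqr_ge0.
Qed.

Lemma euclid_norm_le x : euclid_norm x <= n%:R * `|x|.
Proof.
rewrite -(ler_pXn2r (n:=2))// ?nnegrE ?sqrtr_ge0 ?mulr_ge0//.
rewrite sqr_sqrtr ?sumr_ge0// => [|i _]; last exact: sqr_ge0.
have /le_trans : \sum_(i < n) x ord0 i ^+ 2 <= \sum_(i < n) `|x| ^+ 2.
  by apply: ler_sum => i _; rewrite -real_normK ?num_real// ler_sqr ?nnegrE// rV_norm_coord.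
apply; rewrite sumr_const card_ord exprMn -[leLHS]mulr_natl ler_wpM2r ?sqr_ge0//.
by rewrite -natrX ler_nat; case: (n) => // m; rewrite expnS expn1 leq_pmulr.
Qed.

Lemma euclid_normN x : euclid_norm (- x) = euclid_norm x.
Proof. by congr Num.sqrt; apply: eq_bigr => i _; rewrite mxE sqrrN. Qed.

Lemma ballP x r y : ball x r y <-> `|x - y| < r.
Proof. by rewrite -ball_normE. Qed.

(** Balls of the library norm are open cubes. All averages and coverings below are over these cubes,
    whose volume is exactly [(2 * r) ^+ n]. *)
Lemma ballE x r : 0 < r ->
  ball x r = [set y : 'rV[R]_n | forall i, `]x ord0 i - r, x ord0 i + r[%classic (y ord0 i)].
Proof.
move=> r0; apply/seteqP; split => y.
  move=> /ballP/(rV_norm_ltP _ r0) h i /=; have := h i.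
  by rewrite !mxE in_itv/= ltr_distlC.
move=> /= h; apply/ballP/(rV_norm_ltP _ r0) => i; have := h i.
by rewrite !mxE in_itv/= ltr_distlC.
Qed.

End rV_norm.

Section rV_measure.
Context {R : realType} {n : nat}.
Implicit Types (x y h : 'rV[R]_n) (r : R) (A : set 'rV[R]_n) (f : 'rV[R]_n -> R).

Lemma measurable_box (A : 'I_n -> set (measurableTypeR R)) :
  (forall i, measurable (A i)) -> measurable [set x : 'rV[R]_n | forall i, A i (x ord0 i)].
Proof.
move=> mA.
rewrite [X in measurable X](_ : _ =
    \big[setI/setT]_(i < n) (rV_coord i @^-1` A i)).
  apply: big_ind => // [B C|i _]; first exact: measurableI.
  by rewrite -[X in measurable X]setTI; exact: measurable_rV_coord.
rewrite -bigcap_seq; apply/seteqP; split => x /= xA i.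
  by move=> _; exact: xA.
by apply: (xA i); rewrite /= mem_index_enum.
Qed.

Lemma measurable_rV_ball x r : measurable (ball x r).
Proof.
have [r0|r0] := ltP 0 r; last first.
  rewrite (_ : ball x r = set0)//; apply/seteqP; split => // y /ballP xy.
  by have := le_lt_trans (normr_ge0 _) xy; rewrite ltNge r0.
rewrite ballE//; apply: (measurable_box (A := fun i => `]x ord0 i - r, x ord0 i + r[%classic)) => i.
exact: measurable_itv.
Qed.

Lemma lebesgue_rV_ball x r : 0 < r ->
  lebesgue_rV n (ball x r) = ((2 * r) ^+ n)%:E.
Proof.
move=> r0; rewrite ballE//.
rewrite (@lebesgue_rV_box _ _ (fun i => `]x ord0 i - r, x ord0 i + r[%classic)) => [|i];
  last exact: measurable_itv.
under eq_bigr do rewrite lebesgue_measure_itv/= lte_fin ltrBlDr -addrA ltrDl addr_gt0//.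
rewrite (eq_bigr (fun=> (2 * r)%:E)) => [|i _]; last by rewrite -EFinD; congr EFin; ring.
by rewrite prodEFin prodr_const card_ord.
Qed.

(** The sigma-algebra is generated by the coordinates, so an open set is written as a countable
    union of boxes: the cubes with rational centre and radius [1 / (k + 1)] that it contains. *)
Lemma open_measurable_rV A : open A -> measurable A.
Proof.
move=> oA.
pose c (q : 'rV[rat]_n) : 'rV[R]_n := map_mx ratr q.
pose F (q : 'rV[rat]_n * nat) : set 'rV[R]_n :=
  if pselect (ball (c q.1) q.2.+1%:R^-1 `<=` A) then ball (c q.1) q.2.+1%:R^-1 else set0.
rewrite (_ : A = \bigcup_q F q).
  apply: countable_bigcupT_measurable => [|q]; first exact: countableP.
  rewrite /F.
  by case: pselect => [?|?] /=; [exact: measurable_rV_ball|exact: measurable0].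
apply/seteqP; split => x; last by move=> [q _]; rewrite /F; case: pselect => //; apply.
move=> Ax; have [e /= e0 xeA] := (nbhs_ballP x A).1 (open_nbhs_nbhs (conj oA Ax)).

have [k ke] : exists k, k.+1%:R^-1 < e / 2.
  have e20 : 0 < e / 2 by rewrite divr_gt0.
  by have [k _ hk] := near_infty_natSinv_lt (PosNum e20); exists k; apply: hk => /=.
have [q hq] : exists q : 'rV[rat]_n, `|c q - x| < k.+1%:R^-1.
  have hex i : exists q : rat, `|ratr q - x ord0 i| < k.+1%:R^-1.
    have /rat_in_itvoo[q] : x ord0 i - k.+1%:R^-1 < x ord0 i + k.+1%:R^-1.
      by rewrite ltrBlDr -addrA ltrDl addr_gt0// invr_gt0.
    by rewrite in_itv/= -ltr_distl; exists q.
  have [q hq] := choice hex; exists (\row_i q i).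
  by apply/rV_norm_ltP => // i; rewrite !mxE.
exists (q, k) => //; rewrite /F; case: pselect => /= [_|]; first exact/ballP.
case=> y /ballP qy; apply: xeA; apply/ballP.
have -> : x - y = (x - c q) + (c q - y) by rewrite addrA subrK.
rewrite (le_lt_trans (ler_normD _ _))// (splitr e) ltrD//; last exact: lt_trans ke.
by rewrite distrC; exact: lt_trans ke.
Qed.

Lemma closed_measurable_rV A : closed A -> measurable A.
Proof. by move/closed_openC/open_measurable_rV/measurableC; rewrite setCK. Qed.

Lemma continuous_measurable_rV f : continuous f -> measurable_fun setT f.
Proof.
move=> /continuousP cf; apply: (measurability _ (measurable_realfun.RGenOpens.measurableE R)) => //.
move=> _ [_ [a [b ->] <-]]; rewrite setTI; apply: open_measurable_rV.
by apply: cf; exact: interval_open.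
Qed.

Lemma measurable_shift h : measurable_fun setT (fun x : 'rV[R]_n => x + h).
Proof.
apply: measurable_fun_rV => i.
rewrite (_ : _ \o _ = fun x => (rV_coord i x : R) + h ord0 i); last first.
  by apply/funext => x; rewrite /= /rV_coord mxE.
by apply: measurable_funD => //; exact: measurable_rV_coord.
Qed.

End rV_measure.

Lemma lebesgue_measure_shift (R : realType) (a : R) (A : set (measurableTypeR R)) :
  measurable A ->
  pushforward (@lebesgue_measure R) ((+%R)^~ a : measurableTypeR R -> measurableTypeR R) A
    = lebesgue_measure A.
Proof.
move=> mA.
have ms : measurable_fun setT ((+%R)^~ a : measurableTypeR R -> measurableTypeR R).
  exact: measurable_funD.
pose phi : {mfun measurableTypeR R >-> measurableTypeR R} :=
      HB.pack ((+%R)^~ a : measurableTypeR R -> measurableTypeR R)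
        (isMeasurableFun.Build _ _ _ _ _ ms).
apply/esym/(@lebesgue_measure_unique _ (pushforward (@lebesgue_measure R) phi)) => //= _ [[u v]] _ <-.
rewrite /pushforward (_ : _ @^-1` _ = `]u - a, v - a]%classic); last first.
  by apply/seteqP; split => x; rewrite /= !in_itv/= ltrBlDr lerBrDr.
rewrite !lebesgue_measure_itv/= !lte_fin ltrD2r.
by case: ifP => // _; rewrite -!EFinB; congr EFin; ring.
Qed.

Section rV_translation.
Context {R : realType} {n : nat}.
Implicit Types (x y h : 'rV[R]_n) (r : R) (A : set 'rV[R]_n).

(** Two measures that agree on the boxes, a family stable under intersection, coincide; the cubes
    [ball 0 k.+1%:R] exhaust the space with finite measure. On a box the claim is
    [lebesgue_measure_shift] in each coordinate. *)
Lemma lebesgue_rV_shift h A : measurable A ->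
  pushforward (lebesgue_rV n) (+%R^~ h) A = lebesgue_rV n A.
Proof.
move=> mA.
pose phi : {mfun 'rV[R]_n >-> 'rV[R]_n} :=
    HB.pack (fun x : 'rV[R]_n => x + h)
      (isMeasurableFun.Build _ _ _ _ _ (measurable_shift h)).
pose box (A : 'I_n -> set (measurableTypeR R)) := [set x : 'rV[R]_n | forall i, A i (x ord0 i)].
apply/esym; pose G := [set B | exists2 A, (forall i, measurable (A i)) & box A = B].
apply: (@measure_unique _ R 'rV[R]_n G (fun k => ball 0 k.+1%:R) _ _ _ _
  (lebesgue_rV n) (pushforward (lebesgue_rV n) phi)) => //.
- apply/seteqP; split.
    apply: smallest_sub; first exact: smallest_sigma_algebra.
    move=> B; rewrite -bigcup_seq => -[i _ [C mC <-]]; apply: sub_sigma_algebra.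
    exists (fun j => if j == i then C else setT); first by move=> j; case: ifP.
    rewrite /box setTI; apply/seteqP; split => x /=; last first.
      by move=> Cx j; case: eqVneq => // ->.
    by move=> /(_ i); rewrite eqxx.
  apply: smallest_sub; first exact: sigma_algebra_measurable.
  by move=> _ [C mC <-]; exact: measurable_box.
- move=> _ _ [C mC <-] [D mD <-]; exists (fun i => C i `&` D i).
    by move=> i; exact: measurableI.
  apply/seteqP; split => x /=; first by move=> h'; split => i; have [] := h' i.
  by move=> [h1 h2] i; split.
- move=> k; rewrite ballE//; exists (fun i => `](0:'rV[R]_n) ord0 i - k.+1%:R,
      (0:'rV[R]_n) ord0 i + k.+1%:R[%classic) => //.
- apply/seteqP; split => // x _.
  exists (Num.truncn `|x|) => //; apply/ballP.
  by rewrite sub0r normrN truncnS_gt.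
- move=> _ [C mC <-]; apply: etrans; first exact: lebesgue_rV_box mC.
  have mC' i : measurable ((+%R^~ (h ord0 i) : measurableTypeR R -> measurableTypeR R) @^-1` C i).
    have ms : measurable_fun setT ((+%R)^~ (h ord0 i) : measurableTypeR R -> measurableTypeR R).
      exact: measurable_funD.
    by rewrite -[X in measurable X]setTI; exact: ms.
  apply/esym; apply: etrans (etrans (lebesgue_rV_box mC') _).
    congr (lebesgue_rV n _); apply/seteqP.
    by split => x hx i; have := hx i; rewrite /= mxE.
  by apply: eq_bigr => i _; exact: lebesgue_measure_shift.
- move=> k; apply: (@le_lt_trans _ _ ((2 * k.+1%:R) ^+ n)%:E); last exact: ltry.
  by rewrite -(lebesgue_rV_ball 0).
Qed.

Local Open Scope ereal_scope.

Lemma ge0_integral_shift h (f : 'rV[R]_n -> \bar R) :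
  measurable_fun setT f -> (forall x, 0 <= f x) ->
  \int[lebesgue_rV n]_x f (x + h)%R = \int[lebesgue_rV n]_x f x.
Proof.
move=> mf f0; have := @ge0_integral_pushforward _ _ _ _ R _ (measurable_shift h)
  (lebesgue_rV n) setT f measurableT mf (fun _ _ => f0 _).
rewrite preimage_setT => <-.
apply: (@eq_measure_integral _ _ _ _ _
    (pushforward (lebesgue_rV n) (fun x : 'rV[R]_n => x + h)%R)) => [|ms A mA _].
  exact: measurable_shift.
by first [exact: lebesgue_rV_shift | apply: esym; exact: lebesgue_rV_shift
  | rewrite -[LHS](lebesgue_rV_shift h)].
Qed.

Lemma integral_shift h (f : 'rV[R]_n -> \bar R) : measurable_fun setT f ->
  \int[lebesgue_rV n]_x f (x + h)%R = \int[lebesgue_rV n]_x f x.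
Proof.
move=> mf; rewrite integralE [RHS]integralE; congr (_ - _).
  rewrite -(ge0_integral_shift h (f := f^\+)) => [||x //]; last exact: measurable_funepos.
  by apply: eq_integral => x _; rewrite !funeposE.
rewrite -(ge0_integral_shift h (f := f^\-)) => [||x //]; last exact: measurable_funeneg.
by apply: eq_integral => x _; rewrite !funenegE.
Qed.

End rV_translation.

(** * Approximation of Lipschitz functions by test functions *)

Section smooth_R.
Context {R : realType}.
Implicit Types (f g : R -> R) (k m : nat) (x : R).

(** Each order carries its derivative as a witness, so that the rules for sums, products and
    inverses are inductions on [k]. *)
Fixpoint n_derivable k f : Prop :=
  if k is k'.+1 then exists2 f' : R -> R, forall x : R, is_derive x (1 : R) f (f' x) & n_derivable k' f'
  else True.

Definition smooth_R f := forall k, n_derivable k f.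

Lemma n_derivableW k f : n_derivable k.+1 f -> n_derivable k f.
Proof.
by elim: k f => // k IH f [f' ff' /IH]; exists f'.
Qed.

Lemma n_derivable_cst k (c : R) : n_derivable k (cst c).
Proof.
elim: k c => // k IH c; exists (cst 0) => // x; exact: is_derive_cst.
Qed.

Lemma n_derivableD k f g : n_derivable k f -> n_derivable k g ->
  n_derivable k (f \+ g).
Proof.
elim: k f g => // k IH f g [f' ff' kf] [g' gg' kg].
by exists (f' \+ g'); [move=> x; exact: is_deriveD|exact: IH].
Qed.

Lemma n_derivableM k f g : n_derivable k f -> n_derivable k g ->
  n_derivable k (f \* g).
Proof.
elim: k f g => // k IH f g kf kg; have [f' ff' kf'] := kf; have [g' gg' kg'] := kg.
exists ((f \* g') \+ (g \* f')); last first.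
  by apply: n_derivableD; apply: IH => //; exact: n_derivableW.
by move=> x; exact: is_deriveM.
Qed.

Lemma n_derivableZ k f (c : R) : n_derivable k f -> n_derivable k (fun x => c * f x).
Proof. by move=> kf; apply: n_derivableM => //; exact: n_derivable_cst. Qed.

(** The derivative of [1 / f] contains [1 / f] again, but only one order less is needed of it, which
    the induction supplies. *)
Lemma n_derivableV k f : (forall x, f x != 0) -> n_derivable k f ->
  n_derivable k (fun x => (f x)^-1).
Proof.
move=> f0; elim: k => // k IH kf; have [f' ff' kf'] := kf.
have kV := IH (n_derivableW kf).
exists (fun x => -1 * ((f x)^-1 * (f x)^-1 * f' x)).
  move=> x; apply: is_derive_eq (is_deriveV (f0 x) (ff' x)) _.
  by rewrite -[LHS]/(_ * _) expr2 invfM !mulNr mul1r.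
by apply: n_derivableZ; apply: n_derivableM => //; exact: n_derivableM.
Qed.

Lemma n_derivable_affine k f (a b : R) : n_derivable k f ->
  n_derivable k (fun x => f (a * x + b)).
Proof.
elim: k f => // k IH f [f' ff' kf].
exists (fun x => a * f' (a * x + b)); last by apply: n_derivableZ; exact: IH.
move=> x; rewrite mulrC.
have da : is_derive x (1 : R) (fun x => a * x + b) a.
  rewrite -[X in is_derive _ _ _ X]addr0; apply: is_deriveD.
  by rewrite -[X in is_derive _ _ _ X]mulr1; exact: is_deriveZ.
exact: (is_derive1_comp (f := f) (g := fun x => a * x + b)).
Qed.

(* The flat functions t^-m exp(-1/t), t > 0; the m-th one occurs in the
   m-th derivatives of the 0-th one. *)
Definition flat m (t : R) : R := if 0 < t then t ^- m * expR (- t^-1) else 0.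

(** [expR t^-1] dominates its Taylor term of degree [m.+1]. The linear bound gives the continuity of
    [flat m] at the origin. *)
Lemma flat_le m t : `|flat m t| <= m.+1`!%:R * `|t|.
Proof.
rewrite /flat; case: ifPn => [t0|_]; last by rewrite normr0 mulr_ge0.
rewrite gtr0_norm ?mulr_gt0 ?expR_gt0 ?invr_gt0 ?exprn_gt0// gtr0_norm// expRN.
rewrite ler_pdivrMr ?expR_gt0//.
have := @expR_ge1Dxn R t^-1 m; rewrite invr_ge0 (ltW t0) => /(_ isT) h.
have key : t^-1 ^+ m.+1 <= m.+1`!%:R * expR t^-1.
  rewrite -ler_pdivrMl ?ltr0n ?fact_gt0// mulrC (le_trans _ h)//.
  by rewrite lerDr.
have -> : t ^- m = t * t^-1 ^+ m.+1.
  by rewrite exprS mulrA divff ?gt_eqF// mul1r exprVn.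
by rewrite [_ * t]mulrC -mulrA ler_wpM2l// ltW.
Qed.

Lemma is_derive_flat m x :
  is_derive x (1 : R) (flat m) (- m%:R * flat m.+1 x + flat m.+2 x).
Proof.
have [x0|x0|->] := ltgtP x 0.
- rewrite {2 3}/flat !ifF ?ltNge ?(ltW x0)//= mulr0 addr0.
  apply: (near_eq_is_derive (f := cst 0)).
  near=> y; rewrite /flat ifF//; apply/negbTE; rewrite -leNgt ltW//; near: y.
  exact: lt_nbhsl.
- have xn0 : x != 0 by rewrite gt_eqF.
  apply: (@near_eq_is_derive R R R (fun t : R => (t ^-1) ^+ m * expR (- t^-1))).
    near=> y; rewrite /flat ifT ?exprVn//; near: y; exact: lt_nbhsr.
  have dV : is_derive x (1 : R) (fun t : R => t^-1) (- x ^- 2).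
    apply: is_derive_eq (is_deriveV xn0 (is_derive_id _ _)) _.
    by rewrite -[LHS]/(_ * _) mulr1.
  have dN : is_derive x (1 : R) (fun t : R => - t^-1) (x ^- 2).
    by apply: is_derive_eq (is_deriveN _) _; rewrite opprK.
  have dE : is_derive x (1 : R) (fun t : R => expR (- t^-1)) (expR (- x^-1) * x ^- 2).
    exact: (is_derive1_comp (f := expR) (g := fun t => - t^-1)).
  have dX : is_derive x (1 : R) (fun t : R => t^-1 ^+ m) ((m%:R * x^-1 ^+ m.-1) * - x ^- 2).
    rewrite (_ : (fun _ => _) = (fun t : R => t^-1) ^+ m); first exact: (is_deriveX m dV).
    by apply/funext => t; rewrite !fctE.
  apply: is_derive_eq (is_deriveM dX dE) _.
  rewrite /flat x0 -[LHS]/(_ * _ + _ * _).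
  rewrite -!exprVn; move: (expR _) => e.
  case: m dX => [|m] _ /=; first by rewrite !exprS !expr0 mul0r; ring.
  by rewrite !exprS; move: (m.+1%:R : R) (x^-1 ^+ m) => M y; ring.
(* At the origin the difference quotient of [flat m] is [flat m.+1] itself, which tends to 0 by
   [flat_le]. *)
- apply/is_derive1_caratheodory; exists (flat m.+1); split.
  + move=> z; rewrite subr0 /flat ltxx subr0; case: ifPn => z0; last by rewrite mul0r.
    by rewrite exprS invfM [RHS]mulrC !mulrA divff ?gt_eqF// mul1r.
  + rewrite /prop_for /continuous_at [flat _ 0]/flat ltxx.
    apply/cvgr0Pnorm_le => e e0; near=> z; rewrite (le_trans (flat_le _ _))//.
    rewrite -ler_pdivlMl ?ltr0n ?fact_gt0//; near: z.
    apply: (@cvgr0_norm_le _ _ _ _ _ id); first exact: cvg_id.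
    by rewrite mulr_gt0// invr_gt0 ltr0n fact_gt0.
  + by rewrite /flat ltxx mulr0 addr0.
Unshelve. all: by end_near. Qed.

Lemma smooth_flat m : smooth_R (flat m).
Proof.
move=> k; elim: k m => // k IH m.
exists (fun x => - m%:R * flat m.+1 x + flat m.+2 x); first exact: is_derive_flat.
by apply: n_derivableD => //; exact: n_derivableZ.
Qed.

(** The standard smooth transition from 0 to 1 on [[0, 1]]; the denominator is positive because [t]
    or [1 - t] is. *)
Definition smoothstep (t : R) : R := flat 0 t / (flat 0 t + flat 0 (1 - t)).

Let flat0_ge0 t : 0 <= flat 0 t.
Proof. by rewrite /flat expr0 invr1 mul1r; case: ifP => // _; exact: expR_ge0. Qed.

Let flat0_gt0 t : 0 < t -> 0 < flat 0 t.
Proof. by rewrite /flat expr0 invr1 mul1r => ->; exact: expR_gt0. Qed.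

Let flat0_eq0 t : t <= 0 -> flat 0 t = 0.
Proof. by rewrite /flat => t0; rewrite ifF// ltNge t0. Qed.

Let smoothstep_den t : 0 < flat 0 t + flat 0 (1 - t).
Proof.
have [t0|t0] := ltP 0 t; first by rewrite ltr_pwDl// flat0_gt0.
by rewrite ltr_wpDl// flat0_gt0// subr_gt0 (le_lt_trans t0).
Qed.

Lemma smooth_smoothstep : smooth_R smoothstep.
Proof.
move=> k; apply: n_derivableM; first exact: smooth_flat.
apply: n_derivableV => [x|]; first by rewrite gt_eqF// smoothstep_den.
apply: n_derivableD; first exact: smooth_flat.
rewrite (_ : (fun _ => _) = fun t => flat 0 (-1 * t + 1)).
  by apply: n_derivable_affine; exact: smooth_flat.
by apply/funext => t; rewrite mulN1r addrC.
Qed.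

Lemma smoothstep_le0 t : t <= 0 -> smoothstep t = 0.
Proof. by move=> t0; rewrite /smoothstep flat0_eq0// mul0r. Qed.

Lemma smoothstep_ge1 t : 1 <= t -> smoothstep t = 1.
Proof.
move=> t1; rewrite /smoothstep [flat 0 (1 - t)]flat0_eq0 ?subr_le0// addr0 divff//.
by rewrite gt_eqF// flat0_gt0// (lt_le_trans ltr01).
Qed.

Lemma smoothstep01 t : 0 <= smoothstep t <= 1.
Proof.
rewrite divr_ge0 ?(ltW (smoothstep_den _))//= ler_pdivrMr ?smoothstep_den//.
by rewrite mul1r lerDl.
Qed.

(** Clamping the argument to [[0, 1]] does not change [smoothstep], so the maximum of the modulus of
    its derivative on this compact interval is a global Lipschitz constant. *)
Lemma smoothstep_lipschitz : exists2 l : R, 0 <= l &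
  forall a b, `|smoothstep a - smoothstep b| <= l * `|a - b|.
Proof.
have [g sg [g' gg' _]] := smooth_smoothstep 2.
have cg : continuous g.
  by move=> x; apply/differentiable_continuous/derivable1_diffP; have [] := gg' x.
have cs : continuous smoothstep.
  by move=> x; apply/differentiable_continuous/derivable1_diffP; have [] := sg x.
have [c _ cmax] : exists2 c, c \in `[0, 1]%R & forall t, t \in `[0, 1]%R -> `|g t| <= `|g c|.
  apply: EVT_max => //; apply: continuous_subspaceT => x.
  by apply: continuous_comp; [exact: cg|exact: norm_continuous].
exists `|g c| => // a b.
pose cl (t : R) := Num.max 0 (Num.min t 1).
have scl t : smoothstep (cl t) = smoothstep t.
  rewrite /cl; have [t1|t1] := leP t 1.
    by have [t0|//] := leP t 0; rewrite !smoothstep_le0.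
  by rewrite max_r// !smoothstep_ge1// ltW.
rewrite -(scl a) -(scl b).
have cl01 t : 0 <= cl t <= 1.
  by rewrite /cl le_max lexx /= ge_max ler01 ge_min lexx orbT.
have clL : `|cl a - cl b| <= `|a - b|.
  have h1 := ler_norm (a - b); have h2 := ler_norm (b - a); rewrite distrC in h2.
  by rewrite /cl /Num.max /Num.min; do !case: ifPn; rewrite -?leNgt => *;
    rewrite ler_norml; apply/andP; split; lra.
apply: (@le_trans _ _ (`|g c| * `|cl a - cl b|)); last by rewrite ler_wpM2l.
move: (cl01 a) (cl01 b); move: (cl a) (cl b) => {clL scl cl01}{}a {}b a01 b01.
wlog ab : a b a01 b01 / a <= b => [h|].
  have [/h|/ltW/h] := leP a b; first exact.
  by rewrite distrC [`|a - b|]distrC; apply.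
have [d dab] := @MVT_segment R smoothstep g a b ab (fun x _ => sg x) (continuous_subspaceT cs).
rewrite distrC [`|a - b|]distrC => ->; rewrite normrM ler_wpM2r//; apply: cmax.
move: dab; rewrite !in_itv/= => /andP[ad db].
by have /andP[a0 _] := a01; have /andP[_ b1] := b01; rewrite (le_trans a0)// (le_trans db).
Qed.

(** A difference of shifted steps, so that integer translates telescope and form a partition of
    unity. *)
Definition bump (t : R) : R := smoothstep (t + 1) - smoothstep t.

Lemma smooth_bump : smooth_R bump.
Proof.
move=> k; rewrite /bump (_ : (fun _ => _) =
   (fun t => smoothstep (1 * t + 1)) \+ (fun t => -1 * smoothstep t)).
  apply: n_derivableD; first by apply: n_derivable_affine; exact: smooth_smoothstep.
  by apply: n_derivableZ; exact: smooth_smoothstep.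
by apply/funext => t /=; rewrite mul1r mulN1r.
Qed.

Lemma bump_ge0 t : 0 <= bump t.
Proof.
have [t0|t0] := leP t 0.
  by rewrite /bump (smoothstep_le0 t0) subr0; have /andP[] := smoothstep01 (t + 1).
rewrite /bump smoothstep_ge1 ?lerDr ?(ltW t0)// subr_ge0.
by have /andP[] := smoothstep01 t.
Qed.

Lemma bump_eq0 t : 1 <= `|t| -> bump t = 0.
Proof.
rewrite ler_normr => /orP[t1|t1]; rewrite /bump.
  by rewrite !smoothstep_ge1 ?subrr//; lra.
by rewrite !smoothstep_le0 ?subrr//; lra.
Qed.

Lemma bump_lipschitz : exists2 l : R, 0 <= l &
  forall a b, `|bump a - bump b| <= l * `|a - b|.
Proof.
have [l l0 lL] := smoothstep_lipschitz; exists (l + l); first exact: addr_ge0.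
move=> a b; have := lL (a + 1) (b + 1); have := lL a b.
rewrite (_ : a + 1 - (b + 1) = a - b); last by ring.
rewrite (_ : bump a - bump b = (smoothstep (a + 1) - smoothstep (b + 1)) -
   (smoothstep a - smoothstep b)); last by rewrite /bump; ring.
by move=> h1 h2; rewrite mulrDl (le_trans (ler_normB _ _))// lerD.
Qed.

(** The index [j] encodes the integer [j - K], which runs from [-K] to [K]. *)
Lemma sum_bump K t : \sum_(j < K.*2.+1) bump (t - (j%:R - K%:R)) =
  smoothstep (t + K%:R + 1) - smoothstep (t - K%:R).
Proof.
pose G j := - smoothstep (t + K%:R + 1 - j%:R).
rewrite (eq_bigr (fun j : 'I_K.*2.+1 => G j.+1 - G j)) => [|j _].
  rewrite -(big_mkord xpredT (fun j => G j.+1 - G j)) telescope_sumr//.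
  rewrite /G subr0 opprK addrC; congr (_ - smoothstep _).
  by rewrite -addnn -addn1 !natrD; ring.
rewrite /G /bump opprK [RHS]addrC; congr (smoothstep _ - smoothstep _); first by ring.
by rewrite -(natr1 j); ring.
Qed.

Lemma sum_bump_le1 K t : \sum_(j < K.*2.+1) bump (t - (j%:R - K%:R)) <= 1.
Proof.
rewrite sum_bump; have /andP[_ h1] := smoothstep01 (t + K%:R + 1).
by have /andP[h2 _] := smoothstep01 (t - K%:R); lra.
Qed.

Lemma sum_bump1 K t : `|t| <= K%:R ->
  \sum_(j < K.*2.+1) bump (t - (j%:R - K%:R)) = 1.
Proof.
rewrite ler_norml => /andP[h1 h2].
by rewrite sum_bump smoothstep_ge1 ?smoothstep_le0 ?subr0//; lra.
Qed.

End smooth_R.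

Section smooth_R_derive.
Context {R : realType}.

(** The witnesses of [smooth_R f] may differ from one order to another; uniqueness of the derivative
    identifies them. *)
Lemma smooth_R_derive (f : R -> R) : smooth_R f ->
  exists2 f' : R -> R, forall x : R, is_derive x (1 : R) f (f' x) & smooth_R f'.
Proof.
move=> sf; have [f' ff' _] := sf 1%N.
exists f' => // k; have [g fg kg] := sf k.+1.
rewrite (_ : f' = g)//; apply/funext => x.
have [_ <-] := ff' x; have [_ <-] := fg x.
by [].
Qed.

End smooth_R_derive.

(** * Smoothness in several variables through tensor products *)

Section tensor.
Context {R : realType} {n : nat}.
Implicit Types (F : 'I_n -> R -> R) (x : 'rV[R]_n).

Definition tensor F x : R := \prod_(i < n) F i (x ord0 i).

Lemma differentiable_prod_coord F x (s : seq 'I_n) :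
  (forall i, differentiable (F i) (x ord0 i)) ->
  differentiable (fun y : 'rV[R]_n => \prod_(i <- s) F i (y ord0 i)) x.
Proof.
move=> dF; elim: s => [|i s IH].
  rewrite (_ : (fun _ => _) = cst 1); first exact: differentiable_cst.
  by apply/funext => y; rewrite big_nil.
rewrite (_ : (fun _ => _) = (fun y : 'rV[R]_n => F i (y ord0 i) : R) *
   (fun y : 'rV[R]_n => \prod_(j <- s) F j (y ord0 j))); last first.
  by apply/funext => y; rewrite big_cons.
apply: differentiableM => //.
apply: (differentiable_comp (f := fun y : 'rV[R]_n => y ord0 i : R)) => //.
exact: differentiable_coord.
Qed.

Lemma derive_tensor F (F' : R) x i : is_derive (x ord0 i) (1 : R) (F i) F' ->
  'D_(delta_mx ord0 i) (tensor F) x = F' * \prod_(j < n | j != i) F j (x ord0 j).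
Proof.
move=> [dF <-]; apply: cvg_lim => //.
rewrite (_ : (fun h => _) = (fun h : R => (h^-1 *: ((F i \o shift (x ord0 i)) (h *: 1) - F i (x ord0 i))) *
   \prod_(j < n | j != i) F j (x ord0 j))).
  by apply: cvgM; [exact: dF|exact: cvg_cst].
apply/funext => h; rewrite /tensor/= -[RHS]scalerAl mulrBl; congr (_ *: (_ - _)).
  rewrite (bigD1 i)//=; congr (F i _ * _); first by rewrite !mxE !eqxx/=.
  apply: eq_bigr => j ji; congr (F j _).
  by rewrite !mxE (negbTE ji) andbF mulr0 add0r.
by rewrite (bigD1 i).
Qed.

(** This span consists of differentiable functions and is stable under partial derivatives, so
    [smooth] follows by induction on the list of directions from one-variable calculus. *)
Inductive tensor_span : ('rV[R]_n -> R) -> Prop :=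
| tensor_span0 : tensor_span (cst 0)
| tensor_spanD (c : R) F f : (forall i, smooth_R (F i)) -> tensor_span f ->
    tensor_span (fun x => c * tensor F x + f x).

Lemma tensor_span_derive (f : 'rV[R]_n -> R) : tensor_span f ->
  (forall x, differentiable f x) /\
  forall i, tensor_span ('D_(delta_mx ord0 i) f).
Proof.
elim=> [|c F {}f sF _ [df Df]].
  split=> [x|i]; first exact: differentiable_cst.
  rewrite (_ : 'D_ _ _ = cst 0); first exact: tensor_span0.
  by apply/funext => x; exact: derive_cst.
have [F' FF' sF'] : exists2 F' : 'I_n -> R -> R,
    forall i (t : R), is_derive t (1 : R) (F i) (F' i t) & forall i, smooth_R (F' i).
  have h i : exists f' : R -> R, (forall t : R, is_derive t (1 : R) (F i) (f' t)) /\ smooth_R f'.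
    by have [f' h1 h2] := smooth_R_derive (sF i); exists f'.
  by have [F' h'] := choice h; exists F' => i; [move=> t|]; have [] := h' i.
have dT x : differentiable (tensor F) x.
  apply: differentiable_prod_coord => i; apply/derivable1_diffP.
  by have [] := FF' i (x ord0 i).
have E : (fun x => c * tensor F x + f x) = c *: tensor F + f by [].
split=> [x|i].
  by rewrite E; apply: differentiableD => //; exact: differentiableZ.
pose G j := if j == i then F' j else F j.
rewrite (_ : 'D_ _ _ = fun x => c * tensor G x + 'D_(delta_mx ord0 i) f x).
  by apply: tensor_spanD => // j; rewrite /G; case: ifP.
apply/funext => x; rewrite E deriveD; last 2 first.
- by apply: diff_derivable; exact: differentiableZ.
- exact: diff_derivable.
rewrite deriveZ; last exact: diff_derivable.
rewrite (derive_tensor (FF' i (x ord0 i))); congr (_ * _ + _).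
rewrite /tensor [RHS](bigD1 i)//= /G eqxx; congr (_ * _).
by apply: eq_bigr => j /negbTE ->.
Qed.

Lemma smooth_tensor_span (f : 'rV[R]_n -> R) : tensor_span f -> smooth f.
Proof.
move=> sf s; apply: (tensor_span_derive _).1; elim: s => //= i s IH.
exact: (tensor_span_derive IH).2.
Qed.

Lemma tensor_span_sum (I : Type) (s : seq I) (c : I -> R) (F : I -> 'I_n -> R -> R) :
  (forall k i, smooth_R (F k i)) ->
  tensor_span (fun x => \sum_(k <- s) c k * tensor (F k) x).
Proof.
move=> sF; elim: s => [|k s IH].
  rewrite (_ : (fun _ => _) = cst 0); first exact: tensor_span0.
  by apply/funext => x; rewrite big_nil.
rewrite (_ : (fun _ => _) = (fun x => c k * tensor (F k) x + \sum_(j <- s) c j * tensor (F j) x)).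
  exact: tensor_spanD.
by apply/funext => x; rewrite big_cons.
Qed.

End tensor.

(** * Variation of the partition of unity, uniformly in the number of lattice points *)

Section lattice_sums.
Context {R : realType} {n : nat}.

(** The factors of one product are exchanged for those of the other one coordinate at a time. In
    each exchange the sum over [k] factorizes, and the other coordinates contribute at most 1. *)
Lemma sum_dist_prod_le (J : finType) (a b : 'I_n -> J -> R) :
  (forall i j, 0 <= a i j) -> (forall i, \sum_j a i j <= 1) ->
  (forall i j, 0 <= b i j) -> (forall i, \sum_j b i j <= 1) ->
  \sum_(k : {ffun 'I_n -> J}) `|\prod_i a i (k i) - \prod_i b i (k i)| <=
    \sum_i \sum_j `|a i j - b i j|.
Proof.
move=> a0 a1 b0 b1.
pose w (m : nat) (i : 'I_n) j := if (i < m)%N then a i j else b i j.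
have w0 m i j : 0 <= w m i j by rewrite /w; case: ifP.
have w1 m i : \sum_j w m i j <= 1 by rewrite /w; case: (i < m)%N.
have split_diff (k : {ffun 'I_n -> J}) (m : 'I_n) :
    \prod_i w m.+1 i (k i) - \prod_i w m i (k i) =
    (a m (k m) - b m (k m)) * \prod_(i | i != m) w m i (k i).
  rewrite (bigD1 m)//= [in X in _ - X](bigD1 m)//= mulrBl.
  congr (_ - _); last by rewrite {1}/w ltnn.
  rewrite {1}/w ltnSn; congr (_ * _); apply: eq_bigr => i im.
  by rewrite /w ltnS leq_eqVlt (inj_eq val_inj) (negbTE im).
have tele (k : {ffun 'I_n -> J}) : \prod_i a i (k i) - \prod_i b i (k i) =
    \sum_(m < n) (\prod_i w m.+1 i (k i) - \prod_i w m i (k i)).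
  rewrite -(big_mkord xpredT (fun m => \prod_i w m.+1 i (k i) - \prod_i w m i (k i))).
  rewrite telescope_sumr//; congr (_ - _); apply: eq_bigr => i _; rewrite /w//.
  by rewrite ltn_ord.
apply: (@le_trans _ _ (\sum_(m < n) \sum_(k : {ffun 'I_n -> J})
    `|a m (k m) - b m (k m)| * \prod_(i | i != m) w m i (k i))).
  rewrite exchange_big/=; apply: ler_sum => k _; rewrite tele.
  apply: (le_trans (ler_norm_sum _ _ _)); apply: ler_sum => m _.
  by rewrite split_diff normrM [X in _ * X <= _]ger0_norm //; apply: prodr_ge0.
apply: ler_sum => m _.
pose v i j := if i == m then `|a m j - b m j| else w m i j.
rewrite (eq_bigr (fun k : {ffun 'I_n -> J} => \prod_i v i (k i))); last first.
  move=> k _; rewrite [RHS](bigD1 m)//= /v eqxx; congr (_ * _).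
  by apply: eq_bigr => i /negbTE ->.
rewrite -bigA_distr_bigA (bigD1 m)//= {1}/v eqxx.
rewrite -[leRHS]mulr1 ler_wpM2l ?sumr_ge0//.
apply: prodr_ile1 => i /negbTE im; rewrite /v im w1 andbT.
by apply: sumr_ge0.
Qed.

(** The constant must not depend on [K], which grows as the lattice is refined. A term is nonzero
    only if its lattice point is within 2 of [a], where five consecutive bumps sum to 1; after
    exchanging the sums each of the five contributes at most 1. *)
Lemma sum_dist_bump : exists2 l : R, 0 <= l & forall (K : nat) (a b : R), `|a - b| <= 1 ->
  \sum_(j < K.*2.+1) `|bump (a - (j%:R - K%:R)) - bump (b - (j%:R - K%:R))| <= l * `|a - b|.
Proof.
have [l l0 lL] := @bump_lipschitz R; exists (l * 5); first by rewrite mulr_ge0.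
move=> K a b ab1.
apply: (@le_trans _ _ (\sum_(j < K.*2.+1) (l * `|a - b|) *
    \sum_(m < 5) bump (a - (m%:R - 2%:R) - (j%:R - K%:R)))).
  apply: ler_sum => j _; set c : R := j%:R - K%:R.
  have [d1|d1] := leP `|a - c| 2.
    rewrite (eq_bigr (fun m : 'I_5 => bump (a - c - (m%:R - 2%:R)))) => [|m _]; last by congr bump; ring.
    rewrite (sum_bump1 (K := 2))// mulr1 (le_trans (lL _ _))//.
    by rewrite (_ : a - c - (b - c) = a - b); [by []|ring].
  have d2 : 1 < `|b - c|.
    have := ler_normD (a - b) (b - c); rewrite addrA subrK; lra.
  rewrite !bump_eq0 ?(ltW d2)//; last by rewrite (le_trans _ (ltW d1))// ler1n.
  by rewrite subrr normr0 !mulr_ge0// sumr_ge0// => m _; exact: bump_ge0.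
rewrite -mulr_sumr exchange_big/= [leRHS]mulrAC ler_wpM2l ?mulr_ge0//.
have -> : (5 : R) = \sum_(m < 5) 1 by rewrite sumr_const card_ord.
by apply: ler_sum => m _; exact: sum_bump_le1.
Qed.

End lattice_sums.

Section lipschitz_approx.
Context {R : realType} {n : nat}.
Implicit Types (g : 'rV[R]_n -> R) (x y : 'rV[R]_n) (L r : R).

(** The working class: it contains the test functions, their absolute values and the truncated
    maximal functions, and its members are limits of test functions in the Besov norm. *)
Definition lip_supp L r g := (forall x y, `|g x - g y| <= L * `|x - y|) /\
  (forall x, r <= `|x| -> g x = 0).

Lemma lip_continuous L g : (forall x y, `|g x - g y| <= L * `|x - y|) -> continuous g.
Proof.
move=> gL x; have L0 : 0 < `|L| + 1 by rewrite ltr_wpDl.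
apply/(@cvgrPdist_lt _ _ _ (nbhs x)) => e e0.
apply/nbhs_ballP; exists ((`|L| + 1)^-1 * e) => /=; first by rewrite mulr_gt0// invr_gt0.
move=> y /ballP xy; rewrite (le_lt_trans (gL _ _))//.
apply: (@le_lt_trans _ _ ((`|L| + 1) * `|x - y|)); last by rewrite -ltr_pdivlMl.
by rewrite ler_wpM2r// (le_trans (ler_norm L))// lerDl.
Qed.

Lemma lip_supp_continuous L r g : lip_supp L r g -> continuous g.
Proof. by move=> [gL _]; exact: (lip_continuous gL). Qed.

Lemma compact_norm_le r : compact [set x : 'rV[R]_n | `|x| <= r].
Proof.
apply: bounded_closed_compact.
  exists r; split; first exact: num_real.
  by move=> M rM x /= xr; rewrite (le_trans xr)// ltW.
rewrite (_ : mkset _ = (fun x : 'rV[R]_n => `|x|) @^-1` [set t | t <= r])//.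
apply: (closed_comp (f := fun x : 'rV[R]_n => `|x|)); last exact: closed_le.
by move=> x _; exact: norm_continuous.
Qed.

Lemma compact_supp r g : (forall x, r <= `|x| -> g x = 0) ->
  compact (closure [set x | g x != 0]).
Proof.
move=> g0; apply: (@subclosed_compact _ _ [set x : 'rV[R]_n | `|x| <= r]);
  [exact: closed_closure|exact: compact_norm_le|].
rewrite [X in _ `<=` X](proj1 (closure_id _)); last first.
  by apply: compact_closed; [exact: norm_hausdorff|exact: compact_norm_le].
apply: closure_subset => x /= gx; rewrite leNgt; apply: contra gx => /ltW/g0 ->.
by rewrite eqxx.
Qed.

(** [psi] averages the values of [g] on a lattice of mesh [e] by the partition of unity. The point
    is that [L'] does not depend on [e]: if [|x - y| >= e], comparison with [g] costs [3 * L]; if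
    [|x - y| < e], the factor [e^-1] from rescaling the bumps is offset by values of [g] that differ
    from [g x] by at most [2 * L * e]. *)
Lemma lipschitz_approx L r g : 0 <= L -> lip_supp L r g ->
  exists2 L', 0 <= L' & forall e, 0 < e <= 1 -> exists psi,
    [/\ test_function psi, lip_supp L' (r + 2) psi,
        forall x, `|psi x - g x| <= L * e &
        (forall x, 0 <= g x) -> forall x, 0 <= psi x].
Proof.
move=> L0 [gL gr]; have [l l0 lB] := @sum_dist_bump R.
exists (3 * L + 2 * L * (n%:R * l)) => [|e /andP[e0 e1]].
  by rewrite addr_ge0// !mulr_ge0.
(* The lattice must cover the support of [g] with a margin [3 * e]: [2 * e] for a point where [psi]
   is compared, and [e] more for its neighbour. *)
pose K := (Num.truncn (`|r| / e)).+4.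
have Ke : r + 3 * e <= e * K%:R.
  have : `|r| / e < (Num.truncn (`|r| / e)).+1%:R by exact: truncnS_gt.
  rewrite ltr_pdivrMr// => h.
  rewrite (_ : K%:R = (Num.truncn (`|r| / e)).+1%:R + 3); last by rewrite /K -natrD addn3.
  by have := ler_norm r; lra.
pose c (j : 'I_K.*2.+1) : R := j%:R - K%:R.
pose F (k : {ffun 'I_n -> 'I_K.*2.+1}) i (t : R) := bump (e^-1 * t + (- c (k i))).
pose Phi k x := tensor (F k) x.
pose z (k : {ffun 'I_n -> 'I_K.*2.+1}) : 'rV[R]_n := \row_i (e * c (k i)).
pose psi x := \sum_k g (z k) * Phi k x.
have Phi0 k x : 0 <= Phi k x by apply: prodr_ge0 => i _; exact: bump_ge0.
have Phi_sum1 x : `|x| <= e * K%:R -> \sum_k Phi k x = 1.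
  move=> xK; rewrite /Phi /tensor -(bigA_distr_bigA (fun i j => bump (e^-1 * x ord0 i + (- c j)))).
  apply: big1 => i _; apply: sum_bump1.
  rewrite normrM gtr0_norm ?invr_gt0// ler_pdivrMl//.
  by rewrite (le_trans (rV_norm_coord _ _)).
have Phi_far k x : e < `|x - z k| -> Phi k x = 0.
  move=> xk; apply/eqP; rewrite prodf_seq_eq0; apply/hasP.
  have [i ei] : exists i, e < `|(x - z k) ord0 i|.
    apply: contrapT => /forallNP h; move: xk; rewrite ltNge => /negP; apply.
    by apply/rV_norm_leP => [|i]; [exact: ltW|rewrite leNgt; exact/negP/h].
  exists i; first exact: mem_index_enum.
  rewrite /= /F bump_eq0//; move: ei; rewrite !mxE => ei.
  rewrite (_ : _ + _ = e^-1 * (x ord0 i - e * c (k i))).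
    by rewrite normrM gtr0_norm ?invr_gt0// ler_pdivlMl// mulr1 ltW.
  by rewrite mulrBr mulrA mulVf ?gt_eqF// mul1r.
have psi_far x : r + e <= `|x| -> psi x = 0.
  move=> xr; apply: big1 => k _; have [xk|/Phi_far ->] := leP `|x - z k| e; last by rewrite mulr0.
  rewrite gr ?mul0r//; have := ler_normD (x - z k) (z k); rewrite subrK.
  by lra.
have psi_sub x : `|x| <= e * K%:R -> psi x - g x = \sum_k (g (z k) - g x) * Phi k x.
  move=> xK; under [RHS]eq_bigr do rewrite mulrBl.
  by rewrite sumrB -mulr_sumr Phi_sum1// mulr1.
have psi_near x : `|psi x - g x| <= L * e.
  have [xK|xK] := leP `|x| (e * K%:R); last first.
    rewrite psi_far ?gr ?subrr ?normr0 ?mulr_ge0 ?(ltW e0)//; lra.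
  rewrite psi_sub// (le_trans (ler_norm_sum _ _ _))//.
  apply: (@le_trans _ _ (\sum_k L * e * Phi k x)); last by rewrite -mulr_sumr Phi_sum1// mulr1.
  apply: ler_sum => k _; have [xk|/Phi_far ->] := leP `|x - z k| e; last by rewrite !mulr0 normr0.
  rewrite normrM (ger0_norm (Phi0 _ _)) ler_wpM2r// (le_trans (gL _ _))//.
  by rewrite ler_wpM2l// distrC.
have psi_lip x y : `|psi x - psi y| <= (3 * L + 2 * L * (n%:R * l)) * `|x - y|.
  have nl0 : 0 <= n%:R * l by rewrite mulr_ge0.
  have [xy|xy] := leP e `|x - y|.
    rewrite (_ : psi x - psi y = (psi x - g x) + (g x - g y) - (psi y - g y)); last by ring.
    have h1 := psi_near x; have h2 := psi_near y; have h3 := gL x y.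
    rewrite (le_trans (ler_normB _ _))// (le_trans (lerD (ler_normD _ _) (lexx _)))//.
    have h4 : L * e <= L * `|x - y| by rewrite ler_wpM2l.
    have h5 : 0 <= 2 * L * (n%:R * l) * `|x - y| by rewrite !mulr_ge0.
    by lra.
  have xy0 : 0 <= `|x - y| by [].
  have [xr|xr] := leP (r + 2 * e) `|x|.
    rewrite !psi_far ?subrr ?normr0 ?mulr_ge0//; last by lra.
      by rewrite addr_ge0// !mulr_ge0.
    have := ler_normD (x - y) y; rewrite subrK; lra.
  have xK : `|x| <= e * K%:R by lra.
  have yK : `|y| <= e * K%:R.
    have := ler_normD (y - x) x; rewrite subrK distrC; lra.
  (* The bumps sum to 1 at [x] and at [y], so [g x] may be subtracted from every coefficient; this
     gains the factor [e]. *)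
  have -> : psi x - psi y = \sum_k (g (z k) - g x) * (Phi k x - Phi k y).
    under [RHS]eq_bigr do rewrite mulrBl !mulrBr.
    rewrite !sumrB -!mulr_sumr !Phi_sum1// subrr subr0.
    by rewrite -sumrB.
  apply: (@le_trans _ _ (\sum_k (2 * L * e) * `|Phi k x - Phi k y|)).
    rewrite (le_trans (ler_norm_sum _ _ _))//; apply: ler_sum => k _.
    rewrite normrM; have [xk|xk] := leP `|x - z k| (2 * e).
      rewrite ler_wpM2r// (le_trans (gL _ _))// distrC.
      by have := ler_wpM2l L0 xk; lra.
    rewrite !Phi_far ?subrr ?normr0 ?mulr0//; last by lra.
    have := ler_normD (x - y) (y - z k); rewrite addrA subrK; lra.
  rewrite -mulr_sumr.
  have hs : \sum_k `|Phi k x - Phi k y| <= n%:R * (l * (e^-1 * `|x - y|)).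
    apply: (le_trans (sum_dist_prod_le (a := fun i j => bump (e^-1 * x ord0 i + (- c j)))
      (b := fun i j => bump (e^-1 * y ord0 i + (- c j))) _ _ _ _)).
    - by move=> *; exact: bump_ge0.
    - by move=> i; exact: sum_bump_le1.
    - by move=> *; exact: bump_ge0.
    - by move=> i; exact: sum_bump_le1.
    apply: (@le_trans _ _ (\sum_(i < n) l * (e^-1 * `|x - y|))); last first.
      by rewrite sumr_const card_ord mulr_natl.
    apply: ler_sum => i _.
    have hxy : `|e^-1 * x ord0 i - e^-1 * y ord0 i| <= e^-1 * `|x - y|.
      rewrite -mulrBr normrM gtr0_norm ?invr_gt0// ler_wpM2l ?invr_ge0 ?(ltW e0)//.
      by have := rV_norm_coord (x - y) i; rewrite !mxE.
    rewrite (le_trans (lB _ _ _ _)) ?ler_wpM2l//.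
    by rewrite (le_trans hxy)// ler_pdivrMl// mulr1 ltW.
  apply: (@le_trans _ _ (2 * L * e * (n%:R * (l * (e^-1 * `|x - y|))))).
    by rewrite ler_wpM2l// !mulr_ge0// ltW.
  rewrite (_ : _ * _ = 2 * L * (n%:R * l) * `|x - y|); last by field; rewrite gt_eqF.
  by rewrite ler_wpM2r// lerDr mulr_ge0.
exists psi; split => //.
- split; last by apply: (@compact_supp (r + e)).
  apply: smooth_tensor_span; apply: tensor_span_sum => k i m.
  by apply: n_derivable_affine; exact: smooth_bump.
- by split => // x xr; apply: psi_far; lra.
- by move=> g0 x; apply: sumr_ge0 => k _; rewrite mulr_ge0.
Qed.

End lipschitz_approx.

(** * The Besov norm *)

Section besov_norm_theory.
Context {R : realType} {n : nat}.
Variables (p beta : R).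
Hypotheses (p1 : 1 < p) (beta0 : 0 < beta) (beta1 : beta < 1).
Implicit Types (f g e : 'rV[R]_n -> R) (x y h : 'rV[R]_n) (L r a c : R).

Let p0 : 0 < p. Proof. exact: lt_trans p1. Qed.

Definition diff h f x := f (x + h) - f x.

Definition intp f : \bar R := (\int[lebesgue_rV n]_x (`|f x| `^ p)%:E)%E.

Lemma intp_ge0 f : (0 <= intp f)%E.
Proof. by apply: integral_ge0 => x _; rewrite lee_fin powR_ge0. Qed.

Lemma LnormE f : Lnorm (lebesgue_rV n) p%:E (fun x => (f x)%:E) = (intp f `^ p^-1)%E.
Proof. by rewrite unlock. Qed.

Lemma measurable_powR_norm (D : set 'rV[R]_n) f : measurable_fun D f ->
  measurable_fun D (fun x => (`|f x| `^ p)%:E).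
Proof.
move=> mf; apply/measurable_EFinP; apply: (measurableT_comp (f := fun t : R => t `^ p)) => //.
exact: measurableT_comp.
Qed.

Lemma diff_continuous h f : continuous f -> continuous (diff h f).
Proof.
move=> cf.
have cs : continuous (fun x : 'rV[R]_n => x + h).
  by move=> x; apply: (cvgD (F := nbhs x)); [exact: cvg_id|exact: cvg_cst].
have cfs : continuous (f \o (fun x : 'rV[R]_n => x + h)).
  by move=> x; apply: continuous_comp; [exact: cs|exact: cf].
by move=> x; apply: (cvgB (F := nbhs x)); [exact: cfs|exact: cf].
Qed.

Lemma lee_poweR (x y : \bar R) (r : R) : 0 <= r -> (0 <= x)%E -> (x <= y)%E ->
  (x `^ r <= y `^ r)%E.
Proof.
move=> r0 x0 xy; apply: gt0_ler_poweR => //; rewrite in_itv/= ?x0 leey//.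
by rewrite (le_trans x0).
Qed.

Lemma intp_le_scale f g c : 0 <= c -> (intp g <= (c `^ p)%:E * intp f)%E ->
  (Lnorm (lebesgue_rV n) p%:E (fun x => (g x)%:E) <=
   c%:E * Lnorm (lebesgue_rV n) p%:E (fun x => (f x)%:E))%E.
Proof.
move=> c0 gf; rewrite !LnormE.
have -> : c%:E = ((c `^ p)%:E `^ p^-1)%E.
  by rewrite poweR_EFin -powRrM mulfV ?gt_eqF// powRr1.
rewrite -poweRM ?lee_fin ?powR_ge0 ?intp_ge0//.
by rewrite lee_poweR ?invr_ge0 ?(ltW p0) ?intp_ge0.
Qed.

(** A nonzero direction must exist: a supremum over the empty set would be [-oo]. *)
Lemma besov_norm_ge0 f : (0 < n)%N -> (0 <= besov_norm p beta f)%E.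
Proof.
move=> n0; pose h : 'rV[R]_n := const_mx 1.
apply: le_trans (ereal_sup_ubound _); last first.
  exists h => //=; apply/eqP => /matrixP /(_ ord0 (Ordinal n0)).
  by rewrite !mxE => /eqP; rewrite oner_eq0.
by rewrite mule_ge0 ?Lnorm_ge0// lee_fin powR_ge0.
Qed.

Lemma besov_norm_le_scale f g c : 0 <= c ->
  (forall h, (intp (diff h g) <= (c `^ p)%:E * intp (diff h f))%E) ->
  (besov_norm p beta g <= c%:E * besov_norm p beta f)%E.
Proof.
move=> c0 gf; apply: ge_ereal_sup => _ [h /= h0 <-].
apply: (@le_trans _ _ (c%:E * (Lnorm (lebesgue_rV n) p%:E (fun x => (f (x + h) - f x)%:E)
                 * (euclid_norm h `^ (- beta))%:E))%E).
  rewrite muleA; apply: lee_wpmul2r; first by rewrite lee_fin powR_ge0.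
  exact: (intp_le_scale (f := diff h f) (g := diff h g) c0 (gf h)).
by apply: lee_wpmul2l; [rewrite lee_fin|apply: ereal_sup_ubound; exists h].
Qed.

Lemma le_intp f g : measurable_fun setT f -> measurable_fun setT g ->
  (forall x, `|g x| <= `|f x|) -> (intp g <= intp f)%E.
Proof.
move=> mf mg gf; apply: ge0_le_integral => //.
- exact: measurable_powR_norm.
- exact: measurable_powR_norm.
- by move=> x _; rewrite lee_fin ge0_ler_powR ?nnegrE ?(ltW p0).
Qed.

(** Differences are contracted pointwise. Applied below to negation, to the absolute value and to
    the truncation of the maximal function. *)
Lemma besov_norm_contract f (phi : R -> R) c : continuous f -> 0 <= c ->
  (forall s t, `|phi s - phi t| <= c * `|s - t|) ->
  (besov_norm p beta (phi \o f) <= c%:E * besov_norm p beta f)%E.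
Proof.
move=> cf c0 phic; apply: besov_norm_le_scale => // h.
have cphi : continuous phi.
  move=> t; apply/cvgrPdist_lt => e e0; near=> u.
  apply: le_lt_trans (phic _ _) _; apply: (@le_lt_trans _ _ ((c + 1) * `|t - u|)).
    by rewrite ler_wpM2r// lerDl.
  rewrite -ltr_pdivlMl ?ltr_wpDl//; near: u.
  apply: (@cvgr_dist_lt _ _ _ _ _ id); first exact: cvg_id.
  by rewrite mulr_gt0// invr_gt0 ltr_wpDl.
have cpf : continuous (phi \o f).
  by move=> x; apply: continuous_comp; [exact: cf|exact: cphi].
apply: (@le_trans _ _ (intp (fun x => c * diff h f x))).
  apply: le_intp => [||x].
  - apply: (measurable_funM (f := cst c) (g := diff h f)) => //.
    exact: continuous_measurable_rV (@diff_continuous h f cf).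
  - exact: continuous_measurable_rV (@diff_continuous h _ cpf).
  - by rewrite normrM (ger0_norm c0) phic.
rewrite /intp; under eq_integral do rewrite normrM powRM// (ger0_norm c0) EFinM.
rewrite ge0_integralZl_EFin ?powR_ge0//.
apply: measurable_powR_norm.
exact: continuous_measurable_rV (@diff_continuous h f cf).
Unshelve. all: by end_near. Qed.

Lemma besov_normD f g : (0 < n)%N -> continuous f -> continuous g ->
  (besov_norm p beta (f \+ g)%R <= besov_norm p beta f + besov_norm p beta g)%E.
Proof.
move=> n0 cf cg; apply: ge_ereal_sup => _ [h /= h0 <-].
set w := (_ `^ (- beta))%:E.
apply: (@le_trans _ _ ((Lnorm (lebesgue_rV n) p%:E (fun x => (diff h f x)%:E) +
    Lnorm (lebesgue_rV n) p%:E (fun x => (diff h g x)%:E)) * w)%E).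
  apply: lee_wpmul2r; first by rewrite lee_fin powR_ge0.
  rewrite (_ : (fun x => _) = EFin \o (diff h f \+ diff h g)%R); last first.
    by apply/funext => x; rewrite /= /diff; congr EFin; ring.
  apply: minkowski_EFin; last exact: ltW.
    exact: continuous_measurable_rV (@diff_continuous h f cf).
  exact: continuous_measurable_rV (@diff_continuous h g cg).
rewrite ge0_muleDl ?Lnorm_ge0//.
by apply: leeD; apply: ereal_sup_ubound; exists h.
Qed.

(** A difference of [e] is at most [2 * a] and at most [L |h|]; their geometric mean with weights
    [1 - beta] and [beta] yields the factor [|h|^beta]. With [L] and [r] fixed the bound tends to 0
    with [a]. *)
Lemma besov_norm_small e a L r : (forall x, `|e x| <= a) -> lip_supp L r e ->
  0 <= L -> 0 < r ->
  (besov_norm p beta e <=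
    ((2 * a) `^ (1 - beta) * L `^ beta * (2 * (2 * r) ^+ n) `^ p^-1)%:E)%E.
Proof.
move=> ea eL L0 r0; have ce := lip_supp_continuous eL; have [eLx er] := eL.
apply: ge_ereal_sup => _ [h /= h0 <-].
have a0 : 0 <= a by exact: le_trans (ea 0).
have hn0 : 0 < euclid_norm h.
  by rewrite (lt_le_trans _ (rV_norm_le_euclid h))// normr_gt0.
pose M := (2 * a) `^ (1 - beta) * (L * euclid_norm h) `^ beta.
have M0 : 0 <= M by rewrite mulr_ge0 ?powR_ge0.
(* Off these two cubes both [e x] and [e (x + h)] vanish. *)
pose A : set 'rV[R]_n := ball 0 r `|` ball (- h) r.
have mA : measurable A by apply: measurableU; exact: measurable_rV_ball.
have muA : (lebesgue_rV n A <= (2 * (2 * r) ^+ n)%:E)%E.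
  apply: (@le_trans _ _ (lebesgue_rV n (ball (0 : 'rV[R]_n)%R r) + lebesgue_rV n (ball (- h)%R r))%E).
    by apply: measureU2; exact: measurable_rV_ball.
  by rewrite !lebesgue_rV_ball// -EFinD lee_fin; move: (_ ^+ n) => y; lra.
have key : (intp (diff h e) <= (M `^ p * (2 * (2 * r) ^+ n))%:E)%E.
  apply: (@le_trans _ _ (\int[lebesgue_rV n]_x ((M `^ p)%:E * (\1_A x)%:E))%E); last first.
    rewrite ge0_integralZl_EFin ?powR_ge0//; last exact/measurable_EFinP.
    rewrite integral_indic// setIT EFinM; apply: lee_wpmul2l => //.
    by rewrite lee_fin powR_ge0.
  apply: ge0_le_integral => //.
  - apply: measurable_powR_norm.
    exact: continuous_measurable_rV (@diff_continuous h e ce).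
  - by apply/measurable_EFinP; exact: measurable_funM.
  move=> x _; rewrite -EFinM lee_fin indicE.
  have [xA|xA] := boolP (x \in A); last first.
    rewrite mulr0; move: xA; rewrite notin_setE => /not_orP[x1 x2].
    rewrite /diff !er ?subrr ?normr0 ?powR0 ?gt_eqF//.
      by rewrite leNgt; apply/negP => xr; apply: x1; apply/ballP; rewrite sub0r normrN.
    rewrite leNgt; apply/negP => xr; apply: x2; apply/ballP.
    by rewrite -opprD normrN addrC.
  rewrite mulr1 ge0_ler_powR ?nnegrE ?(ltW p0)//.
  have d1 : `|diff h e x| <= 2 * a.
    by rewrite (le_trans (ler_normB _ _))// mulr_natl mulr2n lerD.
  have d2 : `|diff h e x| <= L * euclid_norm h.
    rewrite (le_trans (eLx _ _))// addrAC subrr add0r ler_wpM2l//.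
    exact: rV_norm_le_euclid.
  have -> : `|diff h e x| = `|diff h e x| `^ (1 - beta) * `|diff h e x| `^ beta.
    by rewrite -powRD ?subrK ?powRr1//; rewrite oner_eq0.
  rewrite ler_pM ?powR_ge0// ge0_ler_powR ?nnegrE ?subr_ge0 ?(ltW beta1) ?(ltW beta0)//.
    by rewrite mulr_ge0.
  by rewrite mulr_ge0// ltW.
rewrite LnormE.
apply: (@le_trans _ _ ((M `^ p * (2 * (2 * r) ^+ n))%:E `^ p^-1 * (euclid_norm h `^ (- beta))%:E)%E).
  apply: lee_wpmul2r; first by rewrite lee_fin powR_ge0.
  by rewrite lee_poweR ?invr_ge0 ?(ltW p0) ?intp_ge0.
have rr0 : 0 <= 2 * (2 * r) ^+ n by rewrite mulr_ge0// exprn_ge0// mulr_ge0// ltW.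
rewrite poweR_EFin -EFinM lee_fin powRM ?powR_ge0// -powRrM mulfV ?gt_eqF// powRr1//.
rewrite /M [(L * _) `^ _]powRM ?(ltW hn0)// powRN.
have := powR_gt0 beta hn0; move: (euclid_norm h `^ beta) => w w0.
rewrite le_eqVlt; apply/orP; left; apply/eqP; field.
by rewrite gt_eqF.
Qed.

End besov_norm_theory.

Section besov_approx.
Context {R : realType} {n : nat}.
Variables (p beta : R).
Hypotheses (p1 : 1 < p) (beta0 : 0 < beta) (beta1 : beta < 1).
Implicit Types (f g e : 'rV[R]_n -> R) (x y h : 'rV[R]_n) (L r a c : R).

Lemma lip_suppB L r L' r' f g : lip_supp L r f -> lip_supp L' r' g ->
  lip_supp (L + L') (Num.max r r') (f \- g).
Proof.
move=> [fL f0] [gL g0]; split=> [x y|x] /=.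
  rewrite (_ : f x - g x - (f y - g y) = (f x - f y) - (g x - g y)); last by ring.
  by rewrite (le_trans (ler_normB _ _))// mulrDl lerD.
by rewrite ge_max => /andP[xr xr']; rewrite f0// g0// subrr.
Qed.

Lemma besov_approx L r g : 0 <= L -> 0 < r -> lip_supp L r g ->
  forall eps, 0 < eps -> exists psi,
    [/\ test_function psi, exists L' r', [/\ 0 <= L', 0 < r' & lip_supp L' r' psi],
        forall x, `|psi x - g x| <= eps,
        (besov_norm p beta (psi \- g)%R <= eps%:E)%E &
        (forall x, 0 <= g x) -> forall x, 0 <= psi x].
Proof.
move=> L0 r0 gL eps eps0; have [L' L'0 H] := lipschitz_approx L0 gL.
have max0 : 0 < Num.max (r + 2) r by rewrite lt_max r0 orbT.
pose K := (L' + L) `^ beta * (2 * (2 * Num.max (r + 2) r) ^+ n) `^ p^-1.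
have K0 : 0 <= K by rewrite mulr_ge0 ?powR_ge0.
have be0 : 0 < 1 - beta by rewrite subr_gt0.
(* Once [2 * (L * e) <= d], [besov_norm_small] gives at most [K] times the power [1 - beta] of [d],
   that is [K * eps / (K + 1)]. *)
pose d := (eps / (K + 1)) `^ (1 - beta)^-1.
have d0 : 0 < d by rewrite powR_gt0// divr_gt0// ltr_wpDl.
pose e := Num.min 1 (Num.min (eps / (L + 1)) (d / (2 * (L + 1)))).
have L10 : 0 < L + 1 by rewrite ltr_wpDl.
have e0 : 0 < e by rewrite !lt_min ltr01 !divr_gt0// mulr_gt0.
have e1 : e <= 1 by rewrite ge_min lexx.
have eL : L * e <= eps.
  have : e <= eps / (L + 1) by rewrite !ge_min lexx orbT.
  rewrite ler_pdivlMr// => h; apply: le_trans h.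
  by rewrite mulrC ler_wpM2l ?(ltW e0)// lerDl.
have ed : 2 * (L * e) <= d.
  have : e <= d / (2 * (L + 1)) by rewrite !ge_min lexx !orbT.
  by rewrite ler_pdivlMr ?mulr_gt0// => h; have := ltW e0; lra.
have [psi [tpsi lpsi psig psi0]] := H e (introT andP (conj e0 e1)).
exists psi; split => //.
- by exists L', (r + 2); split => //; rewrite addr_gt0.
- by move=> x; rewrite (le_trans (psig x)).
have := besov_norm_small (p := p) (beta := beta) p1 beta0 beta1 psig
  (lip_suppB lpsi gL) (addr_ge0 L'0 L0) max0.
move=> /le_trans; apply; rewrite lee_fin -mulrA -/K.
apply: (@le_trans _ _ (eps / (K + 1) * K)).
  apply: ler_wpM2r => //.
  apply: (@le_trans _ _ (d `^ (1 - beta))).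
    by rewrite ge0_ler_powR ?nnegrE ?(ltW be0) ?(ltW d0)// !mulr_ge0// ltW.
  rewrite /d -powRrM mulVf ?gt_eqF// powRr1// divr_ge0 ?(ltW eps0)//.
  by rewrite addr_ge0.
by rewrite -mulrA ler_piMr ?(ltW eps0)// ler_pdivrMl ?ltr_wpDl// mulr1 lerDl.
Qed.

Lemma besov_norm_lt_pinfty L r g : 0 <= L -> 0 < r -> lip_supp L r g ->
  (besov_norm p beta g < +oo)%E.
Proof.
move=> L0 r0 gL; have [gLx g0] := gL.
have ga x : `|g x| <= `|g 0| + L * r.
  have [xr|xr] := leP r `|x|.
    by rewrite g0// normr0 addr_ge0// mulr_ge0// ltW.
  rewrite -[g x](subrK (g 0)) (le_trans (ler_normD _ _))// addrC lerD//.
  by rewrite (le_trans (gLx _ _))// subr0 ler_wpM2l// ltW.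
apply: le_lt_trans (besov_norm_small (p := p) (beta := beta) p1 beta0 beta1 ga gL L0 r0) _.
exact: ltry.
Qed.

End besov_approx.

(** * Test functions are Lipschitz with bounded support *)

Section test_functions.
Context {R : realType} {n : nat}.
Implicit Types (f g : 'rV[R]_n -> R) (x y h : 'rV[R]_n).

Lemma row_sum_coord h : h = \sum_(i < n) h ord0 i *: delta_mx ord0 i.
Proof. exact: row_sum_delta. Qed.

(** The partial derivatives are continuous and vanish far away, hence are bounded by some [B]. The
    mean value theorem on the segment from [y] to [x], with [x - y] expanded in the standard basis,
    gives the constant [n%:R * B]. *)
Lemma test_function_lip f : test_function f ->
  exists L r, [/\ 0 <= L, 0 < r & lip_supp L r f].
Proof.
move=> [sf /compact_bounded[M [_ Mb]]].
pose r := `|M| + 1.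
have r0 : 0 < r by rewrite ltr_wpDl.
have f0 x : r < `|x| -> f x = 0.
  move=> xr; apply/eqP; apply: contraTT xr => fx.
  rewrite -leNgt; apply: (Mb r); first by rewrite /r (le_lt_trans (ler_norm M))// ltrDl.
  exact: subset_closure.
have df x : differentiable f x by exact: (sf [::] x).
have [B [B0 HB]] : exists B, 0 <= B /\ forall i x, `|'D_(delta_mx ord0 i) f x| <= B.
  have hi i : exists B, 0 <= B /\ forall x, `|'D_(delta_mx ord0 i) f x| <= B.
    have cD : continuous ('D_(delta_mx ord0 i) f).
      by move=> x; apply: differentiable_continuous; exact: (sf [:: i] x).
    have D0 x : r < `|x| -> 'D_(delta_mx ord0 i) f x = 0.
      move=> xr; rewrite (near_eq_derive (g := cst 0)); first exact: derive_cst.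
      have oU : open [set y : 'rV[R]_n | r < `|y|].
        rewrite (_ : mkset _ = (fun y : 'rV[R]_n => `|y|) @^-1` [set t | r < t])//.
        apply: open_comp; last exact: open_gt.
        by move=> y _; exact: norm_continuous.
      apply: filterS (open_nbhs_nbhs (conj oU xr)) => y; exact: f0.
    have [c _ hc] : exists2 c, c \in [set x : 'rV[R]_n | `|x| <= r] & forall t,
        t \in [set x : 'rV[R]_n | `|x| <= r] -> `|'D_(delta_mx ord0 i) f t| <= `|'D_(delta_mx ord0 i) f c|.
      apply: EVT_max_rV; first by exists 0; rewrite /= normr0 ltW.
        exact: compact_norm_le.
      have cN : continuous ((fun z : R => `|z|) \o 'D_(delta_mx ord0 i) f).
        by move=> x; apply: continuous_comp; [exact: cD|exact: norm_continuous].
      exact: continuous_subspaceT cN.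
    exists `|'D_(delta_mx ord0 i) f c|; split => // x.
    have [xr|xr] := leP `|x| r; first by apply: hc; rewrite inE.
    by rewrite D0// normr0.
  have [B HB] := choice hi; exists (\sum_i B i); split.
    by apply: sumr_ge0 => i _; have [] := HB i.
  move=> i x; rewrite (le_trans ((HB i).2 x))// (bigD1 i)//= lerDl sumr_ge0// => j _.
  by have [] := HB j.
(* The radius grows by 1 because [f0] asks for a strict inequality and [lip_supp] grants a weak
   one. *)
exists (n%:R * B), (r + 1); split; first by rewrite mulr_ge0.
  by rewrite addr_gt0.
split=> [x y|x xr]; last by apply: f0; lra.
pose g (t : R) := f (y + t *: (x - y)).
have dg (t : R) : is_derive t (1 : R) g ('d f (y + t *: (x - y)) (x - y)).
  have E : (fun h : R => h^-1 *: ((g \o shift t) (h *: 1) - g t)) =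
      (fun h : R => h^-1 *: ((f \o shift (y + t *: (x - y))) (h *: (x - y)) - f (y + t *: (x - y)))).
    apply/funext => h; congr (_ *: (_ - _)); rewrite /g /=; congr f.
    by rewrite scalerDl [_%:A]mulr1 addrCA.
  apply: DeriveDef; rewrite /derivable /derive E; first exact: diff_derivable.
  exact: deriveE.
have [t _] := @MVT_segment R g (fun t => 'd f (y + t *: (x - y)) (x - y)) 0 1 ler01
  (fun t _ => dg t) (continuous_subspaceT (fun t => differentiable_continuous
    (proj1 (derivable1_diffP _ _) (@ex_derive _ _ _ _ _ _ _ (dg t))))).
rewrite /g scale1r scale0r addr0 subr0 mulr1 [y + (x - y)]addrC subrK => ->.
rewrite [x - y in X in `|X|]row_sum_coord linear_sum.
rewrite (le_trans (ler_norm_sum _ _ _))//.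
apply: (@le_trans _ _ (\sum_(i < n) B * `|x - y|)).
  apply: ler_sum => i _; rewrite linearZ/= normrM mulrC ler_pM//.
    by rewrite -deriveE.
  exact: rV_norm_coord.
by rewrite sumr_const card_ord -mulrnAl mulr_natl.
Qed.

End test_functions.

Section besov_space_lip.
Context {R : realType} {n : nat}.
Variables (p beta : R).
Hypotheses (p1 : 1 < p) (beta0 : 0 < beta) (beta1 : beta < 1) (n0 : (0 < n)%N).
Implicit Types (f g : 'rV[R]_n -> R).

Lemma compact_rV_finite (K : set 'rV[R]_n) : compact K ->
  measurable K /\ (lebesgue_rV n K < +oo)%E.
Proof.
move=> cK; have mK : measurable K.
  by apply: closed_measurable_rV; apply: compact_closed => //; exact: norm_hausdorff.
split=> //; have [M [_ Mb]] := compact_bounded cK.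
have M1 : 0 < `|M| + 2 by rewrite ltr_wpDl.
apply: (@le_lt_trans _ _ (lebesgue_rV n (ball (0 : 'rV[R]_n) (`|M| + 2)))); last first.
  by rewrite lebesgue_rV_ball// ltry.
apply: le_measure; rewrite ?inE//; first exact: measurable_rV_ball.
move=> x Kx; apply/ballP; rewrite sub0r normrN.
apply: (@le_lt_trans _ _ (`|M| + 1)); last by rewrite ltrD2l ltr1n.
by apply: (Mb (`|M| + 1)) => //; rewrite (le_lt_trans (ler_norm M))// ltrDl.
Qed.

Lemma invn_cvg0 : (k.+1%:R^-1)%:E @[k --> \oo] --> (0 : \bar R)%E.
Proof. by apply: cvg_EFin; [exact: nearW|exact: cvg_harmonic]. Qed.

(** The approximants with tolerance [1 / (k + 1)] are close both in the Besov norm and uniformly;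
    the latter gives convergence in the mean on compact sets. *)
Lemma besov_space_lip L r g : 0 <= L -> 0 < r -> lip_supp L r g -> besov_space p beta g.
Proof.
move=> L0 r0 gL; have cg := lip_supp_continuous gL.
split; first exact: continuous_measurable_rV.
have /choice[psi Hpsi] : forall k : nat, exists psi : 'rV[R]_n -> R, [/\ test_function psi,
    (besov_norm p beta psi < +oo)%E, continuous psi, forall x, `|psi x - g x| <= k.+1%:R^-1 &
    (besov_norm p beta (psi \- g)%R <= (k.+1%:R^-1)%:E)%E].
  move=> k; have k0 : 0 < k.+1%:R^-1 :> R by rewrite invr_gt0.
  have [psi [tp [L' [r' [L'0 r'0 lp]]] pg bpg _]] :=
    besov_approx p1 beta0 beta1 L0 r0 gL k0.
  exists psi; split => //; first exact: (besov_norm_lt_pinfty p1 beta0 beta1 L'0 r'0 lp).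
  exact: lip_supp_continuous lp.
exists psi; split.
- by move=> k; have [] := Hpsi k.
- apply: (@squeeze_cvge _ _ _ _ (cst 0%E) _ (fun k => (k.+1%:R^-1)%:E)).
  + by apply: nearW => k; rewrite besov_norm_ge0//; have [_ _ _ _] := Hpsi k.
  + exact: cvg_cst.
  + exact: invn_cvg0.
- move=> K /compact_rV_finite[mK muK].
  apply: (@squeeze_cvge _ _ _ _ (cst 0%E) _ (fun k => (k.+1%:R^-1)%:E * lebesgue_rV n K)%E).
  + apply: nearW => k; rewrite integral_ge0//=.
    rewrite -integral_cst//; have [_ _ cpsi h _] := Hpsi k.
    apply: ge0_le_integral => //.
    * apply/measurable_EFinP/measurable_funTS; apply: measurableT_comp => //.
      apply: (measurable_funB (f := psi k) (g := g)); exact: continuous_measurable_rV.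
    * by move=> x _; rewrite lee_fin.
  + exact: cvg_cst.
  + rewrite -[X in _ --> X](mul0e (lebesgue_rV n K)).
    by apply: cvgeZr; [rewrite ge0_fin_numE|exact: invn_cvg0].
Qed.

End besov_space_lip.

(** * The maximal inequality *)

Section weak_type.
Context {R : realType} {n : nat}.
Implicit Types (x y : 'rV[R]_n) (s D : seq ('rV[R]_n * R)).

Local Notation B d := (ball d.1 d.2).

Lemma ball_sub3 (a b : 'rV[R]_n * R) : b.2 <= a.2 -> B a `&` B b !=set0 ->
  B b `<=` ball a.1 (3 * a.2).
Proof.
move=> ba [z [/ballP az /ballP bz]] y /ballP by_; apply/ballP.
rewrite (_ : a.1 - y = (a.1 - z) - (b.1 - z) + (b.1 - y)).
  rewrite (le_lt_trans (ler_normD _ _))//.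
  by have := ler_normB (a.1 - z) (b.1 - z); lra.
by rewrite opprB addrA addrA subrK subrK.
Qed.

(** Greedy choice: keep a largest ball, discard the balls meeting it, which its threefold dilate
    contains, and continue with the shorter list. *)
Lemma vitali_finite s : exists D, [/\ {subset D <= s}, uniq D,
  trivIset [set` D] (fun d => B d) &
  forall b, b \in s -> B b !=set0 -> exists2 a, a \in D & B b `<=` ball a.1 (3 * a.2)].
Proof.
have [m] := ubnP (size s); elim: m s => // m IH s sm.
have [->|s0] := eqVneq s [::].
  by exists [::]; split => //; apply/trivIsetP.
have [a as_ amax] : exists2 a, a \in s & forall b, b \in s -> b.2 <= a.2.
  elim: s s0 {IH sm} => // b s IH _; have [->|/IH[a as_ amax]] := eqVneq s [::].
    by exists b; rewrite ?mem_head// => c; rewrite inE => /eqP ->.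
  have [ab|/ltW ba] := leP a.2 b.2.
    exists b; rewrite ?mem_head// => c; rewrite inE => /orP[/eqP -> //|/amax].
    by move=> /le_trans; apply.
  exists a; first by rewrite inE as_ orbT.
  by move=> c; rewrite inE => /orP[/eqP -> //|/amax].
pose s' := [seq b <- s | ~~ `[< B a `&` B b !=set0 >]].
(* Radii in the list may be nonpositive; if the largest ball is empty, so are all the others. *)
have [aE|aN] := pselect (B a !=set0); last first.
  exists [::]; split => //.
  move=> b bs [y /ballP by_]; exfalso; apply: aN; exists a.1.
  apply/ballP; rewrite subrr normr0 (lt_le_trans _ (amax _ bs))//.
  by rewrite (le_lt_trans _ by_).
have ss' : (size s' < size s)%N.
  rewrite size_filter -(count_predC (fun b => ~~ `[< B a `&` B b !=set0 >]) s) -[ltnLHS]addn0 ltn_add2l.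
  rewrite -has_count; apply/hasP; exists a => //=; rewrite negbK; apply/asboolP.
  by rewrite setIid.
have [D [Ds uD tD HD]] := IH s' (leq_trans ss' sm).
have aD b : b \in D -> ~ (B a `&` B b !=set0).
  by move=> /Ds; rewrite mem_filter => /andP[/asboolPn].
exists (a :: D); split.
- move=> b; rewrite inE => /orP[/eqP -> //|/Ds].
  by rewrite mem_filter => /andP[].
- rewrite /= uD andbT; apply/negP => /aD; apply.
  by rewrite setIid.
- apply/trivIsetP => b c /=; rewrite !inE => bD cD bc.
  have [abc|abc] := boolP ((a == b) || (a == c)); last first.
    move: abc; rewrite negb_or => /andP[ab ac].
    move: bD cD; rewrite eq_sym (negbTE ab) eq_sym (negbTE ac) /= => bD cD.
    by move/trivIsetP : tD; apply.
  apply/seteqP; split => // z [bz cz]; exfalso.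
  case/orP: abc => /eqP eab; subst.
    move: cD; rewrite eq_sym (negbTE bc) /= => /aD; apply.
    by exists z.
  by move: bD; rewrite (negbTE bc) /= => /aD; apply; exists z.
- move=> b bs bE; have [ab|ab] := pselect (B a `&` B b !=set0).
    by exists a; [rewrite mem_head|exact: ball_sub3 (amax _ bs) ab].
  have bs' : b \in s' by rewrite mem_filter bs andbT; apply/asboolPn.
  have [c cD bc] := HD b bs' bE.
  by exists c => //; rewrite inE cD orbT.
Qed.

Lemma lebesgue_rV_bigsetU_le (I : Type) (t : seq I) (F : I -> set 'rV[R]_n) :
  (forall i, measurable (F i)) ->
  (lebesgue_rV n (\big[setU/set0]_(i <- t) F i) <= \sum_(i <- t) lebesgue_rV n (F i))%E.
Proof.
move=> mF; elim: t => [|i t IH]; first by rewrite !big_nil measure0.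
rewrite !big_cons.
apply: (@le_trans _ _ (lebesgue_rV n (F i) + lebesgue_rV n (\big[setU/set0]_(i <- t) F i))%E).
  by apply: measureU2 => //; exact: bigsetU_measurable.
exact: leeD2l.
Qed.

(** Compactness leaves finitely many of the given cubes. The threefold dilates of a disjoint
    subfamily cover [K], whence [3 ^+ n], and integrals over disjoint cubes add up to at most the
    total. *)
Lemma weak_type (K : set 'rV[R]_n) (w : 'rV[R]_n -> R) (l : R) : compact K -> 0 <= l ->
  measurable_fun setT w -> (forall x, 0 <= w x) ->
  (forall x, K x -> exists2 r, 0 < r &
     ((l * (2 * r) ^+ n)%:E <= \int[lebesgue_rV n]_(y in ball x r) (w y)%:E)%E) ->
  (l%:E * lebesgue_rV n K <= (3 ^+ n)%:E * \int[lebesgue_rV n]_y (w y)%:E)%E.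
Proof.
move=> cK l0 mw w0 Kr.
have /choice[r Hr] : forall x, exists r, 0 < r /\ (K x ->
     ((l * (2 * r) ^+ n)%:E <= \int[lebesgue_rV n]_(y in ball x r) (w y)%:E)%E).
  move=> x; have [/Kr[r r0 h]|nK] := pselect (K x); first by exists r; split.
  by exists 1; split.
have := cK; rewrite compact_cover => /(_ _ K (fun x => ball x (r x)) _ _)[||D' D'K KD'].
- by move=> x _; exact: ball_open.
- by move=> x Kx; exists x => //; apply: ballxx; have [] := Hr x.
pose s := [seq (x, r x) | x <- finmap.enum_fset D'].
have [D [Ds uD tD HD]] := vitali_finite s.
have Dr d : d \in D -> 0 < d.2 /\
     ((l * (2 * d.2) ^+ n)%:E <= \int[lebesgue_rV n]_(y in B d) (w y)%:E)%E.
  move=> /Ds /mapP[x xD' ->] /=; have [rx0 h] := Hr x; split => //; apply: h.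
  by have := D'K _ xD'; rewrite inE.
have mB (d : 'rV[R]_n * R) : measurable (B d) by exact: measurable_rV_ball.
have KD : K `<=` \big[setU/set0]_(d <- D) ball d.1 (3 * d.2).
  move=> x /KD'[z zD' /= xz].
  have zs : (z, r z) \in s by apply/mapP; exists z.
  have [|a aD sa] := HD _ zs; first by exists x.
  by rewrite -bigcup_seq; exists a => //; exact: sa.
have mw' (A : set 'rV[R]_n) : measurable_fun A (fun y => (w y)%:E).
  by apply: measurable_funTS; exact/measurable_EFinP.
apply: (@le_trans _ _ (l%:E * \sum_(d <- D) lebesgue_rV n (ball d.1 (3 * d.2)%R))%E).
  apply: lee_wpmul2l; first by rewrite lee_fin.
  apply: le_trans (lebesgue_rV_bigsetU_le _ _); last by move=> d; exact: measurable_rV_ball.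
  apply: le_measure; rewrite ?inE//; first exact: (compact_rV_finite cK).1.
  by apply: bigsetU_measurable => d _; exact: measurable_rV_ball.
apply: (@le_trans _ _ ((3 ^+ n)%:E * \sum_(d <- D) \int[lebesgue_rV n]_(y in B d) (w y)%:E)%E).
  rewrite !ge0_sume_distrr//; last by move=> d _; apply: integral_ge0 => x _; rewrite lee_fin.
  rewrite big_seq [leRHS]big_seq; apply: lee_sum => d /Dr[d0 hd].
  rewrite lebesgue_rV_ball; last by rewrite mulr_gt0.
  rewrite -EFinM (_ : l * _ = 3 ^+ n * (l * (2 * d.2) ^+ n)).
    by rewrite EFinM; apply: lee_wpmul2l => //; rewrite lee_fin exprn_ge0.
  by rewrite [RHS]mulrCA -exprMn; congr (_ * _ ^+ _); ring.
apply: lee_wpmul2l; first by rewrite lee_fin exprn_ge0.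
rewrite -(@ge0_integral_bigsetU _ _ _ _ _ (fun d : 'rV[R]_n * R => B d))//.
apply: ge0_subset_integral => //.
  by apply: bigsetU_measurable => d _; exact: mB.
all: by move=> x _; rewrite lee_fin.
Qed.

End weak_type.

(** * Pointwise bounds on the Caffarelli-Silvestre extension *)

Section geometric_sums.
Context {R : realType}.

Lemma sum_geometric_le (q : R) m : 0 <= q -> q < 1 ->
  \sum_(0 <= k < m) q ^+ k <= (1 - q)^-1.
Proof.
move=> q0 q1; have q1' : 0 < 1 - q by rewrite subr_gt0.
rewrite -[leRHS]mul1r ler_pdivlMr// big_mkord mulrC.
have := subrX1 q m; rewrite -[q - 1]opprB mulNr => /eqP; rewrite eq_sym eqr_oppLR => /eqP ->.
by rewrite opprB gerBl exprn_ge0.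
Qed.

Lemma nneseries_le (u : nat -> \bar R) (M : \bar R) : (forall k, (0 <= u k)%E) ->
  (forall m, (\sum_(0 <= k < m) u k <= M)%E) -> (\sum_(k <oo) u k <= M)%E.
Proof.
move=> u0 uM; apply: lime_le; first by apply: is_cvg_nneseries => k _ _.
exact: nearW.
Qed.

Lemma nneseries_geometric_le (a q : R) : 0 <= a -> 0 <= q -> q < 1 ->
  (\sum_(k <oo) (a * q ^+ k)%:E <= (a / (1 - q))%:E)%E.
Proof.
move=> a0 q0 q1; apply: nneseries_le => [k|m].
  by rewrite lee_fin mulr_ge0// exprn_ge0.
by rewrite sumEFin lee_fin -mulr_sumr ler_wpM2l// sum_geometric_le.
Qed.

End geometric_sums.

Section poisson_kernel_bounds.
Context {R : realType} {n : nat}.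
Variable s : R.
Hypothesis s0 : 0 < s.
Implicit Types (x y z : 'rV[R]_n) (t A : R) (g : 'rV[R]_n -> R).

Let c : R := `|poisson_const n s|.
Let c0 : 0 <= c. Proof. exact: normr_ge0. Qed.
#[local] Hint Resolve c0 : core.
Let ns0 : 0 < n%:R + s. Proof. by rewrite ltr_wpDl. Qed.

Let pow2s_gt1 : 1 < 2 `^ s :> R.
Proof.
have := @gt0_ltr_powR R s s0 1 2; rewrite powR1; apply; rewrite ?nnegrE//.
by rewrite ltr1n.
Qed.

Lemma euclid_norm_sqr x : euclid_norm x ^+ 2 = \sum_(i < n) x ord0 i ^+ 2.
Proof. by rewrite sqr_sqrtr// sumr_ge0// => i _; exact: sqr_ge0. Qed.

Lemma euclid_norm_triangle x y : euclid_norm (x + y) <= euclid_norm x + euclid_norm y.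
Proof.
rewrite -(ler_pXn2r (n := 2))// ?nnegrE ?addr_ge0 ?sqrtr_ge0//.
rewrite euclid_norm_sqr sqrrD !euclid_norm_sqr.
under eq_bigr do rewrite mxE sqrrD.
rewrite !big_split/= lerD2r lerD2l -mulr2n ler_wMn2r//.
rewrite (le_trans (ler_norm _))// -(ler_pXn2r (n := 2))// ?nnegrE ?mulr_ge0 ?sqrtr_ge0//.
rewrite exprMn !euclid_norm_sqr real_normK ?num_real//.
set X := \sum_i x ord0 i ^+ 2; set Y := \sum_i y ord0 i ^+ 2; set Z := \sum_i _.
have X0 : 0 <= X by apply: sumr_ge0 => i _; exact: sqr_ge0.
(* Cauchy-Schwarz: this sum of squares is [X * (X * Y - Z ^+ 2)], and the case [X = 0] is
   trivial. *)
have : 0 <= \sum_i (X * y ord0 i - Z * x ord0 i) ^+ 2 by apply: sumr_ge0 => i _; exact: sqr_ge0.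
have -> : \sum_i (X * y ord0 i - Z * x ord0 i) ^+ 2 = X * (X * Y - Z ^+ 2).
  under eq_bigr do rewrite sqrrB !exprMn.
  rewrite big_split/= sumrB -!mulr_sumr -/X -/Y sumrMnl.
  rewrite (eq_bigr (fun i => X * Z * (x ord0 i * y ord0 i))) => [|i _]; last by ring.
  by rewrite -mulr_sumr -/Z; ring.
have [X0'|X0'] := eqVneq X 0; last by rewrite pmulr_rge0 ?subr_ge0// lt_neqAle eq_sym X0'.
move=> _; have x0 i : x ord0 i = 0.
  have : X == 0 by rewrite X0'.
  rewrite psumr_eq0 => [/allP /(_ i (mem_index_enum _))|j _]; last exact: sqr_ge0.
  by rewrite /= sqrf_eq0 => /eqP.
by rewrite /Z big1 ?expr0n/= ?X0' ?mul0r// => i _; rewrite x0 mul0r.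
Qed.

Lemma measurable_poisson_kernel t y : measurable_fun setT (fun z => poisson_kernel s t (y - z)).
Proof.
rewrite /poisson_kernel; apply: measurable_funM => //.
rewrite (_ : (fun _ => _) = fun z : 'rV[R]_n =>
   (\sum_(i < n) (y ord0 i - rV_coord i z) ^+ 2 + t ^+ 2) `^ (- ((n%:R + s) / 2))).
  apply: (measurableT_comp (f := fun u : R => u `^ (- ((n%:R + s) / 2)))) => //.
  apply: measurable_funD => //; apply: measurable_sum => i; apply: measurable_funX.
  by apply: (measurable_funB (f := cst (y ord0 i))) => //; exact: measurable_rV_coord.
apply/funext => z; rewrite powRN euclid_norm_sqr; congr ((_ + _) `^ _)^-1.
by apply: eq_bigr => i _; rewrite /rV_coord !mxE.
Qed.

(** With [w] the Euclidean norm of [y - z], one has [|x - z| + t <= 2 t + w] and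
    [(2 t + w)^2 <= 9 (w^2 + t^2)]. The bound no longer contains [y], so it serves the whole cone
    over [x]. *)
Lemma poisson_kernel_le t x y z : 0 < t -> euclid_norm (y - x) < t ->
  `|poisson_kernel s t (y - z)| <= c * 3 `^ (n%:R + s) * (t `^ s / (`|x - z| + t) `^ (n%:R + s)).
Proof.
move=> t0 yx; have Q0 : 0 < euclid_norm (y - z) ^+ 2 + t ^+ 2 by rewrite ltr_wpDl ?sqr_ge0// exprn_gt0.
rewrite /poisson_kernel normrM [`|poisson_const n s * _|]normrM -/c normfV.
rewrite !(ger0_norm (powR_ge0 _ _)) -!mulrA ler_wpM2l//.
rewrite [leRHS]mulrCA ler_wpM2l ?powR_ge0//.
have xzt : 0 < `|x - z| + t by rewrite ltr_wpDl.
rewrite ler_pdivlMr ?powR_gt0// mulrC ler_pdivrMr ?powR_gt0//.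
have -> : (`|x - z| + t) `^ (n%:R + s) = ((`|x - z| + t) ^+ 2) `^ ((n%:R + s) / 2).
  by rewrite -powR_mulrn ?(ltW xzt)// -powRrM; congr (_ `^ _); field.
have -> : 3 `^ (n%:R + s) = (9 : R) `^ ((n%:R + s) / 2).
  rewrite (_ : 9 = 3 ^+ 2 :> R); last by rewrite -natrX.
  by rewrite -powR_mulrn// -powRrM; congr (_ `^ _); field.
rewrite -powRM ?(ltW Q0)// ge0_ler_powR ?nnegrE ?divr_ge0 ?(ltW ns0) ?sqr_ge0 ?mulr_ge0 ?(ltW Q0)//.
have h1 : `|x - z| <= t + euclid_norm (y - z).
  rewrite (le_trans (rV_norm_le_euclid _))// (_ : x - z = (x - y) + (y - z)); last by rewrite addrA subrK.
  rewrite (le_trans (euclid_norm_triangle _ _))// lerD2r -opprB euclid_normN.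
  exact: ltW.
have w0 : 0 <= euclid_norm (y - z) by exact: sqrtr_ge0.
move: (euclid_norm _) h1 w0 => w h1 w0.
apply: (@le_trans _ _ ((2 * t + w) ^+ 2)).
  by rewrite ler_sqr ?nnegrE; lra.
have := sqr_ge0 (2 * w - t); have := sqr_ge0 w; have := sqr_ge0 t; rewrite !expr2; nra.
Qed.

(** The base 6 is the 3 of [poisson_kernel_le] times a 2 from rounding to a dyadic dilate; [2 ^+ n]
    comes from the volume of cubes, and the denominator from a geometric series of ratio 2^-s. *)
Definition avg_const : R := c * 6 `^ (n%:R + s) * 2 ^+ n / (1 - 2 `^ (- s)).

Lemma avg_const_ge0 : 0 <= avg_const.
Proof.
rewrite /avg_const divr_ge0// ?subr_ge0.
  by rewrite mulr_ge0 ?mulr_ge0 ?powR_ge0// exprn_ge0.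
by rewrite powRN invf_le1 ?powR_gt0// ltW.
Qed.

Local Open Scope ereal_scope.

(* The kernel is dominated by a geometric sum, over the dilates 2^k t, of
   normalized characteristic functions of balls centred at x. *)
Lemma poisson_integral_le g t x y A : (0 < t)%R -> (euclid_norm (y - x) < t)%R ->
  measurable_fun setT g ->
  (forall r : R, (0 < r)%R ->
     \int[lebesgue_rV n]_(z in ball x r) `|g z|%:E <= (A * (2 * r) ^+ n)%:E) ->
  \int[lebesgue_rV n]_z `|poisson_kernel s t (y - z) * g z|%:E <= (avg_const * A)%:E.
Proof.
move=> t0 yx mg gA.
have q0 : (0 < 2 `^ s :> R)%R by rewrite powR_gt0.
have q1 : ((2 `^ s)^-1 < 1 :> R)%R.
  by rewrite invf_lt1.
pose T k : R := (2 ^+ k * t)%R.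
have T0 k : (0 < T k)%R by rewrite mulr_gt0// exprn_gt0.
pose a k : R := (c * 6 `^ (n%:R + s) * (((2 `^ s)^-1) ^+ k) * (T k ^+ n)^-1)%R.
have a0 k : (0 <= a k)%R.
  by rewrite /a !mulr_ge0 ?powR_ge0 ?invr_ge0 ?exprn_ge0 ?powR_ge0// ?invr_ge0 ?powR_ge0 ?(ltW (T0 k)).
have aE k : a k = (c * 3 `^ (n%:R + s) * (t `^ s * (2 `^ (n%:R + s) / (T k) `^ (n%:R + s))))%R.
  rewrite /a (_ : 6 = 3 * 2)%R; last by rewrite -natrM.
  rewrite powRM//; have -> : (T k `^ (n%:R + s) = T k ^+ n * ((2 `^ s) ^+ k * t `^ s))%R.
    rewrite powRD; last by rewrite gt_eqF.
    rewrite powR_mulrn ?(ltW (T0 k))// /T powRM ?exprn_ge0 ?(ltW t0)//; congr (_ * (_ * _))%R.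
    by rewrite -(powR_mulrn k (ler0n _ 2)) -powRrM mulrC powRrM powR_mulrn ?powR_ge0.
  have ts0 : (t `^ s != 0)%R by rewrite gt_eqF// powR_gt0.
  have X0 : ((2 `^ s) ^+ k != 0 :> R)%R by rewrite expf_neq0// gt_eqF.
  have Y0 : (T k ^+ n != 0)%R by rewrite expf_neq0// gt_eqF.
  rewrite exprVn; move: (3 `^ _)%R (2 `^ (n%:R + s))%R ((2 `^ s) ^+ k)%R (T k ^+ n)%R (t `^ s)%R X0 Y0 ts0.
  by move=> u v X Y w X0 Y0 w0; field; rewrite X0 Y0 w0.
have dom z : `|poisson_kernel s t (y - z) * g z|%:E <=
    \sum_(k <oo) ((a k)%:E * (\1_(ball x (T k)) z * `|g z|)%:E).
  (* The least [k] whose dilate contains [z]: either [k = 0] and [T k = t], or minimality gives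
     [T k <= 2 |x - z|]. The upper bound covers both cases. *)
  have [k /andP[zk kz]] : exists k, (`|x - z| < T k <= 2 * (`|x - z| + t))%R.
    have ex : exists k, (`|x - z| < T k)%R.
      exists (Num.truncn (`|x - z| / t)%R).+1; rewrite /T -ltr_pdivrMr//.
      apply: lt_trans (truncnS_gt _) _; rewrite -natrX ltr_nat; exact: ltn_expl.
    case: (ex_minnP ex) => -[|k] hk hmin.
      by exists 0%N; rewrite hk/= /T expr0 mul1r; have := normr_ge0 (x - z)%R; lra.
    exists k.+1; rewrite hk/= /T exprS -mulrA ler_wpM2l//.
    have : ~~ (`|x - z| < T k)%R by apply/negP => /hmin; rewrite ltnn.
    by rewrite -leNgt => /le_trans; apply; rewrite lerDl ltW.
  apply: le_trans (nneseries_lim_ge k.+1 _); last first.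
    by move=> m _ _; rewrite -EFinM lee_fin mulr_ge0// mulr_ge0.
  rewrite big_nat_recr//=; apply: (@le_trans _ _ ((a k)%:E * (\1_(ball x (T k)) z * `|g z|)%:E)); last first.
    by rewrite leeDr// sume_ge0// => m _; rewrite -EFinM lee_fin mulr_ge0// mulr_ge0.
  rewrite indicE mem_set ?mul1r; last exact/ballP.
  rewrite -EFinM lee_fin normrM ler_wpM2r//.
  apply: (le_trans (poisson_kernel_le _ t0 yx)); rewrite aE ler_wpM2l ?mulr_ge0 ?powR_ge0//.
  rewrite ler_wpM2l ?powR_ge0// ler_pdivlMr ?powR_gt0// mulrC ler_pdivrMr ?powR_gt0 ?ltr_wpDl//.
  rewrite -powRM ?addr_ge0 ?(ltW t0)// ge0_ler_powR ?nnegrE ?(ltW (T0 k)) ?(ltW ns0)//.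
  by rewrite mulr_ge0// addr_ge0// ltW.
have mterm k : measurable_fun setT (fun z => (\1_(ball x (T k)) z * `|g z|)%:E).
  apply/measurable_EFinP; apply: measurable_funM; last exact: measurableT_comp.
  by apply: measurable_indic; exact: measurable_rV_ball.
apply: (@le_trans _ _ (\int[lebesgue_rV n]_z \sum_(k <oo) ((a k)%:E * (\1_(ball x (T k)) z * `|g z|)%:E))).
  apply: ge0_le_integral => //.
  - apply/measurable_EFinP; apply: measurableT_comp => //.
    by apply: measurable_funM => //; exact: measurable_poisson_kernel.
  - apply: ge0_emeasurable_sum => k *; first by rewrite -EFinM lee_fin mulr_ge0// mulr_ge0.
    exact: measurable_funeM.
rewrite integral_nneseries//; last 2 first.
- by move=> k; exact: measurable_funeM.
- by move=> k z _; rewrite -EFinM lee_fin mulr_ge0// mulr_ge0.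
apply: (@le_trans _ _ (\sum_(k <oo) (c * 6 `^ (n%:R + s) * 2 ^+ n * A * ((2 `^ s)^-1) ^+ k)%:E)).
  apply: lee_nneseries => k *.
    by apply: integral_ge0 => z _; rewrite -EFinM lee_fin mulr_ge0// mulr_ge0.
  rewrite ge0_integralZl_EFin//.
  rewrite (_ : \int[_]_(_ in _) _ = \int[lebesgue_rV n]_(z in ball x (T k)) `|g z|%:E); last first.
    rewrite [RHS]integral_mkcond; apply: eq_integral => z _; rewrite patchE indicE.
    by case: ifP => _; rewrite ?mul1r ?mul0r.
  apply: (@le_trans _ _ ((a k)%:E * (A * (2 * T k) ^+ n)%:E)).
    by apply: lee_wpmul2l; [rewrite lee_fin|exact: gA].
  rewrite -EFinM lee_fin le_eqVlt; apply/orP; left; apply/eqP.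
  have Y0 : (T k ^+ n != 0)%R by rewrite expf_neq0// gt_eqF.
  rewrite /a [((2 * T k) ^+ n)%R]exprMn; move: (6 `^ _)%R (2 ^+ n)%R ((2 `^ s)^-1 ^+ k)%R (T k ^+ n)%R Y0.
  by move=> u v w Y Y0; field; exact: Y0.
have A0 : (0 <= A)%R.
  rewrite -(pmulr_lge0 _ (_ : 0 < (2 * 1) ^+ n))%R ?exprn_gt0// -lee_fin.
  by apply: le_trans (gA 1 ltr01)%R; exact: integral_ge0.
apply: (@le_trans _ _ (c * 6 `^ (n%:R + s) * 2 ^+ n * A / (1 - (2 `^ s)^-1))%:E).
  apply: nneseries_geometric_le; last exact: q1.
    by rewrite mulr_ge0// mulr_ge0 ?mulr_ge0 ?powR_ge0// exprn_ge0.
  by rewrite invr_ge0 ltW.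
by rewrite lee_fin /avg_const powRN le_eqVlt; apply/orP; left; apply/eqP; ring.
Qed.

End poisson_kernel_bounds.

(** * The nontangential maximal function *)

Section nontangential.
Context {R : realType} {n : nat}.
Variable s : R.
Hypothesis s0 : 0 < s.
Implicit Types (x y z h : 'rV[R]_n) (t A M L r : R) (f g : 'rV[R]_n -> R).

Local Notation C := (@avg_const R n s).

Definition bounded_measurable f := measurable_fun setT f /\ exists M, forall x, `|f x| <= M.

Lemma ball_integral_le g M x r : 0 < r -> measurable_fun setT g ->
  (forall z, `|g z| <= M) ->
  (\int[lebesgue_rV n]_(z in ball x r) `|g z|%:E <= (M * (2 * r) ^+ n)%:E)%E.
Proof.
move=> r0 mg gM; rewrite EFinM -(lebesgue_rV_ball x r0) -integral_cst//; last exact: measurable_rV_ball.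
apply: ge0_le_integral => //.
- exact: measurable_rV_ball.
- by apply/measurable_funTS/measurable_EFinP; exact: measurableT_comp.
- by move=> z _; rewrite lee_fin.
Qed.

Lemma measurable_poisson_mul g t y : measurable_fun setT g ->
  measurable_fun setT (fun z => poisson_kernel s t (y - z) * g z).
Proof. by move=> mg; apply: measurable_funM => //; exact: measurable_poisson_kernel. Qed.

Lemma poisson_integrable g t y : 0 < t -> bounded_measurable g ->
  (lebesgue_rV n).-integrable setT (fun z => (poisson_kernel s t (y - z) * g z)%:E).
Proof.
move=> t0 [mg [M gM]]; apply/integrableP; split.
  by apply/measurable_EFinP; exact: measurable_poisson_mul.
apply: le_lt_trans (ltry (C * M)); apply: (@poisson_integral_le _ _ s s0 g t y y M) => //.
  by rewrite subrr /euclid_norm big1 ?sqrtr0// => i _; rewrite mxE expr0n.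
by move=> r r0; exact: ball_integral_le.
Qed.

Lemma cs_extension_le g t x y A : 0 < t -> euclid_norm (y - x) < t -> measurable_fun setT g ->
  (forall r, 0 < r -> (\int[lebesgue_rV n]_(z in ball x r) `|g z|%:E <= (A * (2 * r) ^+ n)%:E)%E) ->
  `|cs_extension s g y t| <= C * A.
Proof.
move=> t0 yx mg gA; have H := poisson_integral_le s0 t0 yx mg gA.
have h : (`|\int[lebesgue_rV n]_z (poisson_kernel s t (y - z) * g z)%:E| <= (C * A)%:E)%E.
  apply: le_trans H; apply: le_trans (le_abse_integral _ _ _) _ => //.
  by apply/measurable_EFinP; exact: measurable_poisson_mul.
rewrite /cs_extension /Rintegral; move: h; case: (integral _ _ _) => [r||] //=.
Qed.

Lemma cs_extension_shift f y h t : measurable_fun setT f ->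
  cs_extension s f (y + h) t = cs_extension s (fun z => f (z + h)) y t.
Proof.
move=> mf; rewrite /cs_extension /Rintegral; congr fine.
rewrite -(integral_shift h); last by apply/measurable_EFinP; exact: measurable_poisson_mul.
apply: eq_integral => z _; suff -> : y + h - (z + h) = y - z by [].
by rewrite opprD addrACA subrr addr0.
Qed.

Lemma bounded_measurable_shift f h : bounded_measurable f ->
  bounded_measurable (fun z => f (z + h)).
Proof.
move=> [mf [M fM]]; split; last by exists M.
apply: (measurableT_comp (f := f)) => //; exact: measurable_shift.
Qed.

Lemma bounded_measurable_diff f h : bounded_measurable f -> bounded_measurable (diff h f).
Proof.
move=> bf; have [mfh _] := bounded_measurable_shift h bf.
have [mf [M fM]] := bf; split; first exact: measurable_funB.
by exists (M + M) => x; rewrite (le_trans (ler_normB _ _))// lerD.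
Qed.

Lemma cs_extension_diff f y h t : 0 < t -> bounded_measurable f ->
  cs_extension s (diff h f) y t = cs_extension s f (y + h) t - cs_extension s f y t.
Proof.
move=> t0 bf; have [mf _] := bf; rewrite cs_extension_shift//.
rewrite /cs_extension -RintegralB//.
- by apply: eq_Rintegral => z _; rewrite /diff mulrBr.
- by apply: poisson_integrable => //; exact: bounded_measurable_shift.
- exact: poisson_integrable.
Qed.

(** A real supremum, meaningful only over a bounded set; this is why [ntmax_ub] asks for
    [bounded_measurable f]. *)
Definition ntmax f x : R :=
  sup [set `|cs_extension s f w.1 w.2| | w in [set w : 'rV[R]_n * R |
    0 < w.2 /\ euclid_norm (w.1 - x) < w.2]].

Lemma ntmax_le f x A :
  (forall y t, 0 < t -> euclid_norm (y - x) < t -> `|cs_extension s f y t| <= A) ->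
  ntmax f x <= A.
Proof.
move=> fA; apply: ge_sup; last by move=> _ [[y t] [/= t0 yx] <-]; exact: fA.
exists `|cs_extension s f x 1|, (x, 1) => //=; split => //.
by rewrite subrr /euclid_norm big1 ?sqrtr0// => i _; rewrite mxE expr0n.
Qed.

Lemma ntmax_ub f x y t : bounded_measurable f -> 0 < t -> euclid_norm (y - x) < t ->
  `|cs_extension s f y t| <= ntmax f x.
Proof.
move=> [mf [M fM]] t0 yx; apply: ub_le_sup; last by exists (y, t).
exists (C * M) => _ [[y' t'] [/= t0' yx'] <-]; apply: (@cs_extension_le _ _ x) => //.
by move=> r r0; exact: ball_integral_le.
Qed.

Lemma ntmax_ge0 f x : bounded_measurable f -> 0 <= ntmax f x.
Proof.
move=> bf; apply: le_trans (ntmax_ub bf ltr01 (y := x) _); first by [].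
by rewrite subrr /euclid_norm big1 ?sqrtr0// => i _; rewrite mxE expr0n.
Qed.

Lemma ntmax_le_avg f x A : measurable_fun setT f ->
  (forall r, 0 < r -> (\int[lebesgue_rV n]_(z in ball x r) `|f z|%:E <= (A * (2 * r) ^+ n)%:E)%E) ->
  ntmax f x <= C * A.
Proof. by move=> mf fA; apply: ntmax_le => y t t0 yx; exact: (@cs_extension_le _ _ x). Qed.

(** Translation by [h] carries the cone over [x] onto the cone over [x + h], and the extension
    commutes with translations and differences; each of the two inequalities is then subadditivity
    of the supremum. *)
Lemma ntmax_diff f x h : bounded_measurable f ->
  `|ntmax f (x + h) - ntmax f x| <= ntmax (diff h f) x.
Proof.
move=> bf; have bd := bounded_measurable_diff h bf.
rewrite ler_distl; apply/andP; split.
  rewrite lerBlDr; apply: ntmax_le => y t t0 yx.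
  have yhx : euclid_norm (y + h - (x + h)) < t by rewrite opprD addrACA subrr addr0.
  rewrite (_ : cs_extension s f y t = cs_extension s f (y + h) t - cs_extension s (diff h f) y t); last first.
    by rewrite cs_extension_diff// opprB addrC subrK.
  rewrite (le_trans (ler_normB _ _))// lerD//; first exact: ntmax_ub.
  exact: ntmax_ub.
apply: ntmax_le => y t t0 yx.
have yhx : euclid_norm (y - h - x) < t by rewrite -addrA -opprD [h + x]addrC.
rewrite (_ : cs_extension s f y t =
  cs_extension s f (y - h) t + cs_extension s (diff h f) (y - h) t); last first.
  by rewrite cs_extension_diff// subrK addrC subrK.
by rewrite (le_trans (ler_normD _ _))// lerD//; exact: ntmax_ub.
Qed.

Lemma lip_supp_bounded L r f : 0 <= L -> 0 <= r -> lip_supp L r f -> bounded_measurable f.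
Proof.
move=> L0 r0 fL; split; first exact: continuous_measurable_rV (lip_supp_continuous fL).
have [fLx f0] := fL; exists (`|f 0| + L * r) => x.
have [xr|xr] := leP r `|x|; first by rewrite f0// normr0 addr_ge0// mulr_ge0.
rewrite -[f x](subrK (f 0)) (le_trans (ler_normD _ _))// addrC lerD//.
by rewrite (le_trans (fLx _ _))// subr0 ler_wpM2l// ltW.
Qed.

(** By [ntmax_diff] it suffices to bound the maximal function of a difference, and that difference
    is everywhere at most [L] times the length of the shift. *)
Lemma ntmax_lip L r f : 0 <= L -> 0 <= r -> lip_supp L r f ->
  forall x y, `|ntmax f x - ntmax f y| <= C * L * `|x - y|.
Proof.
move=> L0 r0 fL x y; have bf := lip_supp_bounded L0 r0 fL.
have := ntmax_diff y (x - y) bf; rewrite [y + _]addrC subrK => /le_trans; apply.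
rewrite -mulrA.
apply: ntmax_le_avg => [|rho rho0]; first exact: (bounded_measurable_diff _ bf).1.
apply: ball_integral_le => //; first exact: (bounded_measurable_diff _ bf).1.
by move=> z; rewrite (le_trans (fL.1 _ _))// addrAC subrr add0r.
Qed.

(** A cube centred at [x] meets the support only if its radius exceeds [d = |x| - r], and then its
    average is at most [I / (2 * d) ^+ n], which tends to 0 since [n >= 1]. Bounded superlevel sets
    are the compactness needed for the weak type estimate and for the truncation. *)
Lemma ntmax_decay L r f l : (0 < n)%N -> 0 <= L -> 0 < r -> lip_supp L r f -> 0 < l ->
  exists2 rho, 0 < rho & forall x, l <= ntmax f x -> `|x| < rho.
Proof.
move=> n0 L0 r0 fL l0; have bf := lip_supp_bounded L0 (ltW r0) fL; have [mf [M fM]] := bf.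
have M0 : 0 <= M by exact: le_trans (fM 0).
pose I := M * (2 * r) ^+ n.
have I0 : 0 <= I by rewrite mulr_ge0// exprn_ge0// mulr_ge0// ltW.
have C0 : 0 <= C by exact: avg_const_ge0.
have mball (x : 'rV[R]_n) (a : R) : measurable (ball x a) by exact: measurable_rV_ball.
have mEf (D : set 'rV[R]_n) : measurable_fun D (fun z => `|f z|%:E).
  by apply/measurable_funTS/measurable_EFinP; exact: measurableT_comp.
have fI x rho : (\int[lebesgue_rV n]_(z in ball x rho) `|f z|%:E <= I%:E)%E.
  apply: le_trans (ball_integral_le 0 r0 mf fM).
  rewrite integral_mkcond [leRHS]integral_mkcond; apply: ge0_le_integral => //.
  - by move=> z _; rewrite patchE; case: ifP.
  - exact/(measurable_restrictT _ _).1.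
  - exact/(measurable_restrictT _ _).1.
  - move=> z _; rewrite !patchE; case: ifPn => zx; last by case: ifP => // _; rewrite lee_fin.
    case: ifPn => // zr; rewrite fL.2 ?normr0//.
    by rewrite leNgt; apply: contra zr => zr; rewrite inE; apply/ballP; rewrite sub0r normrN.
exists (r + 1 + (C * I + 1) / l); first by rewrite !addr_gt0// divr_gt0// ltr_wpDl// mulr_ge0.
move=> x; apply: contraTT; rewrite -leNgt -ltNge => xr.
pose d := `|x| - r.
have e0 : 0 < (C * I + 1) / l by rewrite divr_gt0// ltr_wpDl// mulr_ge0.
have d1 : 1 <= d by rewrite /d; lra.
have d0 : 0 < d by lra.
apply: (@le_lt_trans _ _ (C * (I / (2 * d) ^+ n))).
  apply: ntmax_le_avg => // rho rho0; have [rd|dr] := leP rho d.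
    rewrite integral0_eq; first by rewrite lee_fin !mulr_ge0// ?invr_ge0 ?exprn_ge0 ?mulr_ge0// ltW.
    move=> z /ballP xz; rewrite fL.2 ?normr0//.
    by have := ler_normD (x - z) z; rewrite subrK; move: rd; rewrite /d; lra.
  apply: (le_trans (fI _ _)); rewrite lee_fin -mulrA ler_peMr// mulrC.
  rewrite ler_pdivlMr ?exprn_gt0 ?mulr_gt0// mul1r.
  by apply: lerXn2r; rewrite ?nnegrE ?mulr_ge0 ?ler_wpM2l// ltW.
apply: (@le_lt_trans _ _ (C * I / d)).
  rewrite -mulrA ler_wpM2l// ler_wpM2l// lef_pV2 ?posrE ?exprn_gt0 ?mulr_gt0//.
  apply: (@le_trans _ _ (2 * d)); first lra.
  by rewrite -{1}[2 * d]expr1 ler_weXn2l//; lra.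
rewrite ltr_pdivrMr//.
have : (C * I + 1) / l <= d by rewrite /d; lra.
by rewrite ler_pdivrMr// mulrC; lra.
Qed.

End nontangential.

(** * Strong type bound for the nontangential maximal function *)

Section dyadic_layers.
Context {R : realType}.
Variable p : R.
Hypothesis p1 : 1 < p.
Let p0 : 0 < p. Proof. exact: lt_trans p1. Qed.

Local Notation lev Lam k := (Lam * 2^-1 ^+ k).

(** A dyadic layer-cake formula: for [y > 0] the single level with [lev Lam k.+1 <= y <= lev Lam k]
    already gives the bound. *)
Lemma powR_le_dyadic (Lam y : R) : 0 <= y -> y <= Lam ->
  ((y `^ p)%:E <= \sum_(k <oo) ((lev Lam k) `^ p * (lev Lam k.+1 <= y)%R%:R)%:E)%E.
Proof.
move=> y0 yL; have [yE|yN] := eqVneq y 0.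
  rewrite yE powR0 ?gt_eqF//; apply: nneseries_ge0 => k _ _.
  by rewrite lee_fin mulr_ge0 ?powR_ge0.
have {y0 yN} y0 : 0 < y by rewrite lt_neqAle eq_sym yN.
have Lam0 : 0 < Lam by exact: lt_le_trans yL.
have ex : exists k, lev Lam k <= y.
  exists (Num.truncn (Lam / y)).+1; rewrite exprVn ler_pdivrMr ?exprn_gt0// mulrC -ler_pdivrMr//.
  rewrite (le_trans (ltW (truncnS_gt _)))// -natrX ler_nat ltnW//; exact: ltn_expl.
have [k [hk yk]] : exists k, lev Lam k.+1 <= y /\ y <= lev Lam k.
  case: (ex_minnP ex) => -[|k] hk hmin.
    exists 0%N; rewrite expr0 mulr1; split => //; apply: le_trans hk.
    by rewrite expr1 expr0 mulr1 ler_piMr ?(ltW Lam0)// invf_le1// ler1n.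
  exists k; split => //; rewrite leNgt; apply/negP => /ltW/hmin; by rewrite ltnn.
apply: le_trans (nneseries_lim_ge k.+1 _); last first.
  by move=> m _ _; rewrite lee_fin mulr_ge0 ?powR_ge0.
rewrite big_nat_recr//=; apply: (@le_trans _ _ ((lev Lam k) `^ p * (lev Lam k.+1 <= y)%R%:R)%:E).
  by rewrite hk mulr1 lee_fin ge0_ler_powR ?nnegrE ?(ltW p0) ?(ltW y0)// mulr_ge0 ?(ltW Lam0).
by rewrite leeDr// sume_ge0// => m _; rewrite lee_fin mulr_ge0 ?powR_ge0.
Qed.

(** Only levels below [a] contribute, and from the first of them on the sum is geometric, with ratio
    less than 1 because [p > 1]. The induction drops the top level as long as it is at least [a], so
    the bound is free of [Lam]. *)
Lemma dyadic_sum_le (Lam a : R) m : 0 < Lam -> 0 <= a ->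
  \sum_(0 <= k < m) (lev Lam k) `^ (p - 1) * (lev Lam k < a)%R%:R <=
    a `^ (p - 1) / (1 - 2^-1 `^ (p - 1)).
Proof.
move=> Lam0 a0; have p10 : 0 < p - 1 by rewrite subr_gt0.
have q1 : (2^-1 : R) `^ (p - 1) < 1.
  have := @gt0_ltr_powR R (p - 1) p10 2^-1 1; rewrite powR1; apply; rewrite ?nnegrE//.
  by rewrite invf_lt1// ltr1n.
elim: m Lam Lam0 => [|m IH] Lam Lam0.
  by rewrite big_geq// divr_ge0 ?powR_ge0// subr_ge0 ltW.
have [La|aL] := ltP Lam a; last first.
  rewrite big_nat_recl// expr0 mulr1 ltNge aL mulr0 add0r.
  rewrite (eq_bigr (fun k => (lev (Lam / 2) k) `^ (p - 1) * (lev (Lam / 2) k < a)%R%:R)) => [|k _].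
    by apply: IH; rewrite divr_gt0.
  by rewrite exprS mulrA.
apply: (@le_trans _ _ (\sum_(0 <= k < m.+1) Lam `^ (p - 1) * ((2^-1) `^ (p - 1)) ^+ k)).
  apply: ler_sum => k _; rewrite powRM ?(ltW Lam0)//.
  rewrite -[leRHS]mulr1 -mulrA -[leRHS]mulrA ler_wpM2l ?powR_ge0//.
  have -> : (2^-1 ^+ k : R) `^ (p - 1) = (2^-1 `^ (p - 1)) ^+ k.
    by rewrite -powR_mulrn// -powRrM mulrC powRrM powR_mulrn ?powR_ge0.
  by rewrite ler_wpM2l ?exprn_ge0 ?powR_ge0//; case: (_ < _); rewrite ?lexx.
rewrite -mulr_sumr ler_pM ?powR_ge0//.
- by apply: sumr_ge0 => k _; rewrite exprn_ge0// powR_ge0.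
- by rewrite ge0_ler_powR ?nnegrE ?(ltW p10) ?(ltW Lam0)// ltW.
- by apply: sum_geometric_le => //; exact: powR_ge0.
Qed.

End dyadic_layers.

Section strong_type.
Context {R : realType} {n : nat}.
Variables (p s : R).
Hypotheses (p1 : 1 < p) (s0 : 0 < s) (n0 : (0 < n)%N).
Let p0 : 0 < p. Proof. exact: lt_trans p1. Qed.
Implicit Types (g : 'rV[R]_n -> R).

Local Notation C := (@avg_const R n s).
(** Chosen so that [2 * C * delta < 1]: averages of [|g|] up to [2 * (delta * l)] keep the maximal
    function below [l]. *)
Let delta : R := (4 * (C + 1))^-1.
Let C0 : 0 <= C. Proof. exact: avg_const_ge0. Qed.
Let delta0 : 0 < delta. Proof. by rewrite invr_gt0 mulr_gt0// ltr_wpDl. Qed.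

(** The truncation of Marcinkiewicz interpolation; the part left out is too small to raise the
    maximal function to [l]. *)
Definition trunc g (l : R) x : R := if delta * l < `|g x| then `|g x| else 0.

Lemma trunc_ge0 g l x : 0 <= trunc g l x.
Proof. by rewrite /trunc; case: ifP. Qed.

Lemma measurable_trunc g l : measurable_fun setT g -> measurable_fun setT (trunc g l).
Proof.
move=> mg; apply: measurable_fun_ifT => //; last exact: measurableT_comp.
by apply: measurable_fun_ltr => //; exact: measurableT_comp.
Qed.

(** If every cube about [x] has a small average of the truncation, adding back the part below
    [delta * l] gives averages of [|g|] at most [2 * (delta * l)], so [ntmax] is below [l] at [x].
    Otherwise [x] satisfies the hypothesis of [weak_type]. *)
Lemma ntmax_level_le g (L r l : R) : 0 <= L -> 0 < r -> lip_supp L r g -> 0 < l ->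
  ((delta * l)%:E * lebesgue_rV n [set x | (l <= ntmax s g x)%R] <=
    (3 ^+ n)%:E * \int[lebesgue_rV n]_x (trunc g l x)%:E)%E.
Proof.
move=> L0 r0 gL l0; have bg := lip_supp_bounded L0 (ltW r0) gL; have [mg _] := bg.
have dl0 : 0 < delta * l by rewrite mulr_gt0.
apply: weak_type => //; [|exact: ltW|exact: measurable_trunc|by move=> x; exact: trunc_ge0|].
  have [rho rho0 H] := ntmax_decay s0 n0 L0 r0 gL l0.
  apply: (@subclosed_compact _ _ [set x : 'rV[R]_n | `|x| <= rho]).
  - rewrite (_ : mkset _ = ntmax s g @^-1` [set t | l <= t])//.
    apply: closed_comp; last exact: closed_ge.
    by move=> x _; exact: (lip_continuous (ntmax_lip s0 L0 (ltW r0) gL)).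
  - exact: compact_norm_le.
  - by move=> x /= /H /ltW.
move=> x /= lx; apply: contrapT => H.
have : ntmax s g x <= C * (2 * (delta * l)).
  apply: ntmax_le_avg => // rho rho0.
  have Hr : (\int[lebesgue_rV n]_(y in ball x rho) (trunc g l y)%:E <= (delta * l * (2 * rho) ^+ n)%:E)%E.
    rewrite leNgt; apply/negP => Hlt; apply: H; exists rho => //; exact: ltW.
  have mB : measurable (ball x rho) by exact: measurable_rV_ball.
  have mt (D : set 'rV[R]_n) : measurable_fun D (fun y => (trunc g l y)%:E).
    by apply/measurable_funTS/measurable_EFinP; exact: measurable_trunc.
  apply: (@le_trans _ _ (\int[lebesgue_rV n]_(y in ball x rho) ((trunc g l y)%:E + (delta * l)%:E))%E).
    apply: ge0_le_integral => //.
    - by apply/measurable_funTS/measurable_EFinP; exact: measurableT_comp.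
    - by apply: emeasurable_funD.
    - move=> y _; rewrite -EFinD lee_fin /trunc; case: ltP => h; last by rewrite add0r.
      by rewrite lerDl ltW.
  rewrite ge0_integralD//; last 2 first.
  - by move=> y _; rewrite lee_fin trunc_ge0.
  - by move=> y _; rewrite lee_fin ltW.
  rewrite integral_cst//; apply: (@le_trans _ _ ((delta * l * (2 * rho) ^+ n)%:E +
      (delta * l)%:E * lebesgue_rV n (ball x rho))%E); first exact: leeD2r.
  by rewrite lebesgue_rV_ball// -EFinM -EFinD lee_fin; move: ((2 * rho) ^+ n) => u; lra.
apply/negP; rewrite -ltNge (lt_le_trans _ lx)//.
rewrite (_ : C * _ = l * (C / (2 * (C + 1)))); last first.
  by rewrite /delta; field; rewrite gt_eqF// ltr_wpDl.
rewrite gtr_pMr// ltr_pdivrMr ?mulr_gt0 ?ltr_wpDl// mul1r; have := C0; lra.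
Qed.

Definition strong_const : R :=
  2 * 3 ^+ n / delta * ((2 / delta) `^ (p - 1) / (1 - 2^-1 `^ (p - 1))).

Lemma strong_const_ge0 : 0 <= strong_const.
Proof.
have d0 := ltW delta0; rewrite /strong_const mulr_ge0//.
  by rewrite divr_ge0// mulr_ge0// exprn_ge0.
rewrite divr_ge0 ?powR_ge0// subr_ge0.
have := @ge0_ler_powR R (p - 1) _ 2^-1 1; rewrite powR1; apply; rewrite ?nnegrE//.
- by rewrite subr_ge0 ltW.
- by rewrite invf_le1// ler1n.
Qed.

Local Notation lev Lam k := (Lam * 2^-1 ^+ k).

Let D : R := 2 * 3 ^+ n / delta.
Let D0 : 0 <= D. Proof. by rewrite divr_ge0 ?(ltW delta0)// mulr_ge0// exprn_ge0. Qed.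

Lemma trunc_sum_le g (Lam : R) x m : 0 < Lam ->
  \sum_(0 <= k < m) D * (lev Lam k) `^ (p - 1) * trunc g (lev Lam k.+1) x <=
  strong_const * `|g x| `^ p.
Proof.
move=> Lam0; have d0 := ltW delta0.
rewrite (eq_bigr (fun k => D * `|g x| * ((lev Lam k) `^ (p - 1) *
    (lev Lam k < 2 / delta * `|g x|)%R%:R))) => [|k _]; last first.
  have -> : (lev Lam k < 2 / delta * `|g x|) = (delta * (lev Lam k.+1) < `|g x|).
    rewrite -[2 / delta]invf_div ltr_pdivlMl ?divr_gt0//; congr (_ < _).
    by rewrite exprS; ring.
  by rewrite /trunc; case: ifP => _; rewrite ?mulr0 ?mulr1//; ring.
rewrite -mulr_sumr; have h2 : 0 <= 2 / delta * `|g x| by rewrite mulr_ge0// divr_ge0.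
apply: (@le_trans _ _ (D * `|g x| * ((2 / delta * `|g x|) `^ (p - 1) / (1 - 2^-1 `^ (p - 1))))).
  by rewrite ler_wpM2l ?(mulr_ge0 D0)//; exact: (dyadic_sum_le p1 m Lam0 h2).
rewrite powRM ?divr_ge0// -(mulr_powRB1 (x := `|g x|) (p := p))// /strong_const -/D.
by rewrite le_eqVlt; apply/orP; left; apply/eqP; ring.
Qed.

(** Real interpolation: the power is split into dyadic layers, the weak estimate is applied on each
    level, and the truncations are summed pointwise by [trunc_sum_le]. *)
Lemma strong_type g L r : 0 <= L -> 0 < r -> lip_supp L r g ->
  (intp p (ntmax s g) <= strong_const%:E * intp p g)%E.
Proof.
move=> L0 r0 gL; have bg := lip_supp_bounded L0 (ltW r0) gL; have [mg [M gM]] := bg.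
have cN : continuous (ntmax s g) := lip_continuous (ntmax_lip s0 L0 (ltW r0) gL).
have mN := continuous_measurable_rV cN.
have M0 : 0 <= M by exact: le_trans (gM 0).
(* Any positive bound for the maximal function serves as top level; it does not enter the final
   constant. *)
pose Lam := C * M + 1.
have Lam0 : 0 < Lam by rewrite ltr_wpDl// mulr_ge0.
have NLam x : ntmax s g x <= Lam.
  apply: (@le_trans _ _ (C * M)); last by rewrite lerDl.
  by apply: ntmax_le_avg => // rho rho0; exact: ball_integral_le.
have N0 x : 0 <= ntmax s g x by exact: ntmax_ge0.
have lev0 k : 0 < lev Lam k by rewrite mulr_gt0// exprn_gt0// invr_gt0.
pose K k := [set x | lev Lam k.+1 <= ntmax s g x].
have mK k : measurable (K k).
  rewrite -[K k]setTI; exact: (measurable_fun_le (f := cst (lev Lam k.+1)) (g := ntmax s g)).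
have KE k x : (lev Lam k.+1 <= ntmax s g x)%R%:R = \1_(K k) x :> R.
  by rewrite indicE; congr (nat_of_bool _)%:R; apply/idP/idP; rewrite inE.
apply: (@le_trans _ _ (\int[lebesgue_rV n]_x \sum_(k <oo) ((lev Lam k) `^ p * \1_(K k) x)%:E)%E).
  apply: ge0_le_integral => //.
  - exact: measurable_powR_norm.
  - apply: ge0_emeasurable_sum => k *; first by rewrite lee_fin mulr_ge0 ?powR_ge0.
    by apply/measurable_EFinP; exact: measurable_funM.
  - move=> x _; rewrite ger0_norm//; apply: le_trans (powR_le_dyadic p1 (N0 x) (NLam x)) _.
    by apply: lee_nneseries => k *; rewrite ?KE// lee_fin mulr_ge0 ?powR_ge0.
rewrite integral_nneseries//; last 2 first.
- by move=> k; apply/measurable_EFinP; exact: measurable_funM.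
- by move=> k x _; rewrite lee_fin mulr_ge0 ?powR_ge0.
pose w k x := D * (lev Lam k) `^ (p - 1) * trunc g (lev Lam k.+1) x.
have w0 k x : 0 <= w k x by rewrite /w mulr_ge0 ?trunc_ge0// mulr_ge0 ?powR_ge0.
have mw k : measurable_fun setT (w k).
  by apply: measurable_funM => //; exact: measurable_trunc.
apply: (@le_trans _ _ (\sum_(k <oo) \int[lebesgue_rV n]_x (w k x)%:E)%E).
  apply: lee_nneseries => k *.
    by apply: integral_ge0 => x _; rewrite lee_fin mulr_ge0 ?powR_ge0.
  under eq_integral do rewrite EFinM.
  under [leRHS]eq_integral do rewrite EFinM.
  rewrite ge0_integralZl_EFin ?powR_ge0//; last exact/measurable_EFinP.
  have mt : measurable_fun setT (fun x => (trunc g (lev Lam k.+1) x)%:E).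
    by apply/measurable_EFinP; exact: measurable_trunc.
  have t0 x : setT x -> (0 <= (trunc g (lev Lam k.+1) x)%:E)%E by rewrite lee_fin trunc_ge0.
  have Dk0 : 0 <= D * lev Lam k `^ (p - 1) by rewrite mulr_ge0 ?powR_ge0.
  rewrite (ge0_integralZl_EFin (lebesgue_rV n) measurableT t0 mt Dk0).
  rewrite integral_indic// setIT.
  have := ntmax_level_le L0 r0 gL (lev0 k.+1).
  have -> : (lev Lam k) `^ p = (lev Lam k) `^ (p - 1) * (2 / delta) * (delta * lev Lam k.+1).
    rewrite -(mulr_powRB1 (p := p)) ?(ltW (lev0 k))// exprS; field.
    by rewrite gt_eqF.
  rewrite -/(K k) => hK.
  rewrite EFinM -muleA; apply: le_trans (lee_wpmul2l _ hK) _.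
    by rewrite lee_fin mulr_ge0 ?powR_ge0// divr_ge0 ?(ltW delta0).
  rewrite muleA -EFinM; apply: lee_wpmul2r; first by apply: integral_ge0 => x _; rewrite lee_fin trunc_ge0.
  by rewrite lee_fin /D le_eqVlt; apply/orP; left; apply/eqP; ring.
rewrite -integral_nneseries//; last 2 first.
- by move=> k; exact/measurable_EFinP.
- by move=> k x _; rewrite lee_fin.
rewrite /intp -ge0_integralZl_EFin ?strong_const_ge0//; last exact: measurable_powR_norm.
apply: ge0_le_integral => //.
- by move=> x _; apply: nneseries_ge0 => k _ _; rewrite lee_fin.
- apply: ge0_emeasurable_sum => k *; first by rewrite lee_fin.
  exact/measurable_EFinP.
- by apply: measurable_funeM; exact: measurable_powR_norm.
move=> x _; apply: nneseries_le => [k|m]; first by rewrite lee_fin.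
by rewrite sumEFin -EFinM lee_fin; exact: trunc_sum_le.
Qed.

End strong_type.

(** * Positivity of the Poisson kernel *)

Section gamma_positive.
Context {R : realType}.
Variable a : R.
Hypothesis a0 : 0 < a.
Local Notation mu := (@lebesgue_measure R).

Let F (x : R) : R := x `^ (a - 1) * expR (- x).

Let F_ge0 x : 0 <= F x.
Proof. by rewrite /F mulr_ge0 ?powR_ge0 ?expR_ge0. Qed.

Let measurable_F (D : set R) : measurable_fun D F.
Proof.
apply: measurable_funTS; apply: measurable_funM => //.
by apply: (measurableT_comp (f := @expR R)) => //; exact: measurable_expR.
Qed.

Let powRB1 x : 0 < x -> x `^ (a - 1) = x `^ a / x.
Proof. by move=> x0; rewrite -(mulr_powRB1 (ltW x0) a0) mulrAC mulfV ?mul1r// gt_eqF. Qed.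

Let m := Num.truncn a.
Let M : R := m.+3`!%:R.

(** With [m] the integer part of [a], the power is at most [x ^+ m.+1]; the Taylor term of degree
    [m.+3] of the exponential leaves [x ^- 2]. *)
Let F_le_inv x : 1 <= x -> F x <= M / x ^+ 2.
Proof.
move=> x1; have x0 : 0 < x by exact: lt_le_trans x1.
rewrite /F expRN ler_pdivrMr ?expR_gt0//.
have h := @expR_ge1Dxn R x m.+2 (ltW x0).
apply: (@le_trans _ _ (x ^+ m.+1)).
  rewrite -powR_mulrn ?(ltW x0)// ler_powR//.
  by have := truncnS_gt a; rewrite -/m; lra.
rewrite mulrAC ler_pdivlMr ?exprn_gt0// -exprD addn2 mulrC -ler_pdivrMr ?ltr0n ?fact_gt0//.
by rewrite (le_trans _ h)// lerDr.
Qed.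

Let I k : set (measurableTypeR R) := `[2^-1 ^+ k.+1, 2^-1 ^+ k]%classic.
Let J k : set (measurableTypeR R) := `[2 ^+ k, 2 ^+ k.+1]%classic.

(** The bounds are of order 2^k 2^(-a k) on [I k] and 4^-k on [J k]; multiplied by the lengths of
    the intervals they give two convergent geometric series. *)
Let F_dyadic (x : R) : 0 < x -> ((F x)%:E <=
  \sum_(k <oo) ((2 ^+ k.+1 * (2^-1 `^ a) ^+ k)%:E * (\1_(I k) x)%:E +
                (M * 4^-1 ^+ k)%:E * (\1_(J k) x)%:E))%E.
Proof.
move=> x0.
have t0 k : (0 <= (2 ^+ k.+1 * (2^-1 `^ a) ^+ k)%:E * (\1_(I k) x)%:E +
                (M * 4^-1 ^+ k)%:E * (\1_(J k) x)%:E)%E.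
  rewrite -!EFinM -EFinD lee_fin addr_ge0// mulr_ge0//; rewrite mulr_ge0// ?exprn_ge0// powR_ge0//.
suff [k Fk] : exists k, ((F x)%:E <= (2 ^+ k.+1 * (2^-1 `^ a) ^+ k)%:E * (\1_(I k) x)%:E +
                (M * 4^-1 ^+ k)%:E * (\1_(J k) x)%:E)%E.
  apply: (le_trans Fk); apply: le_trans (nneseries_lim_ge k.+1 _) => //.
  by rewrite big_nat_recr//= leeDr// sume_ge0.
have [x1|x1] := leP x 1.
  have ex : exists k, 2^-1 ^+ k <= x.
    exists (Num.truncn x^-1).+1; rewrite exprVn -[leRHS]invrK lef_pV2 ?posrE ?exprn_gt0 ?invr_gt0//.
    rewrite (le_trans (ltW (truncnS_gt _)))// -natrX ler_nat ltnW//; exact: ltn_expl.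
  have [k [hk xk]] : exists k, 2^-1 ^+ k.+1 <= x /\ x <= 2^-1 ^+ k.
    case: (ex_minnP ex) => -[|k] hk hmin.
      exists 0%N; rewrite expr0; split => //; apply: le_trans hk.
      by rewrite expr1 expr0 invf_le1// ler1n.
    by exists k; split => //; rewrite leNgt; apply/negP => /ltW/hmin; rewrite ltnn.
  exists k; rewrite [\1_(I k) x]indicE mem_set; last by rewrite /I /= in_itv/= hk xk.
  rewrite mule1; apply: (@le_trans _ _ (2 ^+ k.+1 * (2^-1 `^ a) ^+ k)%:E); last first.
    by rewrite leeDl// -EFinM lee_fin mulr_ge0// mulr_ge0// exprn_ge0.
  rewrite lee_fin /F; apply: (@le_trans _ _ (x `^ (a - 1))).
    by rewrite ler_piMr ?powR_ge0// expR_le1 oppr_le0 ltW.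
  rewrite powRB1// mulrC; apply: ler_pM; rewrite ?invr_ge0 ?powR_ge0 ?(ltW x0)//.
    by rewrite -[leRHS]invrK lef_pV2 ?posrE ?invr_gt0 ?exprn_gt0// -exprVn.
  rewrite -powR_mulrn ?powR_ge0// -powRrM mulrC powRrM powR_mulrn//.
  by rewrite ge0_ler_powR ?nnegrE ?(ltW a0) ?(ltW x0)// exprn_ge0.
have ex : exists k, x < 2 ^+ k.
  exists (Num.truncn x).+1; apply: lt_trans (truncnS_gt _) _; rewrite -natrX ltr_nat; exact: ltn_expl.
have [k [hk xk]] : exists k, 2 ^+ k <= x /\ x <= 2 ^+ k.+1.
  case: (ex_minnP ex) => -[|k] hk hmin; first by move: hk; rewrite expr0 ltNge ltW.
  exists k; split; last exact: ltW.
  by rewrite leNgt; apply/negP => /hmin; rewrite ltnn.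
exists k; rewrite [\1_(J k) x]indicE mem_set; last by rewrite /J /= in_itv/= hk xk.
rewrite mule1; apply: (@le_trans _ _ (M * 4^-1 ^+ k)%:E); last first.
  by rewrite leeDr// -EFinM lee_fin mulr_ge0// mulr_ge0// ?exprn_ge0// powR_ge0.
rewrite lee_fin (le_trans (F_le_inv (ltW x1)))// ler_wpM2l// exprVn lef_pV2 ?posrE ?exprn_gt0//.
rewrite (_ : 4 = 2 ^+ 2 :> R); last by rewrite -natrX.
by rewrite exprAC ler_sqr ?nnegrE ?exprn_ge0// ltW.
Qed.

Let mI k : measurable (I k). Proof. exact: measurable_itv. Qed.
Let mJ k : measurable (J k). Proof. exact: measurable_itv. Qed.

Let muI k : mu (I k) = (2^-1 ^+ k.+1)%:E.
Proof.
rewrite lebesgue_measure_itv/= lte_fin exprS.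
have h : 0 < 2^-1 ^+ k :> R by rewrite exprn_gt0.
rewrite ifT; last lra.
by rewrite -EFinB; congr EFin; lra.
Qed.

Let muJ k : mu (J k) = (2 ^+ k)%:E.
Proof.
rewrite lebesgue_measure_itv/= lte_fin exprS.
have h : 0 < 2 ^+ k :> R by rewrite exprn_gt0.
rewrite ifT; last lra.
by rewrite -EFinB; congr EFin; lra.
Qed.

(** Needed for positivity: a divergent integral would make [Gamma a] equal to 0. *)
Let integral_F_lt_pinfty : (\int[mu]_(x in `]0%R, +oo[) (F x)%:E < +oo)%E.
Proof.
pose T k (x : R) := ((2 ^+ k.+1 * (2^-1 `^ a) ^+ k)%:E * (\1_(I k) x)%:E +
                (M * 4^-1 ^+ k)%:E * (\1_(J k) x)%:E)%E.
have T0 k x : (0 <= T k x)%E.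
  by rewrite /T -!EFinM -EFinD lee_fin addr_ge0// mulr_ge0//; rewrite mulr_ge0// ?exprn_ge0// powR_ge0.
have mT k D : measurable D -> measurable_fun D (T k).
  by move=> mD; apply: emeasurable_funD; apply: measurable_funeM; apply/measurable_EFinP;
    apply: measurable_indic; [exact: mI|exact: mJ].
have q1 : (2^-1 : R) `^ a < 1.
  have := @gt0_ltr_powR R a a0 2^-1 1; rewrite powR1; apply; rewrite ?nnegrE//.
  by rewrite invf_lt1// ltr1n.
apply: (@le_lt_trans _ _ (1 / (1 - 2^-1 `^ a) + M / (1 - 2^-1))%:E); last exact: ltry.
apply: (@le_trans _ _ (\int[mu]_(x in `]0%R, +oo[) \sum_(k <oo) T k x)%E).
  apply: ge0_le_integral => //.
  - by move=> x _; rewrite lee_fin.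
  - by apply/measurable_EFinP; exact: measurable_F.
  - by apply: ge0_emeasurable_sum => // k *; exact: mT.
  - by move=> x; rewrite /= in_itv/= andbT; exact: F_dyadic.
rewrite integral_nneseries//; last by move=> k; exact: mT.
apply: (@le_trans _ _ (\sum_(k <oo) ((1 * (2^-1 `^ a) ^+ k)%:E + (M * 2^-1 ^+ k)%:E))%E).
  apply: lee_nneseries => k *; first by apply: integral_ge0.
  apply: (@le_trans _ _ (\int[mu]_x T k x)%E).
    by apply: ge0_subset_integral => //; exact: mT.
  have mIk : measurable_fun (setT : set (measurableTypeR R)) (fun x => (\1_(I k) x : R)%:E).
    by apply/measurable_EFinP; apply: measurable_indic; exact: mI.
  have mJk : measurable_fun (setT : set (measurableTypeR R)) (fun x => (\1_(J k) x : R)%:E).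
    by apply/measurable_EFinP; apply: measurable_indic; exact: mJ.
  have c1 : 0 <= 2 ^+ k.+1 * (2^-1 `^ a) ^+ k by rewrite mulr_ge0// exprn_ge0// powR_ge0.
  have c2 : 0 <= M * 4^-1 ^+ k by rewrite mulr_ge0// exprn_ge0.
  have p1 x : setT x -> (0 <= (2 ^+ k.+1 * (2^-1 `^ a) ^+ k)%:E * (\1_(I k) x)%:E)%E.
    by rewrite -EFinM lee_fin mulr_ge0.
  have p2 x : setT x -> (0 <= (M * 4^-1 ^+ k)%:E * (\1_(J k) x)%:E)%E.
    by rewrite -EFinM lee_fin mulr_ge0.
  rewrite (ge0_integralD _ measurableT p1 _ p2); [|exact: measurable_funeM|exact: measurable_funeM].
  rewrite (ge0_integralZl_EFin _ _ _ mIk c1)// (ge0_integralZl_EFin _ _ _ mJk c2)//.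
  have -> : (\int[mu]_x (\1_(I k) x)%:E = (2^-1 ^+ k.+1)%:E)%E.
    by rewrite integral_indic// setIT; exact: muI.
  have -> : (\int[mu]_x (\1_(J k) x)%:E = (2 ^+ k)%:E)%E.
    by rewrite integral_indic// setIT; exact: muJ.
  rewrite -!EFinM -!EFinD lee_fin.
  rewrite (_ : 2 ^+ k.+1 * _ * _ = 1 * (2^-1 `^ a) ^+ k); last first.
    by rewrite mulrAC -exprMn mulfV// expr1n.
  by rewrite -mulrA -exprMn lerD2l ler_wpM2l// (_ : 4^-1 * 2 = 2^-1 :> R)//; lra.
rewrite nneseriesD => [|k *|k *]; last 2 first.
- by rewrite lee_fin mul1r exprn_ge0// powR_ge0.
- by rewrite lee_fin mulr_ge0// exprn_ge0.
rewrite EFinD; apply: leeD; apply: nneseries_geometric_le => //.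
by rewrite invf_lt1// ltr1n.
Qed.

Lemma Gamma_gt0 : 0 < Gamma a.
Proof.
rewrite /Gamma /Rintegral fine_gt0//; apply/andP; split; last exact: integral_F_lt_pinfty.
(* On [[1, 2]] the power is [x^a / x >= 1 / 2] and the exponential is at least [expR (- 2)]. *)
apply: (@lt_le_trans _ _ (expR (- 2) / 2)%:E); first by rewrite lte_fin divr_gt0 ?expR_gt0.
have -> : (expR (- 2) / 2)%:E = (\int[mu]_(x in `[1%R, 2%R]) (expR (- 2) / 2)%:E)%E.
  have muK : mu `[1%R, 2%R]%classic = 1%E.
    rewrite lebesgue_measure_itv/= lte_fin ltr1n -EFinB; congr EFin; lra.
  rewrite integral_cst//.
  by rewrite -[LHS]mule1; congr (_ * _)%E; exact/esym/muK.
apply: (@le_trans _ _ (\int[mu]_(x in `[1%R, 2%R]) (F x)%:E)%E).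
  apply: ge0_le_integral => //.
  - by apply/measurable_EFinP; exact: measurable_F.
  - move=> x; rewrite /= in_itv/= => /andP[x1 x2]; rewrite lee_fin /F mulrC.
    have x0 : 0 < x by exact: lt_le_trans x1.
    apply: ler_pM; rewrite ?expR_ge0// ?ler_expR ?lerN2//.
    rewrite powRB1// -[leLHS]mul1r; apply: ler_pM => //.
      by have := @ge0_ler_powR R a (ltW a0) 1 x; rewrite powR1; apply; rewrite ?nnegrE// ltW.
    by rewrite lef_pV2 ?posrE.
apply: ge0_subset_integral => //.
- by apply/measurable_EFinP; exact: measurable_F.
- by move=> x _; rewrite lee_fin.
- by move=> x; rewrite /= !in_itv/= andbT => /andP[x1 _]; exact: lt_le_trans x1.
Qed.

End gamma_positive.

Section poisson_kernel_lower.
Context {R : realType} {n : nat}.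
Variable s : R.
Hypothesis s0 : 0 < s.
Implicit Types (x y : 'rV[R]_n) (t : R).

Lemma poisson_const_gt0 : 0 < poisson_const n s.
Proof.
rewrite /poisson_const divr_gt0 ?mulr_gt0 ?powR_gt0 ?pi_gt0// Gamma_gt0 ?divr_gt0//.
by rewrite ltr_wpDl.
Qed.

Lemma poisson_kernel_ge0 t x : 0 <= poisson_kernel s t x.
Proof.
apply: divr_ge0; last exact: powR_ge0.
by apply: mulr_ge0; [exact/ltW/poisson_const_gt0|exact: powR_ge0].
Qed.

(** [kernel_min / t ^+ n] is the value of the kernel on the Euclidean sphere of radius [t]. *)
Definition kernel_min : R := poisson_const n s / 2 `^ ((n%:R + s) / 2).

Lemma kernel_min_gt0 : 0 < kernel_min.
Proof. by rewrite divr_gt0 ?poisson_const_gt0// powR_gt0. Qed.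

Lemma poisson_kernel_ge t x : 0 < t -> euclid_norm x <= t ->
  kernel_min / t ^+ n <= poisson_kernel s t x.
Proof.
move=> t0 xt; have c0 := poisson_const_gt0.
have ns : 0 <= (n%:R + s) / 2 by rewrite divr_ge0// addr_ge0// ltW.
have -> : kernel_min / t ^+ n = poisson_const n s * t `^ s / (2 * t ^+ 2) `^ ((n%:R + s) / 2).
  rewrite powRM ?sqr_ge0// -(powR_mulrn 2 (ltW t0)) -powRrM (_ : 2%:R * _ = n%:R + s); last by field.
  rewrite powRD; last by rewrite gt_eqF ?ltr_wpDl.
  rewrite (powR_mulrn n (ltW t0)) /kernel_min.
  have h1 : t ^+ n != 0 by rewrite gt_eqF// exprn_gt0.
  have h2 : t `^ s != 0 by rewrite gt_eqF// powR_gt0.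
  have h3 : 2 `^ ((n%:R + s) / 2) != 0 :> R by rewrite gt_eqF// powR_gt0.
  move: (poisson_const n s) (t ^+ n) (t `^ s) (2 `^ _) h1 h2 h3 => c u v w h1 h2 h3.
  by field; rewrite h1 h2 h3.
have ct0 : 0 <= poisson_const n s * t `^ s by rewrite (mulr_ge0 (ltW c0)) ?powR_ge0.
apply: (ler_wpM2l ct0).
have Q0 : 0 < euclid_norm x ^+ 2 + t ^+ 2 by rewrite ltr_wpDl ?sqr_ge0// exprn_gt0.
rewrite lef_pV2 ?posrE ?powR_gt0// ?mulr_gt0 ?exprn_gt0//.
have xt2 : euclid_norm x ^+ 2 <= t ^+ 2 by rewrite ler_sqr ?nnegrE ?sqrtr_ge0 ?(ltW t0).
rewrite ge0_ler_powR ?nnegrE ?(ltW Q0)//; first by rewrite mulr_ge0// sqr_ge0.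
by move: xt2; move: (euclid_norm x ^+ 2) (t ^+ 2) => u v; lra.
Qed.

End poisson_kernel_lower.

(** * Both implications *)

Section capacity_to_weak_type.
Context {R : realType} {n : nat}.
Variables (p beta s : R).
Hypotheses (p1 : 1 < p) (beta0 : 0 < beta) (beta1 : beta < 1) (s0 : 0 < s) (n0 : (0 < n)%N).
Implicit Types (f g : 'rV[R]_n -> R) (L r l : R).
Let p0 : 0 < p. Proof. exact: lt_trans p1. Qed.
Local Notation C := (@avg_const R n s).

Lemma lip_supp_diff L r f h : lip_supp L r f -> lip_supp (L + L) (r + `|h|) (diff h f).
Proof.
move=> [fL f0]; split=> [x y|x xr].
  rewrite (_ : _ - _ = (f (x + h) - f (y + h)) - (f x - f y)); last by rewrite /diff; ring.
  rewrite (le_trans (ler_normB _ _))// mulrDl lerD// (le_trans (fL _ _))//.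
  by rewrite opprD addrACA subrr addr0.
rewrite /diff !f0 ?subrr//; first by rewrite (le_trans _ xr)// lerDl.
by have := ler_normB (x + h) h; rewrite addrK; lra.
Qed.

Definition ntmax_const : R := strong_const (n := n) p s `^ p^-1.

(** The constant of [strong_type] depends neither on the Lipschitz constant nor on the support, so
    it is the same for all differences [diff h f], whose supports grow with [h]. *)
Lemma besov_norm_ntmax L r f : 0 <= L -> 0 < r -> lip_supp L r f ->
  (besov_norm p beta (ntmax s f) <= ntmax_const%:E * besov_norm p beta f)%E.
Proof.
move=> L0 r0 fL; have bf := lip_supp_bounded L0 (ltW r0) fL.
apply: besov_norm_le_scale => //; first exact: powR_ge0.
move=> h; rewrite /ntmax_const -powRrM mulVf ?gt_eqF// powRr1; last exact: strong_const_ge0.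
have dL := lip_supp_diff h fL.
have LL0 : 0 <= L + L by rewrite addr_ge0.
have rh0 : 0 < r + `|h| by rewrite ltr_pwDl.
apply: le_trans (strong_type p1 s0 n0 LL0 rh0 dL).
have cN := lip_continuous (ntmax_lip s0 L0 (ltW r0) fL).
apply: le_intp => //.
- exact: continuous_measurable_rV (lip_continuous (ntmax_lip s0 LL0 (ltW rh0) dL)).
- exact: continuous_measurable_rV (diff_continuous cN).
- by move=> x; rewrite [leRHS]ger0_norm ?ntmax_ge0//; [exact: ntmax_diff|exact: bounded_measurable_diff].
Qed.

Lemma besov_capacity_ntmax L r f l : 0 <= L -> 0 < r -> lip_supp L r f -> 0 < l ->
  (besov_capacity p beta [set x | (l < ntmax s f x)%R] <=
   ((2 / l * ntmax_const)%:E * besov_norm p beta f) `^ p)%E.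
Proof.
move=> L0 r0 fL l0; have bf := lip_supp_bounded L0 (ltW r0) fL.
have NL := ntmax_lip s0 L0 (ltW r0) fL.
have cN := lip_continuous NL.
have C0 : 0 <= C by exact: avg_const_ge0.
(* The maximal function decays but need not have compact support: cutting at [l / 2] restores it,
   and the slope [2 / l] restores the value 1 at height [l]. *)
pose phi (u : R) := 2 / l * Num.max (u - l / 2) 0.
have l20 : 0 <= 2 / l by rewrite divr_ge0// ltW.
have phiL u v : `|phi u - phi v| <= 2 / l * `|u - v|.
  rewrite /phi -mulrBr normrM (ger0_norm l20) ler_wpM2l//.
  have h1 := ler_norm (u - v); have h2 := ler_norm (v - u); rewrite distrC in h2.
  by rewrite /Num.max; do !case: ifPn; rewrite -?leNgt => *;
    rewrite ler_norml; apply/andP; split; lra.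
have [rho rho0 Hrho] := ntmax_decay s0 n0 L0 r0 fL (divr_gt0 l0 (ltr0Sn R 1)).
have gL : lip_supp (2 / l * (C * L)) rho (phi \o ntmax s f).
  split=> [x y|x xr] /=.
    by rewrite (le_trans (phiL _ _))// -[leRHS]mulrA; apply: (ler_wpM2l l20); exact: NL.
  rewrite /phi max_r ?mulr0// subr_le0 leNgt; apply/negP => /ltW/Hrho.
  by rewrite ltNge xr.
have gL0 : 0 <= 2 / l * (C * L) by rewrite mulr_ge0// mulr_ge0.
apply: (@le_trans _ _ (besov_norm p beta (phi \o ntmax s f) `^ p)%E).
  apply: ereal_inf_lbound; exists (phi \o ntmax s f) => //; split.
  - exact: (besov_space_lip p1 beta0 beta1 n0 gL0 rho0 gL).
  - exact: lip_supp_continuous gL.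
  - have oO : open [set x | l < ntmax s f x].
      rewrite (_ : mkset _ = ntmax s f @^-1` [set t | l < t])//.
      apply: open_comp; last exact: open_gt.
      by move=> x _; exact: cN.
    exists [set x | l < ntmax s f x]; split; first by rewrite (interior_id _).1.
    move=> x lx; rewrite indicE mem_set//= /phi max_l; last by move: lx => /= lx; lra.
    by rewrite mulrAC ler_pdivlMr// mul1r; move: lx => /= lx; lra.
apply: lee_poweR; [exact: ltW|exact: besov_norm_ge0|].
have h := besov_norm_contract beta p1 cN l20 phiL.
rewrite EFinM -muleA; apply: (le_trans h).
by apply: lee_wpmul2l; [rewrite lee_fin|exact: (besov_norm_ntmax L0 r0 fL)].
Qed.

Lemma capacity_to_weak_type (q0 : R) (mu : {outer_measure set (half_space R n) -> \bar R}) (C' : R) :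
  0 < q0 ->
  (forall O : set 'rV[R]_n, open O ->
     (mu (tent O) <= C'%:E * (besov_capacity p beta O) `^ (q0 / p))%E) ->
  forall f, test_function f ->
     (weak_norm q0 mu (fun z => cs_extension s f (val z).1 (val z).2)
        <= (`|C'| `^ q0^-1 * (2 * ntmax_const))%:E * besov_norm p beta f)%E.
Proof.
move=> q00 H f /test_function_lip[L [r [L0 r0 fL]]].
have bf := lip_supp_bounded L0 (ltW r0) fL.
have c0 : 0 <= ntmax_const by exact: powR_ge0.
apply: ge_ereal_sup => _ [l /= l0 <-].
pose O := [set x | l < ntmax s f x].
have oO : open O.
  rewrite (_ : O = ntmax s f @^-1` [set t | l < t])//.
  apply: open_comp; last exact: open_gt.
  by move=> x _; exact: (lip_continuous (ntmax_lip s0 L0 (ltW r0) fL)).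
(* The point [(x, t)] lies in the cone over every [y] of the ball [B(x, t)], so the maximal function
   exceeds [l] on that whole ball. *)
have sub : [set z : half_space R n | l < `|cs_extension s f (val z).1 (val z).2|] `<=` tent O.
  move=> z /= lz y; rewrite /euclid_ball /= => yx; apply: (lt_le_trans lz).
  apply: ntmax_ub => //; first exact: (valP z).
  by rewrite -opprB euclid_normN.
have bn0 : (0 <= besov_norm p beta f)%E by exact: besov_norm_ge0.
have q0p0 : 0 <= q0 / p by rewrite divr_ge0// ltW.
set X := ((2 / l * ntmax_const)%:E * besov_norm p beta f)%E.
have X0 : (0 <= X)%E by rewrite mule_ge0// lee_fin mulr_ge0// divr_ge0// ltW.
have muO : (mu [set z : half_space R n | (l < `|cs_extension s f (val z).1 (val z).2|)%R] <= `|C'|%:E * X `^ q0)%E.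
  apply: le_trans (le_trans _ (H _ oO)) _; first by apply: le_outer_measure; exact: sub.
  apply: (@le_trans _ _ (`|C'|%:E * (besov_capacity p beta O) `^ (q0 / p))%E).
    by apply: lee_wpmul2r; [exact: poweR_ge0|rewrite lee_fin ler_norm].
  apply: lee_wpmul2l; first by rewrite lee_fin.
  have -> : (X `^ q0 = (X `^ p) `^ (q0 / p))%E.
    by rewrite -poweRrM mulrCA mulfV ?mulr1// gt_eqF.
  apply: lee_poweR => //; last exact: (besov_capacity_ntmax L0 r0 fL l0).
  by apply: le_ereal_inf_tmp => _ [g _ <-]; exact: poweR_ge0.
apply: (@le_trans _ _ (l%:E * (`|C'|%:E * X `^ q0) `^ q0^-1)%E).
  apply: lee_wpmul2l; first by rewrite lee_fin ltW.
  by apply: lee_poweR => //; rewrite ?invr_ge0 ?(ltW q00)//; exact: outer_measure_ge0.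
(* The root of order [q0] gives back [X], whose factor [1 / l] cancels the [l] of the weak norm. *)
rewrite poweRM ?lee_fin ?poweR_ge0// -poweRrM mulfV ?gt_eqF// poweRe1//.
rewrite poweR_EFin /X !muleA -!EFinM le_eqVlt; apply/orP; left; apply/eqP; congr (_%:E * _)%E.
by move: (`|C'| `^ _) => u; field; rewrite gt_eqF.
Qed.

End capacity_to_weak_type.

(** * From the weak type estimate to the capacitary condition *)

Section weak_type_to_capacity.
Context {R : realType} {n : nat}.
Variables (p beta s : R).
Hypotheses (p1 : 1 < p) (beta0 : 0 < beta) (beta1 : beta < 1) (s0 : 0 < s) (n0 : (0 < n)%N).
Implicit Types (f g psi : 'rV[R]_n -> R) (x y : 'rV[R]_n) (t l : R).
Let p0 : 0 < p. Proof. exact: lt_trans p1. Qed.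

Lemma test_function_bounded psi : test_function psi ->
  continuous psi /\ bounded_measurable psi.
Proof.
move=> /test_function_lip[L [r [L0 r0 fL]]]; split; first exact: lip_supp_continuous fL.
exact: lip_supp_bounded L0 (ltW r0) fL.
Qed.

(** By [euclid_norm_le] the cube of radius [t / (n + 1)] lies in the Euclidean ball of radius [t],
    where the kernel is at least [kernel_min / t ^+ n]. *)
Lemma cs_extension_ge psi x t : bounded_measurable psi -> (forall y, 0 <= psi y) -> 0 < t ->
  ((kernel_min (n := n) s / t ^+ n)%:E *
     \int[lebesgue_rV n]_(y in ball x (t / n.+1%:R)) (psi y)%:E <= (cs_extension s psi x t)%:E)%E.
Proof.
move=> bpsi psi0 t0; have [mpsi _] := bpsi.
have int := poisson_integrable s0 x t0 bpsi.
have mB : measurable (ball x (t / n.+1%:R)) by exact: measurable_rV_ball.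
have k0 : 0 <= kernel_min (n := n) s / t ^+ n.
  by rewrite divr_ge0 ?exprn_ge0 ?(ltW t0)// ltW// kernel_min_gt0.
rewrite /cs_extension /Rintegral fineK; last exact: integrable_fin_num int.
rewrite -ge0_integralZl_EFin//; [|by move=> y _; rewrite lee_fin|by apply/measurable_EFinP/measurable_funTS].
have mP := measurable_poisson_mul s t x mpsi.
apply: (@le_trans _ _ (\int[lebesgue_rV n]_(y in ball x (t / n.+1%:R))
   (poisson_kernel s t (x - y) * psi y)%:E)%E).
  apply: ge0_le_integral => //.
  - by move=> y _; rewrite -EFinM lee_fin mulr_ge0.
  - by apply: measurable_funeM; apply/measurable_EFinP/measurable_funTS.
  - by apply/measurable_EFinP/measurable_funTS.
  - move=> y /ballP xy; rewrite -EFinM lee_fin ler_wpM2r//; apply: poisson_kernel_ge => //.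
    rewrite (le_trans (euclid_norm_le _))//.
    apply: (@le_trans _ _ (n%:R * (t / n.+1%:R))); first by rewrite ler_wpM2l// ltW.
    by rewrite mulrCA ger_pMr// ler_pdivrMr ?ltr0n// mul1r ler_nat.
apply: ge0_subset_integral => //.
  exact/measurable_EFinP.
by move=> y _; rewrite lee_fin mulr_ge0//; exact: poisson_kernel_ge0.
Qed.

Lemma weak_norm_level (q0 : R) (mu : {outer_measure set (half_space R n) -> \bar R}) l (M : R)
    (w : half_space R n -> R) : 0 < q0 -> 0 < l -> 0 <= M -> (weak_norm q0 mu w <= M%:E)%E ->
  (mu [set z | (l < `|w z|)%R] <= ((M / l) `^ q0)%:E)%E.
Proof.
move=> q00 l0 M0 wM; set E := mkset _.
have E0 : (0 <= mu E)%E by exact: outer_measure_ge0.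
have h : (l%:E * mu E `^ q0^-1 <= M%:E)%E.
  by apply: le_trans wM; apply: ereal_sup_ubound; exists l.
have h' : (mu E `^ q0^-1 <= (M / l)%:E)%E.
  by rewrite mulrC EFinM lee_pdivlMl.
have -> : mu E = ((mu E `^ q0^-1) `^ q0)%E.
  by rewrite -poweRrM mulVf ?gt_eqF// poweRe1.
by rewrite -poweR_EFin; apply: lee_poweR => //; [exact: ltW|exact: poweR_ge0].
Qed.

Lemma cvge0_lt (u : nat -> \bar R) (e : R) : u k @[k --> \oo] --> 0%E -> 0 < e ->
  exists N, forall k, (N <= k)%N -> (u k < e%:E)%E.
Proof.
move=> u0 e0; have nb : nbhs (0 : \bar R)%E [set x | (x < e%:E)%E].
  by apply: open_nbhs_nbhs; split; [exact: open_ereal_lt_ereal|rewrite /= lte_fin].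
by have [N _ HN] := u0 _ nb; exists N => k Nk; exact: HN.
Qed.

(** [16 * a0] is [kernel_min / t ^+ n] times the volume of the cube of radius [t / (n + 1)], hence
    free of [t]. The 16 leaves room for the losses in [tent_le]. *)
Let a0 : R := kernel_min (n := n) s * (2 / n.+1%:R) ^+ n / 16.
Let a00 : 0 < a0.
Proof.
apply: divr_gt0 => //; apply: mulr_gt0; first exact: kernel_min_gt0.
by rewrite exprn_gt0// divr_gt0.
Qed.

(* The approximation of the completion is decomposed into a telescoping series
   of test functions with geometrically decreasing norms; majorizing the absolute
   values of its terms by nonnegative test functions, at each point of the tent
   one of the extensions must be large. *)
Lemma tent_le (q0 K : R) (mu : {outer_measure set (half_space R n) -> \bar R}) f
    (O N : set 'rV[R]_n) (c : R) : 0 < q0 -> 0 <= K ->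
  (forall g, test_function g ->
     (weak_norm q0 mu (fun z => cs_extension s g (val z).1 (val z).2)
        <= K%:E * besov_norm p beta g)%E) ->
  besov_space p beta f -> continuous f -> O `<=` N° -> (forall x, N x -> \1_N x <= f x) ->
  0 < c -> (besov_norm p beta f <= c%:E)%E ->
  (mu (tent O) <= ((9 * K * c / a0) `^ q0 / (1 - 2^-1 `^ q0))%:E)%E.
Proof.
move=> q00 K0 H [mf [phi [tphi phif phi1]]] cf ON Nf c0 bfc.
have cphi k : continuous (phi k).
  by have [tk _] := tphi k; have [ck _] := test_function_bounded tk.
(* The condition [k <= j] preserves convergence in the mean along the subsequence. *)
have /choice[j Hj] : forall k, exists j, (k <= j)%N /\
    (besov_norm p beta (phi j \- f)%R <= (c * 4^-1 ^+ k)%:E)%E.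
  move=> k; have e0 : 0 < c * 4^-1 ^+ k by rewrite mulr_gt0// exprn_gt0// invr_gt0.
  have [M HM] := cvge0_lt phif e0; exists (maxn k M); split; first exact: leq_maxl.
  by apply/ltW/HM; exact: leq_maxr.
pose g k := if k is k'.+1 then phi (j k) \- phi (j k') else phi (j 0%N).
have cphif k : continuous (phi (j k) \- f).
  by move=> x; apply: (continuousB (f := phi (j k)) (g := f)); [exact: cphi|exact: cf].
have bg k : (besov_norm p beta (g k) <= (8 * c * 4^-1 ^+ k)%:E)%E.
  case: k => [|k]; rewrite /g.
    rewrite (_ : phi _ = (phi (j 0%N) \- f) \+ f); last by apply/funext => x /=; rewrite subrK.
    apply: (le_trans (besov_normD beta p1 n0 (@cphif 0%N) cf)).
    apply: (le_trans (leeD (Hj 0%N).2 bfc)).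
    by rewrite -EFinD lee_fin expr0; lra.
  have c1 : continuous (-%R \o (phi (j k) \- f)).
    by move=> x; apply: (continuousN (f := phi (j k) \- f)); exact: cphif.
  rewrite (_ : phi _ \- _ = (phi (j k.+1) \- f) \+ (-%R \o (phi (j k) \- f))); last first.
    by apply/funext => x /=; ring.
  apply: (le_trans (besov_normD beta p1 n0 (@cphif k.+1) c1)).
  have hN : (besov_norm p beta (-%R \o (phi (j k) \- f)%R) <= (c * 4^-1 ^+ k)%:E)%E.
    have hL (u v : R) : `|- u - - v| <= 1 * `|u - v| by rewrite mul1r opprK addrC distrC.
    apply: (le_trans (besov_norm_contract beta p1 (@cphif k) ler01 hL)).
    by rewrite mul1e; exact: (Hj k).2.
  apply: (le_trans (leeD (Hj k.+1).2 hN)).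
  rewrite -EFinD lee_fin exprS; have : 0 <= c * 4^-1 ^+ k by rewrite mulr_ge0 ?(ltW c0)// exprn_ge0.
  by rewrite -[8 * c * _]mulrA [c * (_ * _)]mulrCA; lra.
have glip k : exists L r, [/\ 0 <= L, 0 < r & lip_supp L r (fun x => `|g k x|)].
  have [L [r [L0 r0 gL]]] : exists L r, [/\ 0 <= L, 0 < r & lip_supp L r (g k)].
    have lp i : exists L r, [/\ 0 <= L, 0 < r & lip_supp L r (phi i)].
      by apply: test_function_lip; have [] := tphi i.
    case: k => [|k]; rewrite /g; first exact: lp.
    have [L [r [L0 r0 h]]] := lp (j k.+1); have [L' [r' [L'0 r'0 h']]] := lp (j k).
    exists (L + L'), (Num.max r r'); split; [exact: addr_ge0|by rewrite lt_max r0|exact: lip_suppB].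
  exists L, r; split => //; split=> [x y|x xr]; last by rewrite gL.2// normr0.
  by rewrite (le_trans (ler_dist_dist _ _))//; exact: gL.1.
(* The first bound keeps the Besov norm of [psi k] of order 4^-k; the second makes the pointwise
   errors sum to at most 1/2. *)
pose e k : R := Num.min (c * 4^-1 ^+ k) (4^-1 * 2^-1 ^+ k).
have e0 k : 0 < e k by rewrite lt_min !mulr_gt0// ?exprn_gt0 ?invr_gt0.
have /choice[psi Hpsi] : forall k, exists psi, [/\ test_function psi,
    forall x, `|psi x - `|g k x| | <= e k,
    (besov_norm p beta psi <= (9 * c * 4^-1 ^+ k)%:E)%E & forall x, 0 <= psi x].
  move=> k; have [L [r [L0 r0 gL]]] := glip k.
  have [psi [tpsi [L' [r' [_ _ psiL]]] psig bpsi psi0]] :=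
    besov_approx p1 beta0 beta1 L0 r0 gL (e0 k).
  exists psi; split => //; last by apply: psi0.
  have cg : continuous (fun x => `|g k x|) := lip_supp_continuous gL.
  have cgk : continuous (g k).
    case: (k) => [|k'] x; rewrite /g; first exact: cphi.
    by apply: (continuousB (f := phi (j k'.+1)) (g := phi (j k'))); exact: cphi.
  have cpg : continuous (psi \- (fun x => `|g k x|)).
    move=> x; apply: (continuousB (f := psi) (g := fun x => `|g k x|)); last exact: cg.
    exact: (lip_supp_continuous psiL).
  rewrite (_ : psi = (psi \- (fun x => `|g k x|)) \+ (fun x => `|g k x|)); last first.
    by apply/funext => x /=; rewrite subrK.
  apply: (le_trans (besov_normD beta p1 n0 cpg cg)).
  have hn : (besov_norm p beta (fun x => `|g k x|)%R <= (8 * c * 4^-1 ^+ k)%:E)%E.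
    have hL (u v : R) : `| `|u| - `|v| | <= 1 * `|u - v| by rewrite mul1r ler_dist_dist.
    apply: (le_trans (besov_norm_contract beta p1 cgk ler01 hL)).
    by rewrite mul1e.
  apply: (le_trans (leeD bpsi hn)); rewrite -EFinD lee_fin.
  have : e k <= c * 4^-1 ^+ k by rewrite ge_min lexx.
  lra.
pose lam k : R := a0 * 2^-1 ^+ k.
have lam0 k : 0 < lam k by rewrite mulr_gt0// exprn_gt0// invr_gt0.
pose E k := [set z : half_space R n | lam k < `|cs_extension s (psi k) (val z).1 (val z).2|].
have muE k : (mu (E k) <= ((9 * K * c / a0) `^ q0 * (2^-1 `^ q0) ^+ k)%:E)%E.
  have [tpsi _ bpsi _] := Hpsi k.
  have M0 : 0 <= K * (9 * c * 4^-1 ^+ k).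
    by rewrite mulr_ge0// mulr_ge0 ?exprn_ge0// mulr_ge0// ltW.
  have hw : (weak_norm q0 mu (fun z => cs_extension s (psi k) (val z).1 (val z).2) <=
      (K * (9 * c * 4^-1 ^+ k))%:E)%E.
    by rewrite EFinM (le_trans (H _ tpsi))// lee_wpmul2l// lee_fin.
  apply: (le_trans (weak_norm_level q00 (lam0 k) M0 hw)).
  rewrite lee_fin le_eqVlt; apply/orP; left; apply/eqP.
  rewrite (_ : (2^-1 `^ q0) ^+ k = (2^-1 ^+ k) `^ q0 :> R); last first.
    by rewrite -(powR_mulrn k (_ : 0 <= 2^-1))// -powRrM mulrC powRrM powR_mulrn ?powR_ge0.
  rewrite -powRM ?exprn_ge0//; last by rewrite divr_ge0 ?(ltW a00)// mulr_ge0 ?(ltW c0)// mulr_ge0.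
  congr (_ `^ _); rewrite (_ : 4^-1 = 2^-1 * 2^-1 :> R); last by rewrite -invfM -natrM.
  rewrite exprMn /lam; have : (2^-1 ^+ k : R) != 0 by rewrite expf_neq0// invr_neq0.
  by move: (2^-1 ^+ k) => u u0; field; rewrite u0 gt_eqF.
have cover : tent O `<=` \bigcup_k E k.
  move=> z zO; apply: contrapT => zE.
  have {zE}zE k : `|cs_extension s (psi k) (val z).1 (val z).2| <= lam k.
    by rewrite leNgt; apply/negP => h; apply: zE; exists k.
  have {}zO : euclid_ball (val z).1 (val z).2 `<=` O by [].
  move: zO zE (valP z); case: (val z) => x t /= zO zE t0.
  pose rho := t / n.+1%:R.
  have rho0 : 0 < rho by rewrite divr_gt0.
  pose Q : set 'rV[R]_n := ball x rho.
  have mQ : measurable Q by exact: measurable_rV_ball.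
  have muQ : lebesgue_rV n Q = ((2 * rho) ^+ n)%:E by exact: lebesgue_rV_ball.
  pose q := (2 * rho) ^+ n.
  have q_gt0 : 0 < q by rewrite exprn_gt0// mulr_gt0.
  have fQ y : Q y -> 1 <= f y.
    move=> /ballP xy; have Ny : N y.
      apply: interior_subset; apply: ON; apply: zO; rewrite /euclid_ball/=.
      have xyr : `|y - x| <= rho by rewrite distrC; exact: ltW.
      apply: (le_lt_trans (euclid_norm_le _)).
      apply: (@le_lt_trans _ _ (n%:R * rho)); first by rewrite ler_wpM2l.
      by rewrite /rho mulrCA gtr_pMr// ltr_pdivrMr ?ltr0n// mul1r ltr_nat.
    by have := Nf _ Ny; rewrite indicE mem_set.
  (* The index depends on the point of the tent, which is harmless: membership in the union asks for
     some [k] only. *)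
  have [M HM] : exists M, forall k, (M <= k)%N ->
      (\int[lebesgue_rV n]_(y in [set y : 'rV[R]_n | (`|y| <= `|x| + rho)%R])
        `|(phi k y - f y)%:E| < (q / 4)%:E)%E.
    apply: cvge0_lt; last by rewrite divr_gt0.
    exact/phi1/compact_norm_le.
  have mphif k D : measurable_fun D (fun y => (`|phi k y - f y|)%:E).
    apply/measurable_funTS/measurable_EFinP; apply: measurableT_comp => //.
    by apply: (measurable_funB (f := phi k) (g := f)) => //; exact: continuous_measurable_rV.
  have hQ : (\int[lebesgue_rV n]_(y in Q) (`|phi (j M) y - f y|)%:E <= (q / 4)%:E)%E.
    apply: le_trans (ltW (HM (j M) (Hj M).1)).
    apply: ge0_subset_integral => //.
    - have [mK _] := compact_rV_finite (@compact_norm_le R n (`|x| + rho)); exact: mK.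
    - move=> y /ballP xy /=; have := ler_normD (y - x) x; rewrite subrK distrC.
      by move: xy; lra.
  (* Here [f y >= 1] and [phi (j M)] is the telescoped sum of the [g k]; the missing half pays for
     the errors [e k]. *)
  have psi_sum y : Q y -> 2^-1 <= \sum_(0 <= k < M.+1) psi k y + `|phi (j M) y - f y|.
    move=> Qy; have fy := fQ _ Qy.
    have tele : phi (j M) y = \sum_(0 <= k < M.+1) g k y.
      rewrite big_nat_recl//=; elim: (M) => [|i IH]; first by rewrite big_geq// addr0.
      by rewrite big_nat_recr//= addrA -IH addrC subrK.
    have h1 : `|phi (j M) y| <= \sum_(0 <= k < M.+1) (psi k y + 4^-1 * 2^-1 ^+ k).
      rewrite tele (le_trans (ler_norm_sum _ _ _))//; apply: ler_sum => k _.
      have [_ /(_ y) + _ _] := Hpsi k; rewrite ler_norml => /andP[h _].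
      have : e k <= 4^-1 * 2^-1 ^+ k by rewrite ge_min lexx orbT.
      lra.
    have h2 : \sum_(0 <= k < M.+1) (4^-1 * 2^-1 ^+ k) <= 2^-1 :> R.
      rewrite -mulr_sumr; have h21 : (2^-1 : R) < 1 by lra.
      have h20 : 0 <= (2^-1 : R) by [].
      have := sum_geometric_le M.+1 h20 h21; rewrite (_ : (1 - 2^-1)^-1 = 2 :> R); last by field.
      lra.
    move: h1; rewrite big_split/= => h1.
    have h3 := ler_norm (phi (j M) y); have h4 := ler_norm (f y - phi (j M) y); rewrite distrC in h4.
    lra.
  pose w := kernel_min (n := n) s / t ^+ n.
  have w0 : 0 < w by rewrite divr_gt0 ?kernel_min_gt0// exprn_gt0.
  have mpsi k D : measurable_fun D (fun y => (psi k y)%:E).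
    apply/measurable_funTS/measurable_EFinP.
    by have [tk _ _ _] := Hpsi k; have [_ []] := test_function_bounded tk.
  have psi0 k y : 0 <= psi k y by have [_ _ _] := Hpsi k.
  have Ipsi k : (w%:E * \int[lebesgue_rV n]_(y in Q) (psi k y)%:E <= (lam k)%:E)%E.
    have [tk _ _ _] := Hpsi k; have [_ bpsi] := test_function_bounded tk.
    apply: le_trans (cs_extension_ge x bpsi (psi0 k) t0) _.
    by rewrite lee_fin (le_trans (ler_norm _)).
  have tot : ((q / 2)%:E <= \sum_(0 <= k < M.+1) \int[lebesgue_rV n]_(y in Q) (psi k y)%:E +
      \int[lebesgue_rV n]_(y in Q) (`|phi (j M) y - f y|)%:E)%E.
    have -> : (q / 2)%:E = (\int[lebesgue_rV n]_(y in Q) (2^-1)%:E)%E.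
      by rewrite integral_cst// [X in (_ * X)%E]muQ -EFinM mulrC.
    rewrite -ge0_integral_sum//; last by move=> k y _; rewrite lee_fin.
    rewrite -ge0_integralD//; last 2 first.
    - by move=> y _; apply: sume_ge0 => k _; rewrite lee_fin.
    - exact: emeasurable_sum.
    apply: ge0_le_integral => //.
    - by apply: emeasurable_funD => //; exact: emeasurable_sum.
    - by move=> y Qy; rewrite sumEFin -EFinD lee_fin; exact: psi_sum.
  (* The thresholds [lam k] sum to at most [2 * a0]. As [w * q = 16 * a0], this reads
     [8 * a0 <= 6 * a0], a contradiction. *)
  have fin : ((w * (q / 2))%:E <= (2 * a0 + w * (q / 4))%:E)%E.
    rewrite EFinM; apply: (le_trans (lee_wpmul2l _ tot)); first by rewrite lee_fin ltW.
    rewrite ge0_muleDr; last 2 first.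
    - by apply: sume_ge0 => k _; apply: integral_ge0 => y _; rewrite lee_fin.
    - by apply: integral_ge0 => y _; rewrite lee_fin.
    rewrite EFinD; apply: leeD; last first.
      by rewrite [leRHS]EFinM; apply: lee_wpmul2l; [rewrite lee_fin ltW|exact: hQ].
    rewrite ge0_sume_distrr; last by move=> k _; apply: integral_ge0 => y _; rewrite lee_fin.
    apply: (@le_trans _ _ (\sum_(0 <= k < M.+1) (lam k)%:E)%E); first exact: lee_sum.
    rewrite sumEFin lee_fin /lam -mulr_sumr mulrC ler_wpM2r ?(ltW a00)//.
    have h21 : (2^-1 : R) < 1 by lra.
    have h20 : 0 <= (2^-1 : R) by [].
    by have := sum_geometric_le M.+1 h20 h21; rewrite (_ : (1 - 2^-1)^-1 = 2 :> R); last by field.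
  have wq : w * q = 16 * a0.
    have -> : q = t ^+ n * (2 / n.+1%:R) ^+ n by rewrite /q /rho mulrCA exprMn.
    have t0' : t ^+ n != 0 by rewrite expf_neq0// gt_eqF.
    rewrite /w /a0; move: (kernel_min s) (t ^+ n) t0' ((2 / n.+1%:R) ^+ n) => a u u0 v.
    by field; exact: u0.
  have e2 : w * (q / 2) = 8 * a0 by rewrite mulrA wq; field.
  have e4 : w * (q / 4) = 4 * a0 by rewrite mulrA wq; field.
  move: fin a00; rewrite lee_fin e2 e4; move: a0 => a1 h1 h2; lra.
apply: (le_trans (le_outer_measure mu _ _ cover)).
apply: (le_trans (outer_measure_sigma_subadditive mu E)).
apply: (@le_trans _ _ (\sum_(k <oo) ((9 * K * c / a0) `^ q0 * (2^-1 `^ q0) ^+ k)%:E)%E).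
  by apply: lee_nneseries => k *; [exact: outer_measure_ge0|exact: muE].
apply: nneseries_geometric_le; rewrite ?powR_ge0//.
have := @gt0_ltr_powR R q0 q00 2^-1 1; rewrite powR1; apply; rewrite ?nnegrE//.
by rewrite invf_lt1// ltr1n.
Qed.

Lemma weak_type_to_capacity (q0 K : R) (mu : {outer_measure set (half_space R n) -> \bar R}) :
  0 < q0 -> 0 <= K ->
  (forall g, test_function g ->
     (weak_norm q0 mu (fun z => cs_extension s g (val z).1 (val z).2)
        <= K%:E * besov_norm p beta g)%E) ->
  exists C' : R, forall O : set 'rV[R]_n, open O ->
     (mu (tent O) <= C'%:E * (besov_capacity p beta O) `^ (q0 / p))%E.
Proof.
move=> q00 K0 H.
pose B := (9 * K / a0) `^ q0 / (1 - 2^-1 `^ q0).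
have B0 : 0 <= B.
  rewrite divr_ge0 ?powR_ge0// subr_ge0.
  have := @ge0_ler_powR R q0 (ltW q00) 2^-1 1; rewrite powR1; apply; rewrite ?nnegrE//.
  by rewrite invf_le1// ler1n.
have B10 : 0 < B + 1 by rewrite ltr_wpDl.
have qp0 : 0 < q0 / p by rewrite divr_gt0.
(* The infimum need not be attained and may be 0; the excess over [B] gives the strict room needed
   to approach it from above. *)
exists (B + 1) => O oO.
have tentB (c : R) : 0 < c -> (besov_capacity p beta O < c%:E)%E ->
    (mu (tent O) <= (B * c `^ (q0 / p))%:E)%E.
  move=> c0 /ereal_inf_lt[_ [f [bf cf [N [ON Nf]]] <-] fc].
  have bn0 : (0 <= besov_norm p beta f)%E by exact: besov_norm_ge0.
  have c'0 : 0 < c `^ p^-1 by rewrite powR_gt0.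
  have fc' : (besov_norm p beta f <= (c `^ p^-1)%:E)%E.
    have pn0 : p != 0 by rewrite gt_eqF.
    rewrite -(poweRe1 bn0) -(mulfV pn0) poweRrM -poweR_EFin.
    by apply: lee_poweR; rewrite ?invr_ge0 ?(ltW p0)//; [exact: poweR_ge0|exact: ltW].
  apply: (le_trans (tent_le q00 K0 H bf cf ON Nf c'0 fc')).
  rewrite lee_fin le_eqVlt; apply/orP; left; apply/eqP.
  rewrite mulrAC powRM ?powR_ge0//; last by rewrite divr_ge0 ?(ltW a00)// mulr_ge0.
  by rewrite -powRrM [p^-1 * q0]mulrC /B mulrAC.
have cap0 : (0 <= besov_capacity p beta O)%E.
  by apply: le_ereal_inf_tmp => _ [g _ <-]; exact: poweR_ge0.
move: tentB cap0; case: (besov_capacity p beta O) => [r| |//] tentB cap0; last first.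
  by rewrite poweRyr ?gt_eqF// gt0_muley ?leey// lte_fin.
rewrite lee_fin in cap0; rewrite leNgt; apply/negP => Hlt.
have mu_fin : mu (tent O) \is a fin_num.
  rewrite ge0_fin_numE; last exact: outer_measure_ge0.
  have r1 : 0 < r + 1 by rewrite ltr_wpDl.
  apply: le_lt_trans (tentB _ r1 _) (ltry _).
  by rewrite lte_fin ltrDl.
move: Hlt tentB; rewrite -(fineK mu_fin); move: (fine _) => v.
rewrite poweR_EFin -EFinM lte_fin => vr tentB.
have v0 : 0 < v by apply: le_lt_trans vr; rewrite mulr_ge0 ?powR_ge0// ltW.
(* The power [q0 / p] of [c] is [v / (B + 1)]: the assumed failure says [r < c], and [tentB] then
   yields [v <= B * v / (B + 1)], impossible for [v > 0]. *)
pose c := (v / (B + 1)) `^ (q0 / p)^-1.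
have c0 : 0 < c by rewrite powR_gt0// divr_gt0.
have rc : r < c.
  have -> : r = (r `^ (q0 / p)) `^ (q0 / p)^-1 by rewrite -powRrM mulfV ?gt_eqF// powRr1.
  rewrite gt0_ltr_powR ?invr_gt0 ?nnegrE ?powR_ge0// ?divr_ge0 ?(ltW v0) ?(ltW B10)//.
  by rewrite ltr_pdivlMr// mulrC.
have := tentB c c0; rewrite lte_fin => /(_ rc).
rewrite lee_fin /c -powRrM mulVf ?gt_eqF// powRr1 ?divr_ge0 ?(ltW v0) ?(ltW B10)//.
apply/negP; rewrite -ltNge mulrA ltr_pdivrMr// mulrDr mulr1 mulrC.
by rewrite ltrDl.
Qed.

End weak_type_to_capacity.

Theorem theorem4p3 (R : realType) (n : nat) (s beta p q0 : R)
    (mu : {outer_measure set (half_space R n) -> \bar R}) :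
  (1 <= n)%N -> 0 < s -> s < 2 -> 0 < beta -> beta < 1 ->
  1 < p -> p < n%:R / beta -> 0 < q0 ->
  (exists C : R, forall f : 'rV[R]_n -> R, test_function f ->
     (weak_norm q0 mu (fun z => cs_extension s f (val z).1 (val z).2)
        <= C%:E * besov_norm p beta f)%E)
  <->
  (exists C' : R, forall O : set 'rV[R]_n, open O ->
     (mu (tent O) <= C'%:E * (besov_capacity p beta O) `^ (q0 / p))%E).
Proof.
move=> n0 s0 _ b0 b1 p1 _ q00; split=> [[C HC]|[C' HC']].
  (* The given [C] may be negative; its absolute value serves as well because the Besov norm is
     nonnegative. *)
  apply: (weak_type_to_capacity (beta := beta) (s := s) p1 b0 b1 s0 n0 q00 (normr_ge0 C)) => g tg.
  apply: (le_trans (HC g tg)); apply: lee_wpmul2r; last by rewrite lee_fin ler_norm.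
  exact: besov_norm_ge0.
exists (`|C'| `^ q0^-1 * (2 * ntmax_const (n := n) p s)) => f tf.
exact: capacity_to_weak_type HC' _ tf.
Qed.
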